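(* Let $K$ be an infinite field, $\mathsf{M}$ a matroid on $[n]$, $E=K\langle e_1,\dots,e_n\rangle$ and $J$ the Orlik–Solomon ideal of $\mathsf{M}$. Then $J$ has an $m$-linear projective resolution if and only if $\mathsf{M}$ satisfies one of the following: (i) $\mathsf{M}$ has a loop and $m=0$; (ii) $\mathsf{M}$ has no loops but has a non-trivial parallel class, $m=1$, and $\mathsf{M}=U_{1,n_1}\oplus\dots\oplus U_{1,n_k}\oplus U_{f,f}$ for some $k,f\geq0$ (direct sum over a partition of $[n]$ into sets of sizes $n_1,\dots,n_k,f$); (iii) $\mathsf{M}$ is simple and $\mathsf{M}=U_{m,n-f}\oplus U_{f,f}$ for some $0\leq f\leq n$ (direct sum over a partition of $[n]$ into sets of sizes $n-f$ and $f$).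
   Context: A matroid on $[n]$ is a nonempty family of subsets of $[n]$ (independent sets) containing $\emptyset$, closed under subsets, satisfying the exchange axiom; other subsets are dependent, minimal dependent sets are circuits. A loop is an $i$ with $\{i\}$ dependent; $i,j$ are parallel if $\{i,j\}$ is a circuit; a parallel class is a maximal set of pairwise parallel elements, non-trivial if it has at least two elements; $\mathsf{M}$ is simple if it has no loops and no non-trivial parallel class. The uniform matroid $U_{a,b}$ on a $b$-element set has as independent sets all subsets of cardinality at most $a$. The direct sum $\mathsf{M}_1\oplus\mathsf{M}_2$ of matroids on disjoint ground sets has as independent sets the unions of an independent set of $\mathsf{M}_1$ and one of $\mathsf{M}_2$. $E$ is the standard graded exterior algebra; for $S=\{i_0<\dots<i_m\}$, $e_S=e_{i_0}\wedge\dots\wedge e_{i_m}$ and $\partial e_S=\sum_{j=0}^m(-1)^je_{S\setminus\{i_j\}}$ (so $\partial e_{\{i\}}=1$); the Orlik–Solomon ideal is $J=(\partial e_S:S\text{ dependent})$. A graded $E$-module $N$ has an $m$-linear projective resolution if $\dim_K\operatorname{Tor}^E_i(K,N)_{i+j}=0$ for all $i$ and all $j\neq m$. *)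

(* Defs.v *)
From HB Require Import structures.
From mathcomp Require Import all_boot all_order all_algebra.

Set Implicit Arguments.
Unset Strict Implicit.
Unset Printing Implicit Defensive.

Import Order.TTheory GRing.Theory Num.Theory.
Local Open Scope ring_scope.

(** * Matroids *)

Record matroid (T : finType) := Matroid {
  indep : {set {set T}};
  indep0 : set0 \in indep;
  indepS : forall A B : {set T}, A \subset B -> B \in indep -> A \in indep;
  indep_exchange : forall A B : {set T},
    A \in indep -> B \in indep -> (#|A| < #|B|)%N ->
    exists2 b, b \in B :\: A & b |: A \in indep
}.

Section MatroidTheory.
Variables (T : finType) (M : matroid T).

Definition dependent (S : {set T}) : bool := S \notin indep M.
Definition circuit (C : {set T}) : bool := minset dependent C.
Definition loop (i : T) : bool := dependent [set i].
Definition parallel (i j : T) : bool := (i != j) && circuit [set i; j].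
Definition pairwise_parallel (X : {set T}) : bool :=
  [forall i in X, forall j in X, (i != j) ==> parallel i j].
Definition parallel_class (X : {set T}) : bool := maxset pairwise_parallel X.

Definition has_loop : bool := [exists i, loop i].
Definition has_nontrivial_parallel_class : bool :=
  [exists X, parallel_class X && (1 < #|X|)%N].
Definition simple_matroid : bool :=
  ~~ has_loop && ~~ has_nontrivial_parallel_class.

End MatroidTheory.

(* Matroids with ground set a subset of T are given below by their families of
   independent sets.  [uniform a A] is U_{a,#|A|} on the ground set A; [a] may
   exceed #|A|, in which case every subset of A is independent. *)
Definition uniform (T : finType) (a : nat) (A : {set T}) : {set {set T}} :=
  [set I : {set T} | (I \subset A) && (#|I| <= a)%N].

Definition dsum (T : finType) (F G : {set {set T}}) : {set {set T}} :=
  [set I :|: J | I in F, J in G].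

(** * The exterior algebra *)

(* E = K<e_1, ..., e_n> as the space of families of coefficients in the basis
   (e_S), where S ranges over the subsets of [n]: x S is the coefficient of
   e_S in x.  A synonym of the function type, so that E does not get the
   pointwise product of functions. *)
Definition ext (K : fieldType) (n : nat) : Type := {ffun {set 'I_n} -> K}.

HB.instance Definition _ (K : fieldType) (n : nat) :=
  GRing.Lmodule.copy (ext K n) {ffun {set 'I_n} -> K^o}.

Section Ext.
Variables (K : fieldType) (n : nat).
Local Notation E := (ext K n).
Implicit Types (A B C S : {set 'I_n}) (x y z : E).

Definition ext_coef x S : K := (x : {ffun {set 'I_n} -> K}) S.

(* The number of inversions of the concatenation of the increasing lists of
   the elements of A and of B. *)
Definition ninv A B : nat := \sum_(a in A) \sum_(b in B) (b < a)%N.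

Definition ext_basis S : E := [ffun A : {set 'I_n} => (A == S)%:R].

(* e_A ^ e_B = (-1) ^ ninv A B e_{A u B} if A and B are disjoint, and 0
   otherwise; see [ext_basisM]. *)
Definition ext_mul x y : E :=
  [ffun S : {set 'I_n} => \sum_(A : {set 'I_n} | A \subset S)
     (-1) ^+ ninv A (S :\: A) * (ext_coef x A * ext_coef y (S :\: A))].

Lemma ext_coefP x y : (forall S, ext_coef x S = ext_coef y S) -> x = y.
Proof. by move=> h; apply/ffunP. Qed.

Lemma ext_coefD x y S : ext_coef (x + y) S = ext_coef x S + ext_coef y S.
Proof. by rewrite /ext_coef ffunE. Qed.

Lemma ext_coefZ (a : K) x S : ext_coef (a *: x) S = a * ext_coef x S.
Proof. by rewrite /ext_coef ffunE. Qed.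

Lemma ext_coef0 S : ext_coef 0 S = 0.
Proof. by rewrite /ext_coef ffunE. Qed.

Lemma ext_coef_basis A S : ext_coef (ext_basis A) S = (S == A)%:R.
Proof. by rewrite /ext_coef ffunE. Qed.

Lemma ext_coef_mul x y S : ext_coef (ext_mul x y) S =
  \sum_(A : {set 'I_n} | A \subset S)
     (-1) ^+ ninv A (S :\: A) * (ext_coef x A * ext_coef y (S :\: A)).
Proof. by rewrite /ext_coef ffunE. Qed.

Lemma ninv0l A : ninv set0 A = 0%N.
Proof. by rewrite /ninv big_set0. Qed.

Lemma ninv0r A : ninv A set0 = 0%N.
Proof. by rewrite /ninv big1 // => i _; rewrite big_set0. Qed.

Lemma ninvUl A B C : [disjoint A & B] ->
  ninv (A :|: B) C = (ninv A C + ninv B C)%N.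
Proof.
by move=> dAB; rewrite /ninv -bigU //; apply: eq_bigl => i; rewrite !inE.
Qed.

Lemma ninvUr A B C : [disjoint B & C] ->
  ninv A (B :|: C) = (ninv A B + ninv A C)%N.
Proof.
move=> dBC; rewrite /ninv -big_split; apply: eq_bigr => a _ /=.
by rewrite -bigU //; apply: eq_bigl => i; rewrite !inE.
Qed.

Lemma ext_mulA : associative ext_mul.
Proof.
move=> x y z; apply: ext_coefP => S; rewrite !ext_coef_mul.
transitivity (\sum_(A : {set 'I_n} | A \subset S)
   \sum_(B : {set 'I_n} | (A \subset B) && (B \subset S))
   (-1) ^+ (ninv A (B :\: A) + ninv A (S :\: B) + ninv (B :\: A) (S :\: B)) *
   (ext_coef x A * ext_coef y (B :\: A) * ext_coef z (S :\: B))).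
  apply: eq_bigr => A sAS; rewrite ext_coef_mul !mulr_sumr.
  rewrite (reindex_onto (fun B => B :\: A) (fun C => A :|: C)) /=; last first.
    move=> C sC; apply/setP => i; rewrite !inE.
    have /implyP := subsetP sC i; rewrite !inE.
    by case: (i \in A); case: (i \in C); case: (i \in S).
  apply: eq_big => [B|B].
    apply/idP/idP => [/andP[sB /eqP eB]|/andP[sAB sBS]].
      have sAB : A \subset B by rewrite -eB subsetUl.
      rewrite sAB -eB subUset sAS /=.
      by apply: subset_trans sB (subsetDl _ _).
    rewrite setSD //=; apply/eqP/setP => i; rewrite !inE.
    have /implyP := subsetP sAB i.
    by case: (i \in A); case: (i \in B).
  case/andP=> sB /eqP eB.
  have sAB : A \subset B by rewrite -eB subsetUl.
  have sBS : B \subset S.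
    by rewrite -eB subUset sAS (subset_trans sB (subsetDl _ _)).
  have eD : S :\: A :\: (B :\: A) = S :\: B.
    apply/setP => i; rewrite !inE; have /implyP := subsetP sAB i.
    by case: (i \in A); case: (i \in B).
  have eU : S :\: A = (B :\: A) :|: (S :\: B).
    apply/setP => i; rewrite !inE; have /implyP := subsetP sAB i.
    have /implyP := subsetP sBS i.
    by case: (i \in A); case: (i \in B); case: (i \in S).
  have dU : [disjoint B :\: A & S :\: B].
    rewrite -setI_eq0; apply/eqP/setP => i; rewrite !inE.
    by case: (i \in A); case: (i \in B); case: (i \in S).
  rewrite eD {1}eU ninvUr // !exprD -!mulrA.
  do 2!congr (_ * _).
  by rewrite mulrCA; congr (_ * _); rewrite mulrCA.
rewrite (exchange_big_dep (fun B : {set 'I_n} => B \subset S)) /=; last first.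
  by move=> A B _ /andP[].
apply: eq_bigr => B sBS; rewrite ext_coef_mul mulr_suml mulr_sumr.
apply: eq_big => [A|A /andP[sAS /andP[sAB _]]].
  rewrite sBS andbT; apply/andP/idP => [[]//|sAB]; split=> //.
  exact: subset_trans sAB sBS.
have eB : B = A :|: (B :\: A).
  apply/setP => i; rewrite !inE; have /implyP := subsetP sAB i.
  by case: (i \in A); case: (i \in B).
have dB : [disjoint A & B :\: A].
  by rewrite -setI_eq0; apply/eqP/setP => i; rewrite !inE; case: (i \in A).
have -> : ninv B (S :\: B) = (ninv A (S :\: B) + ninv (B :\: A) (S :\: B))%N.
  by rewrite {1}eB ninvUl.
by rewrite -addnA exprD -!mulrA mulrCA.
Qed.

Lemma ext_mul1l : left_id (ext_basis set0) ext_mul.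
Proof.
move=> x; apply: ext_coefP => S; rewrite ext_coef_mul.
rewrite (bigD1 set0) ?sub0set //= big1 => [|A /andP[_ /negPf nA]].
  by rewrite ext_coef_basis eqxx ninv0l setD0 !mul1r addr0.
by rewrite ext_coef_basis nA mul0r mulr0.
Qed.

Lemma ext_mul1r : right_id (ext_basis set0) ext_mul.
Proof.
move=> x; apply: ext_coefP => S; rewrite ext_coef_mul.
rewrite (bigD1 S) //= big1 => [|A /andP[sA nA]].
  by rewrite setDv ext_coef_basis eqxx ninv0r mul1r mulr1 addr0.
rewrite ext_coef_basis setD_eq0; case: (boolP (S \subset A)) => [sSA|_]; last by rewrite !mulr0.
by case/eqP: nA; apply/eqP; rewrite eqEsubset sA.
Qed.

Lemma ext_mulDl : left_distributive ext_mul +%R.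
Proof.
move=> x y z; apply: ext_coefP => S.
rewrite ext_coefD !ext_coef_mul -big_split; apply: eq_bigr => A _ /=.
by rewrite ext_coefD mulrDl mulrDr.
Qed.

Lemma ext_mulDr : right_distributive ext_mul +%R.
Proof.
move=> x y z; apply: ext_coefP => S.
rewrite ext_coefD !ext_coef_mul -big_split; apply: eq_bigr => A _ /=.
by rewrite ext_coefD mulrDr mulrDr.
Qed.

Lemma ext_1neq0 : ext_basis set0 != 0.
Proof.
apply/eqP => /(congr1 (fun x => ext_coef x set0)).
by rewrite ext_coef_basis ext_coef0 eqxx => /eqP; rewrite oner_eq0.
Qed.

HB.instance Definition _ := GRing.Zmodule_isNzRing.Build E
  ext_mulA ext_mul1l ext_mul1r ext_mulDl ext_mulDr ext_1neq0.

Lemma ext_coefM x y S : ext_coef (x * y) S =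
  \sum_(A : {set 'I_n} | A \subset S)
     (-1) ^+ ninv A (S :\: A) * (ext_coef x A * ext_coef y (S :\: A)).
Proof. exact: ext_coef_mul. Qed.

Lemma ext_scalerAl (a : K) x y : a *: (x * y) = (a *: x) * y.
Proof.
apply: ext_coefP => S; rewrite ext_coefZ !ext_coefM mulr_sumr.
by apply: eq_bigr => A _; rewrite ext_coefZ mulrCA !mulrA.
Qed.

Lemma ext_scalerAr (a : K) x y : a *: (x * y) = x * (a *: y).
Proof.
apply: ext_coefP => S; rewrite ext_coefZ !ext_coefM mulr_sumr.
apply: eq_bigr => A _; rewrite ext_coefZ mulrCA; congr (_ * _).
exact: mulrCA.
Qed.

HB.instance Definition _ := GRing.Lmodule_isLalgebra.Build K E ext_scalerAl.
HB.instance Definition _ := GRing.Lalgebra_isAlgebra.Build K E ext_scalerAr.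

Lemma ext_basisM A B : ext_basis A * ext_basis B =
  if [disjoint A & B] then (-1) ^+ ninv A B *: ext_basis (A :|: B) else 0.
Proof.
apply: ext_coefP => S; rewrite ext_coefM.
transitivity (\sum_(C : {set 'I_n} | (C \subset S) && (C == A))
    (-1) ^+ ninv C (S :\: C) * (S :\: C == B)%:R : K).
  rewrite big_mkcondr; apply: eq_bigr => C _; rewrite !ext_coef_basis.
  by case: eqP => _; rewrite ?mul1r // mul0r mulr0.
have [sAS|nAS] := boolP (A \subset S); last first.
  rewrite big1 => [|C /andP[sC /eqP eC]]; last by rewrite -eC sC in nAS.
  case: ifP => _; rewrite ?ext_coef0 // ext_coefZ ext_coef_basis.
  case: eqP => [eS|_]; last by rewrite mulr0.
  by rewrite eS subsetUl in nAS.
rewrite (big_pred1 A) => [|C /=]; last first.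
  by case: eqVneq => [->|_]; rewrite ?andbF ?sAS.
case: eqP => [eB|nB].
  have dAB : [disjoint A & B].
    by rewrite -eB -setI_eq0; apply/eqP/setP=> i; rewrite !inE; case: (i \in A).
  rewrite dAB ext_coefZ ext_coef_basis -eB.
  suff -> : A :|: S :\: A = S by rewrite eqxx.
  apply/setP => i; rewrite !inE; have /implyP := subsetP sAS i.
  by case: (i \in A).
rewrite mulr0; case: ifP => [dAB|_]; last by rewrite ext_coef0.
rewrite ext_coefZ ext_coef_basis; case: eqP => [eS|_]; last by rewrite mulr0.
case: nB; rewrite eS; apply/setP => i; rewrite !inE.
case iB: (i \in B); last by case: (i \in A).
by rewrite (disjointFl dAB iB).
Qed.

Definition ext_gen (i : 'I_n) : E := ext_basis [set i].

Lemma ext_basis_prod S : ext_basis S = \prod_(i in S) ext_gen i.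
Proof.
rewrite -big_filter deprecated_filter_index_enum -/(enum S).
have : sorted (fun i j : 'I_n => i < j)%N (enum S).
  rewrite /enum_mem (@sorted_filter _ _ (fun y x z : 'I_n => @ltn_trans y x z)) //.
  by have := iota_ltn_sorted 0 n; rewrite -val_enum_ord enumT sorted_map.
have -> : ext_basis S = ext_basis [set i in enum S].
  by congr ext_basis; apply/setP => i; rewrite inE mem_enum.
elim: (enum S) => [|i s IHs] /=.
  rewrite big_nil => _; change (1 : E) with (ext_basis set0).
  by congr ext_basis; apply/setP => j; rewrite !inE.
rewrite (path_sortedE (fun y x z : 'I_n => @ltn_trans y x z)).
case/andP=> /allP lti /IHs es.
rewrite big_cons -es /ext_gen ext_basisM.
have -> : [disjoint [set i] & [set j in s]].
  rewrite disjoints1 inE; apply/negP => /lti; by rewrite ltnn.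
rewrite /ninv big_set1 big1 => [|j]; last first.
  by rewrite inE => /lti /ltnW; rewrite ltnNge => ->.
by rewrite scale1r; congr ext_basis; apply/setP => j; rewrite !inE.
Qed.

(* The zero element is homogeneous of every degree. *)
Definition homogeneous (d : int) x : Prop :=
  forall S, ext_coef x S != 0 -> #|S|%:Z = d.

(* The augmentation E -> E / (e_1, ..., e_n) = K. *)
Definition ext_aug x : K := ext_coef x set0.

(* [#|[set j in S | (j < i)%N]|] is the position of i in the increasing
   enumeration of S, starting from 0. *)
Definition ext_partial S : E :=
  \sum_(i in S) (-1) ^+ #|[set j in S | (j < i)%N]| *: ext_basis (S :\ i).

End Ext.

(* The two-sided ideal generated by G, whose elements are the finite sums of
   products a * g * b with g in G. *)
Definition ideal_gen (R : pzRingType) (G : R -> Prop) (x : R) : Prop :=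
  exists2 s : seq (R * R * R), {in s, forall t, G t.1.2}
    & x = \sum_(t <- s) t.1.1 * t.1.2 * t.2.

Definition orlik_solomon_ideal (K : fieldType) (n : nat) (M : matroid 'I_n) :
    ext K n -> Prop :=
  ideal_gen (fun x => exists2 S, dependent M S & x = ext_partial K S).

(** * Graded free resolutions and Tor *)

Section Resolution.
Variables (K : fieldType) (n : nat) (N : ext K n -> Prop).
Local Notation E := (ext K n).

(* A resolution ... -> F_2 -> F_1 -> F_0 -> N -> 0 of a graded left ideal N of
   E by graded free left E-modules of finite rank, with maps homogeneous of
   degree 0.  F_i has a basis of [fr_rank i] elements of degrees
   [fr_degree i]; its elements are row vectors, on which a map acts by right
   multiplication by its matrix, so that row k of [fr_diff i] is the image in
   F_i of the basis element k of F_(i+1). *)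
Record graded_free_resolution := GradedFreeResolution {
  fr_rank : nat -> nat;
  fr_degree : forall i, 'I_(fr_rank i) -> int;
  fr_aug : 'cV[E]_(fr_rank 0);
  fr_diff : forall i, 'M[E]_(fr_rank i.+1, fr_rank i);
  fr_aug_homogeneous : forall k,
    homogeneous (fr_degree k) (fr_aug k 0);
  fr_diff_homogeneous : forall i k l,
    homogeneous (fr_degree k - fr_degree l) (fr_diff i k l);
  fr_aug_image : forall x : E,
    N x <-> exists v : 'rV[E]_(fr_rank 0), x = (v *m fr_aug) 0 0;
  fr_exact0 : forall v : 'rV[E]_(fr_rank 0),
    v *m fr_aug = 0 <-> exists w, v = w *m fr_diff 0;
  fr_exactS : forall i (v : 'rV[E]_(fr_rank i.+1)),
    v *m fr_diff i = 0 <-> exists w, v = w *m fr_diff i.+1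
}.

Variable F : graded_free_resolution.

(* The complex K (x)_E F: its term in homological degree i is K^(fr_rank i),
   again written as row vectors, and its differentials are those of F with
   entries reduced along the augmentation. *)
Definition tensor_diff (i : nat) : 'M[K]_(fr_rank F i.+1, fr_rank F i) :=
  map_mx (@ext_aug K n) (fr_diff F i).

(* The subspaces of K^(fr_rank i) below are the row spaces of the matrices. *)

(* The component of internal degree d, spanned by the basis elements of
   degree d. *)
Definition tensor_degree (i : nat) (d : int) : 'M[K]_(fr_rank F i) :=
  diag_mx (\row_k (fr_degree k == d)%:R).

Definition tensor_kernel (i : nat) : 'M[K]_(fr_rank F i) :=
  match i with
  | 0 => 1%:M
  | i'.+1 => kermx (tensor_diff i')
  end.

Definition tensor_cycles (i : nat) (d : int) : 'M[K]_(fr_rank F i) :=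
  (tensor_degree i d :&: tensor_kernel i)%MS.

Definition tensor_boundaries (i : nat) (d : int) :
    'M[K]_(fr_rank F i.+1, fr_rank F i) :=
  tensor_degree i.+1 d *m tensor_diff i.

(* dim_K Tor^E_i(K, N)_d = dim_K H_i(K (x)_E F)_d; [:\:] is a complement of
   the (contained) space of boundaries in the space of cycles. *)
Definition tor_dim (i : nat) (d : int) : nat :=
  \rank (tensor_cycles i d :\: tensor_boundaries i d)%MS.

End Resolution.

(* The dimensions of the graded components of Tor^E(K, N) do not depend on the
   graded free resolution from which they are computed. *)
Definition linear_resolution (K : fieldType) (n m : nat) (N : ext K n -> Prop) :
    Prop :=
  exists F : graded_free_resolution N,
    forall (i : nat) (j : int), j != m%:Z -> tor_dim F i (i%:Z + j) = 0%N.

(* Main.v *)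
Require Import Defs.
From HB Require Import structures.
From mathcomp Require Import all_boot all_order all_algebra zify.
From Stdlib Require Import IndefiniteDescription.

(* A graded ideal of E is studied through the functionals vanishing on it, and
   families of functionals indexed by exponents are the coefficients of polynomials
   in variables x_j dual to a basis w_j of the linear forms. Multiplying such a
   polynomial by the sum of the x_j w_j is a differential, and (E being Koszul) an
   ideal with an m-linear resolution has no homology for it in internal degrees at
   least m.

   If J has an m-linear resolution and M is neither free nor has a loop, then m + 1
   is the least size of a dependent set, and, K being infinite, generic linear
   forms act exactly on the functionals in degrees at least m. Let r be the rank of
   M. Since J contains all of E in degrees above r, cutting by s = r + 1 - m generic
   forms shows that at most C(n, m) - C(n - s, m) independent functionals of degree
   m vanish on J, so that dim J_m >= C(n - s, m). On the other hand dim J_m is at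
   most the number of m-sets completed to a dependent set by a smaller element,
   which deletion and contraction bound by the same binomial. Equality throughout
   the induction forces M to be U_{m,n-f} + U_{f,f}, or a sum of parallel classes if
   m = 1.

   Conversely, for these matroids J is stable under contraction with the indicator
   of each block, which makes multiplication by one generator e_b of each block
   exact; modulo these e_b the ideal J is everything in degree m. Hence there is no
   homology in degrees at least m, a property which implies generation in degree m
   and passes, with m replaced by 1, to the module of relations between the
   generators: this builds the resolution. *)

Set Implicit Arguments.
Unset Strict Implicit.
Unset Printing Implicit Defensive.

(** * Matroids *)

(** The given resolution need not be minimal, so linearity cannot be read off the degrees of its
    bases: it is used only through the vanishing homology of [K (x) F]. Functionals suit this well,
    because over a field a functional vanishing on the kernel of a map factors through the map,
    which replaces every lifting by freeness or minimality. The variables [x_j] turn a statement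
    about Tor into one about generic linear forms. Substituting scalars for them makes the
    differential multiplication by one linear form; exactness over the fraction field of the
    polynomial ring is a rank inequality, and ranks do not drop off a hypersurface. An infinite [K]
    provides a point off it. The number [s = r + 1 - m] is what it takes to lift a functional from
    degree [m], one degree per form, to degree [r + 1], where none vanishes on J except 0. The two
    bounds then meet because [n - s] is the nullity plus [m - 1]. The bound alone says little about
    the matroid; its equality case has to be carried through deletion and contraction, which is why
    the counting is done relative to a contracted set [C]. *)

Local Ltac revert_nat :=
  repeat match goal with
  | H : is_true (leq _ _) |- _ => revert H
  | H : @eq nat _ _ |- _ => revert H
  | H : ~ @eq nat _ _ |- _ => revert H
  end.
Local Ltac card_lia :=
  repeat (let z := fresh "z" in move: #|_| => z);
  repeat match goal with |- context [binomial ?p ?q] => generalize (binomial p q) end;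
  clear; intros; lia.

Section Rank.
Variables (T : finType) (M : matroid T).
Implicit Types (X Y I J C S : {set T}) (e x : T).

Definition rk X : nat := \max_(I in indep M | I \subset X) #|I|.

Local Ltac nat_lia := revert_nat;
  repeat match goal with |- context [rk ?X] => generalize (rk X) end; card_lia.

Lemma rk_ge I X : I \in indep M -> I \subset X -> #|I| <= rk X.
Proof. by move=> Ii IX; rewrite /rk (leq_bigmax_cond (P := fun I => (I \in indep M) && (I \subset X)) _) // Ii. Qed.

Lemma rk_basis X : exists I, [/\ I \in indep M, I \subset X & #|I| = rk X].
Proof.
have [|I /andP[Ii IX] e] := @eq_bigmax_cond _ (fun I : {set T} => (I \in indep M) && (I \subset X))
    (fun I => #|I|).
  by apply/card_gt0P; exists set0; rewrite unfold_in indep0 sub0set.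
by exists I.
Qed.

Lemma rk_mono X Y : X \subset Y -> rk X <= rk Y.
Proof.
move=> XY; have [I [Ii IX <-]] := rk_basis X.
by apply: rk_ge => //; apply: subset_trans XY.
Qed.

Lemma rk_card X : rk X <= #|X|.
Proof. by have [I [_ IX <-]] := rk_basis X; apply: subset_leq_card. Qed.

Lemma rk_indep I : (I \in indep M) = (rk I == #|I|).
Proof.
apply/idP/eqP => [Ii|e].
  by apply/eqP; rewrite eqn_leq rk_card rk_ge.
have [J [Ji JI cJ]] := rk_basis I.
by have /eqP <- : J == I by rewrite eqEcard JI cJ e leqnn.
Qed.

Lemma rk_extend I X : I \in indep M -> I \subset X ->
  exists J, [/\ J \in indep M, I \subset J, J \subset X & #|J| = rk X].
Proof.
move=> Ii IX; have [k] : {k | rk X - #|I| <= k} by exists (rk X - #|I|).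
elim: k I Ii IX => [|k IH] I Ii IX hk.
  exists I; split=> //; apply/eqP; rewrite eqn_leq rk_ge //.
  by rewrite leqn0 in hk.
have [lt|ge] := ltnP #|I| (rk X); last first.
  by exists I; split=> //; apply/eqP; rewrite eqn_leq rk_ge.
have [B [Bi BX cB]] := rk_basis X.
rewrite -cB in lt; have [b /setDP[bB bI] bi] := indep_exchange Ii Bi lt.
case: (IH (b |: I)) => // [||J [Ji IJ JX cJ]].
- by rewrite subUset sub1set (subsetP BX).
- by rewrite cardsU1 bI; nat_lia.
exists J; split=> //; by apply: subset_trans IJ; apply: subsetUr.
Qed.

Lemma rkU1 e X : rk (e |: X) <= (rk X).+1.
Proof.
have [I [Ii IX <-]] := rk_basis (e |: X).
have Ie : I :\ e \in indep M by apply: indepS Ii; apply: subsetDl.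
have : #|I :\ e| <= rk X.
  apply: rk_ge => //; apply/subsetP => x; rewrite !inE => /andP[xe /(subsetP IX)].
  by rewrite !inE (negPf xe).
by rewrite (cardsD1 e I); case: (e \in I); nat_lia.
Qed.

(** Closures are monotone. A basis of [X] extends to one of [Y]; if [e] raised the rank of [Y],
    exchange could only add [e] itself, and the basis of [X] together with [e] would be
    independent. *)
Lemma rk_closure e X Y : rk (e |: X) = rk X -> X \subset Y -> rk (e |: Y) = rk Y.
Proof.
move=> eX XY; apply/eqP; rewrite eqn_leq (rk_mono (subsetUr _ _)) andbT leqNgt.
apply/negP => lt; have [I [Ii IX cI]] := rk_basis X.
have [B [Bi IB BY cB]] := rk_extend Ii (subset_trans IX XY).
have [B' [B'i B'Y cB']] := rk_basis (e |: Y).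
have ltB : #|B| < #|B'| by rewrite cB cB'.
have [b /setDP[bB' bB] bi] := indep_exchange Bi B'i ltB.
have bY : b |: B \subset Y -> False.
  by move=> s; have := rk_ge bi s; rewrite cardsU1 bB cB; nat_lia.
have be : b = e.
  have := subsetP B'Y _ bB'; rewrite !inE => /predU1P[//|bY'].
  by case: bY; rewrite subUset sub1set bY'.
have eIi : e |: I \in indep M by apply: indepS bi; rewrite be setUS.
have := rk_ge eIi (setUS _ IX); rewrite eX cardsU1.
have -> : e \notin I by apply: contra bB; rewrite be => /(subsetP IB).
nat_lia.
Qed.

Lemma rkU X C : rk (X :|: C) <= #|X| + rk C.
Proof.
move: {2}#|X| (erefl #|X|) => k; elim: k X => [|k IH] X.
  by move/eqP; rewrite cards_eq0 => /eqP ->; rewrite set0U cards0.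
move=> sX; have /card_gt0P[e eX] : 0 < #|X| by rewrite sX.
rewrite -[X in rk (X :|: C)](setD1K eX) -setUA (leq_trans (rkU1 _ _)) //.
have cX : #|X :\ e| = k by move: sX; rewrite (cardsD1 e) eX => -[].
by rewrite sX addSn ltnS -cX IH.
Qed.

End Rank.

Lemma leq_add_eq a b c d : a <= c -> b <= d -> c + d <= a + b -> a = c /\ b = d.
Proof. lia. Qed.

(** * Broken sets under deletion and contraction *)

Section BrokenCircuits.
Variables (n : nat) (M : matroid 'I_n).
Local Notation rk := (rk M).
Implicit Types (X Y Z C S : {set 'I_n}) (c e x : 'I_n).

(** Every set of at most [m] elements of [X] is independent in the contraction by [C]. Contractions
    are recorded by [C] alone, [rk (Y :|: C) - rk C] being the rank there, so that one matroid
    serves the whole induction. *)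
Definition girth m C X := forall Y, Y \subset X -> #|Y| <= m -> rk (Y :|: C) = #|Y| + rk C.

(* The [m]-subsets of [X] completed to a dependent set of the contraction by [C]
   by an element smaller than all of theirs. *)
Definition broken m C X : {set {set 'I_n}} :=
  [set S : {set 'I_n} | [&& S \subset X, #|S| == m &
    [exists c in X, [forall x in S, (c < x)%N] && (rk (c |: S :|: C) == rk (S :|: C))]]].

Lemma brokenP m C X S : reflect
  [/\ S \subset X, #|S| = m & exists c, [/\ c \in X, forall x, x \in S -> c < x &
     rk (c |: S :|: C) = rk (S :|: C)]] (S \in broken m C X).
Proof.
rewrite inE; apply: (iffP and3P) => [[SX /eqP cS /existsP[c /and3P[cX /forall_inP cm /eqP e]]]|].
  by split=> //; exists c.
case=> SX cS [c [cX cm e]]; split=> //; first by apply/eqP.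
by apply/existsP; exists c; rewrite cX e eqxx andbT /=; apply/forall_inP.
Qed.

Local Ltac nat_lia :=
  repeat match goal with H : context [broken] |- _ => clear H end;
  revert_nat; repeat match goal with |- context [rk ?X] => generalize (rk X) end; card_lia.

(** The nullity of [X] in the contraction by [C]. Deleting an element that is not a coloop lowers it
    by one; contracting a non-loop keeps it. *)
Definition nullity C X := #|X| + rk C - rk (X :|: C).

Lemma broken_step m C X e : e \in X -> (forall x, x \in X -> x <= e) ->
  #|broken m.+1 C X| <= #|broken m.+1 C (X :\ e)| + #|broken m (e |: C) (X :\ e)|.
Proof.
move=> eX emax; set B1 := broken m.+1 C (X :\ e); set B2 := broken m _ _.
have : broken m.+1 C X \subset B1 :|: [set e |: S | S in B2].
  apply/subsetP => S /brokenP[SX cS [c [cX cm rc]]].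
  have ce : c != e.
    have /card_gt0P[x xS] : 0 < #|S| by rewrite cS.
    by rewrite neq_ltn (leq_trans (cm x xS)) ?emax // (subsetP SX).
  rewrite inE; case: (boolP (e \in S)) => eS; last first.
    rewrite (_ : S \in B1) //; apply/brokenP; split=> //; first by rewrite subsetD1 SX.
    by exists c; rewrite !inE ce.
  apply/orP; right; apply/imsetP; exists (S :\ e); last by rewrite setD1K.
  apply/brokenP; split; first exact: setSD.
    by move: cS; rewrite (cardsD1 e) eS => -[].
  exists c; split; first by rewrite !inE ce.
    by move=> x /setD1P[_]; apply: cm.
  have e1 : S :\ e :|: (e |: C) = S :|: C by rewrite setUCA setUA setD1K.
  by rewrite -setUA e1 setUA.
move/subset_leq_card/leq_trans; apply.
by rewrite (leq_trans (leq_card_setU _ _)) // leq_add2l leq_imset_card.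
Qed.

Lemma coloop_closure C X e Y : e \in X -> rk (X :|: C) <> rk (X :\ e :|: C) ->
  Y \subset X :\ e -> rk (e |: (Y :|: C)) != rk (Y :|: C).
Proof.
move=> eX col YX'; apply: contra_notN col => /eqP h.
rewrite -[X in X :|: C](setD1K eX) -setUA; apply: (rk_closure h).
exact: setSU.
Qed.

(** A broken set [S] cannot contain a coloop [e]: trading [e] for [c] gives [m.+1] elements,
    independent by girth, whose closure misses [e], so adding [c] to [S] would raise the rank. *)
Lemma broken_coloop m C X e : e \in X -> (forall x, x \in X -> x <= e) ->
  girth m.+1 C X -> rk (X :|: C) <> rk (X :\ e :|: C) ->
  #|broken m.+1 C X| <= #|broken m.+1 C (X :\ e)|.
Proof.
move=> eX emax gX /(coloop_closure eX) noc; set X' := X :\ e in noc *.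
have X'X : X' \subset X by apply: subsetDl.
apply/subset_leq_card/subsetP => S /brokenP[SX cS [c [cX0 cm rc]]].
have ce : c != e.
  have /card_gt0P[x xS] : 0 < #|S| by rewrite cS.
  by rewrite neq_ltn (leq_trans (cm x xS)) ?emax // (subsetP SX).
have [eS|eS] := boolP (e \in S); last first.
  by apply/brokenP; split=> //; [rewrite subsetD1 SX|exists c; rewrite !inE ce].
set S' := S :\ e; have SE : S = e |: S' by rewrite setD1K.
have S'X : S' \subset X' by apply: setSD.
have cS' : c \notin S' by apply/negP => /setD1P[_ /cm]; rewrite ltnn.
have csX : c |: S' \subset X' by rewrite subUset sub1set !inE ce cX0.
have ccs : #|c |: S'| = m.+1.
  by rewrite cardsU1 cS'; move: cS; rewrite (cardsD1 e S) eS -/S' add1n => -[->].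
have := noc (c |: S') csX.
rewrite (gX (c |: S')) ?ccs ?(subset_trans csX) //.
have -> : e |: (c |: S' :|: C) = c |: S :|: C by rewrite [in RHS]SE !setUA [c |: [set e]]setUC.
by rewrite rc gX ?cS // eqxx.
Qed.

(* Induction on the largest element [e], by deletion and contraction: the bound is
   Pascal's rule unless [e] is a coloop. *)
Lemma bc_bound k m C X : #|X| = k -> girth m C X ->
  #|broken m C X| <= 'C(nullity C X + m.-1, m) /\
  (0 < m -> #|broken m C X| = 'C(nullity C X + m.-1, m) ->
   forall Y, Y \subset X -> rk (Y :|: C) < #|Y| + rk C ->
   exists Z, [/\ Z \subset Y, #|Z| = m.+1 & rk (Z :|: C) <= m + rk C]).
Proof.
elim: k m C X => [|k IH] m C X.
  move/eqP; rewrite cards_eq0 => /eqP -> _.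
  have -> : broken m C set0 = set0.
    apply/setP => S; rewrite [RHS]inE; apply/brokenP => -[_ _ [c []]].
    by rewrite inE.
  rewrite cards0; split=> // _ _ Y; rewrite subset0 => /eqP ->.
  by rewrite set0U cards0 ltnn.
move=> cX gX; have /card_gt0P[e0 e0X] : 0 < #|X| by rewrite cX.
case: m gX => [|m] gX.
  rewrite bin0; split=> //; have : broken 0 C X \subset [set set0].
    by apply/subsetP => S /brokenP[_ /eqP]; rewrite cards_eq0 inE.
  by move/subset_leq_card; rewrite cards1.
have [e eX0 emax] := @arg_maxnP _ e0 (mem X) (fun x : 'I_n => x : nat) e0X.
have {eX0} eX : e \in X := eX0.
have {}emax x : x \in X -> x <= e by apply: emax.
set X' := X :\ e; have cX' : #|X'| = k by move: cX; rewrite (cardsD1 e) eX => -[].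
have X'X : X' \subset X by apply: subsetDl.
have XE : X = e |: X' by rewrite setD1K.
have rC : rk (e |: C) = (rk C).+1.
  by have := gX [set e]; rewrite sub1set cards1 add1n; apply.
have g1 : girth m.+1 C X' by move=> Y YX'; apply: gX; apply: subset_trans X'X.
have g2 : girth m (e |: C) X'.
  move=> Y YX' cY; rewrite rC setUCA setUA gX; last by rewrite cardsU1; case: (e \notin Y) => //; nat_lia.
    rewrite cardsU1; suff -> : e \notin Y by nat_lia.
    by apply/negP => /(subsetP YX'); rewrite !inE eqxx.
  by rewrite subUset sub1set eX (subset_trans YX').
have [b1 q1] := IH m.+1 C X' cX' g1; have [b2 q2] := IH m (e |: C) X' cX' g2.
have st := broken_step m C eX emax.
have XC : X :|: C = e |: (X' :|: C) by rewrite XE setUA.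
have X'C := rkU M X' C; rewrite cX' in X'C.
have [col|ncol] := eqVneq (rk (X :|: C)) (rk (X' :|: C)).
  have nu1 : nullity C X = (nullity C X').+1 by rewrite /nullity cX cX' col; nat_lia.
  have nu2 : nullity (e |: C) X' = nullity C X.
    by rewrite /nullity rC cX cX' setUCA -XC; nat_lia.
  have eb : 'C(nullity C X + m, m.+1) = 'C(nullity C X' + m, m.+1) + 'C(nullity (e |: C) X' + m.-1, m).
    rewrite nu2 nu1 addSn binS; congr (_ + _).
    by case: (m) => [|m']; rewrite ?bin0 //= addSnnS.
  rewrite /= in b1 q1 *; split; first by rewrite eb (leq_trans st) // leq_add.
  rewrite eb => _ eq; rewrite eq in st.
  have [E1 E2] : #|broken m.+1 C X'| = 'C(nullity C X' + m, m.+1) /\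
      #|broken m (e |: C) X'| = 'C(nullity (e |: C) X' + m.-1, m).
    exact: leq_add_eq b1 b2 st.
  move=> Y YX dY; have [eY|eY] := boolP (e \in Y); last first.
    by apply: (q1 isT E1 Y _ dY); rewrite subsetD1 YX.
  set Y' := Y :\ e; have YE : Y = e |: Y' by rewrite setD1K.
  have Y'X : Y' \subset X' by apply: setSD.
  have cY : #|Y| = #|Y'|.+1 by rewrite (cardsD1 e) eY.
  have [dY'|iY'] := ltnP (rk (Y' :|: C)) (#|Y'| + rk C).
    have [Z [ZY' cZ rZ]] := q1 isT E1 Y' Y'X dY'.
    by exists Z; split=> //; apply: subset_trans ZY' (subsetDl _ _).
  case: m => [|m] in gX g1 g2 b1 q1 b2 q2 st eb eq E1 E2 *; last first.
    have [|Z [ZY' cZ rZ]] := q2 isT E2 Y' Y'X.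
      by rewrite rC setUCA setUA -YE addnS -addSn -cY.
    have eZ : e \notin Z by apply/negP => /(subsetP ZY'); rewrite !inE eqxx.
    exists (e |: Z); split; last by rewrite -setUA setUCA; nat_lia.
      by rewrite subUset sub1set eY (subset_trans ZY') ?subsetDl.
    by rewrite cardsU1 eZ; nat_lia.
  (* The contraction has parameter 0 here, for which the induction says nothing about equality. But
     [broken 0] is nonempty, which gives an [f] parallel to [e] over [C] to stand in for [e]. *)
  rewrite bin0 in E2; have /card_gt0P[S /brokenP[_ /eqP]] : 0 < #|broken 0 (e |: C) X'| by rewrite E2.
  rewrite cards_eq0 => /eqP -> [f [fX' _]]; rewrite setU0 set0U => fe.
  have fne : f != e by move: fX'; rewrite !inE => /andP[].
  have pair : rk ([set e; f] :|: C) <= 1 + rk C.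
    by rewrite -setUA setUCA fe rC.
  have [fY|fY] := boolP (f \in Y).
    exists [set e; f]; split=> //; last by rewrite cards2 eq_sym fne.
    by apply/subsetP => x; rewrite !inE => /orP[] /eqP ->.
  have fY' : f \notin Y' by rewrite !inE negb_and fY orbT.
  have rf : rk (f |: C) = (rk C).+1.
    have := gX [set f]; rewrite sub1set cards1 add1n; apply=> //.
    by apply: (subsetP X'X).
  have ef : rk (e |: (f |: C)) = rk (f |: C) by rewrite setUCA fe rC rf.
  have fYd : rk ((f |: Y') :|: C) < #|f |: Y'| + rk C.
    have h1 : rk (e |: ((f |: Y') :|: C)) = rk ((f |: Y') :|: C).
      by apply: rk_closure ef _; rewrite setSU // subsetUl.
    have h2 : rk (f |: (Y :|: C)) = rk (Y :|: C).
      by apply: rk_closure fe _; rewrite setSU // sub1set.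
    have h3 : e |: ((f |: Y') :|: C) = f |: (Y :|: C) 
      by apply/setP => x; rewrite [in RHS]YE !inE; case: (x == f); rewrite ?orbT ?orbA.
    by rewrite -h1 h3 h2 cardsU1 fY' add1n -cY.
  have [|Z [ZY' cZ rZ]] := q1 isT E1 (f |: Y') _ fYd.
    by rewrite subUset sub1set fX'.
  (* [Y'] is independent over [C], so [Z] has to use [f], which is then exchanged for its parallel
     element [e]. *)
  have fZ : f \in Z.
    apply: contraT => fZ; have ZY : Z \subset Y'.
      apply/subsetP => x xZ; have := subsetP ZY' x xZ; rewrite !inE => /predU1P[xf|//].
      by rewrite -xf xZ in fZ.
    have := rkU M (Y' :\: Z) (Z :|: C); rewrite setUA.
    have -> : Y' :\: Z :|: Z = Y'.
      apply/setP => x; rewrite in_setU in_setD.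
      by case: (boolP (x \in Z)) => [/(subsetP ZY) ->|_]; rewrite ?orbF ?orbT.
    by have := cardsID Z Y'; rewrite (setIidPr ZY) cZ; nat_lia.
  exists (e |: Z :\ f); split.
  - apply/subsetP => x; rewrite !inE => /predU1P[->//|/andP[xf /(subsetP ZY')]].
    by rewrite !inE (negPf xf) => /andP[].
  - rewrite cardsU1 [e \in _]inE.
    have /negPf -> : e \notin Z.
      apply/negP => /(subsetP ZY'); rewrite !inE eqxx /= orbF => /eqP ef'.
      by rewrite ef' eqxx in fne.
    by rewrite andbF; have := cardsD1 f Z; rewrite fZ cZ /= => <-.
  have ZC : rk (e |: (Z :|: C)) = rk (Z :|: C).
    by apply: rk_closure ef _; rewrite subUset sub1set inE fZ subsetUr.
  apply: leq_trans rZ; rewrite -ZC -setUA; apply/rk_mono/setUS/setSU.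
  exact: subsetDl.
have noc := coloop_closure eX (elimN eqP ncol).
have rXC : rk (X :|: C) = (rk (X' :|: C)).+1.
  by have := rkU1 M e (X' :|: C); have := noc X' (subxx _); rewrite -XC; have := rk_mono M (setSU C X'X); nat_lia.
have nu : nullity C X = nullity C X' by rewrite /nullity cX cX' rXC; nat_lia.
have sub := broken_coloop eX emax gX (elimN eqP ncol).
rewrite /= in b1 q1 *; split; first by rewrite nu (leq_trans sub).
move=> _ eq; have E1 : #|broken m.+1 C X'| = 'C(nullity C X' + m, m.+1).
  by apply/eqP; rewrite eqn_leq b1 -nu -eq sub.
move=> Y YX dY; have [eY|eY] := boolP (e \in Y); last first.
  by apply: (q1 isT E1 Y _ dY); rewrite subsetD1 YX.
set Y' := Y :\ e; have YE : Y = e |: Y' by rewrite setD1K.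
have Y'X : Y' \subset X' by apply: setSD.
have cY : #|Y| = #|Y'|.+1 by rewrite (cardsD1 e) eY.
have [|Z [ZY' cZ rZ]] := q1 isT E1 Y' Y'X.
  have lt : rk (Y' :|: C) < rk (Y :|: C).
    by rewrite [in X in _ < X]YE -setUA ltn_neqAle eq_sym noc // rk_mono ?subsetUr.
  by rewrite cY in dY; nat_lia.
by exists Z; split=> //; apply: subset_trans ZY' (subsetDl _ _).
Qed.

(* Equality passes to the deletion and the contraction of the largest element [e];
   the latter shows that [e] lies in the closure of the set [A] obtained for the
   deletion. *)
Lemma uniform_part k m X : #|X| = k -> girth m.+2 set0 X ->
  #|broken m.+2 set0 X| = 'C(nullity set0 X + m.+1, m.+2) ->
  exists A : {set 'I_n}, [/\ A \subset X, rk A <= m.+2 & rk X = rk A + #|X :\: A|].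
Proof.
have rk0 : rk set0 = 0 by apply/eqP; rewrite -leqn0 -(cards0 'I_n) rk_card.
elim: k X => [|k IH] X cX gX eqX.
  move/eqP: cX; rewrite cards_eq0 => /eqP ->.
  by exists set0; rewrite sub0set rk0 setDv cards0.
have /card_gt0P[e0 e0X] : 0 < #|X| by rewrite cX.
have [e eX0 emax] := @arg_maxnP _ e0 (mem X) (fun x : 'I_n => x : nat) e0X.
have {eX0} eX : e \in X := eX0.
have {}emax x : x \in X -> x <= e by apply: emax.
set X' := X :\ e; have cX' : #|X'| = k by move: cX; rewrite (cardsD1 e) eX => -[].
have X'X : X' \subset X by apply: subsetDl.
have eX' : e \notin X' by rewrite !inE eqxx.
have XE : X = e |: X' by rewrite setD1K.
have g1 : girth m.+2 set0 X' by move=> Y YX'; apply: gX; apply: subset_trans X'X.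
have re : rk [set e] = 1.
  by have := gX [set e]; rewrite sub1set cards1 setU0 rk0 addn0; apply.
have g2 : girth m.+1 (e |: set0) X'.
  move=> Y YX' cY; have eY : e \notin Y by apply: contra eX'; apply: (subsetP YX').
  have := gX (Y :|: [set e]); rewrite !setU0 rk0 addn0 re setUC cardsU1 eY => ->; try nat_lia.
  by rewrite subUset sub1set eX (subset_trans YX').
(* The contraction has parameter [m.+1], which is positive, so its equality case is available as
   [q2]; this is where a parameter of at least two is needed. *)
have [b1 _] := bc_bound cX' g1; have [b2 q2] := bc_bound cX' g2.
have DX (A : {set 'I_n}) : A \subset X' -> #|X :\: A| = #|X' :\: A|.+1.
  move=> AX'; rewrite XE setDUl (setDidPl _) ?disjoints1; last first.
    by apply: contra eX'; apply: (subsetP AX').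
  by rewrite cardsU1 inE (negPf eX') andbF.
have rX' := rk_card M X'; rewrite cX' in rX'.
have rXX' := rk_mono M X'X; have := rkU1 M e X'; rewrite -XE => rX.
have [col|/eqP ncol] := eqVneq (rk X) (rk X'); last first.
  have rE : rk X = (rk X').+1.
    by apply/eqP; rewrite eqn_leq rX ltn_neqAle rXX' andbT eq_sym; apply/eqP.
  have nu : nullity set0 X = nullity set0 X' by rewrite /nullity cX cX' !setU0 rE rk0 !addn0 subSS.
  case: (IH X' cX' g1) => [|A [AX' rA eA]].
    apply/eqP; rewrite eqn_leq b1 -nu -eqX broken_coloop //.
    by rewrite !setU0.
  by exists A; split=> //; [apply: subset_trans X'X|rewrite DX //; nat_lia].
have {}col : rk X = rk X' := col.
have nu1 : nullity set0 X = (nullity set0 X').+1 by rewrite /nullity cX cX' !setU0 rk0; nat_lia.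
have nu2 : nullity (e |: set0) X' = nullity set0 X.
  by rewrite /nullity cX cX' !setU0 re rk0 [X' :|: _]setUC -XE; nat_lia.
have eb : 'C(nullity set0 X + m.+1, m.+2) =
    'C(nullity set0 X' + m.+1, m.+2) + 'C(nullity (e |: set0) X' + m, m.+1).
  by rewrite nu2 nu1 addSn binS addSnnS.
have st := broken_step m.+1 set0 eX emax; rewrite eqX eb in st.
have [E1 E2] : #|broken m.+2 set0 X'| = 'C(nullity set0 X' + m.+1, m.+2) /\
    #|broken m.+1 (e |: set0) X'| = 'C(nullity (e |: set0) X' + m, m.+1).
  exact: leq_add_eq b1 b2 st.
have [_ qX] := bc_bound cX gX; have {}qX := qX isT eqX.
have [A' [A'X rA' eA']] := IH X' cX' g1 E1.
have cA' := cardsID A' X'; rewrite (setIidPr A'X) in cA'.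
(* If [A'] is independent, so is [X'], and [X] has nullity one since [e] is no coloop. A dependent
   set of [m.+3] elements then absorbs the whole nullity and is the required set. *)
have [iA'|dA'] := eqVneq (rk A') #|A'|.
  have {}iA' : rk A' = #|A'| := iA'.
  have [|Z [ZX cZ]] := qX X (subxx _); first by rewrite setU0 rk0; nat_lia.
  rewrite setU0 rk0 addn0 => rZ; exists Z; split=> //.
  have := rkU M (X :\: Z) Z; have := cardsID Z X; rewrite (setIidPr ZX) cZ.
  have -> : X :\: Z :|: Z = X.
    apply/setP => x; rewrite in_setU in_setD.
    by case: (boolP (x \in Z)) => [/(subsetP ZX) ->|_]; rewrite ?orbF ?orbT.
  have gZ x : x \in Z -> m.+2 <= rk Z.
    move=> xZ; have cD : #|Z :\ x| = m.+2 by move: cZ; rewrite (cardsD1 x) xZ => -[].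
    have := gX (Z :\ x); rewrite cD setU0 rk0 addn0 => <- //; first exact/rk_mono/subsetDl.
    by rewrite (subset_trans (subsetDl _ _)).
  have /card_gt0P[x /gZ] : 0 < #|Z| by rewrite cZ.
  nat_lia.
have [|Z [ZA' cZ]] := qX A' (subset_trans A'X X'X).
  by rewrite setU0 rk0 addn0 ltn_neqAle dA' rk_card.
rewrite setU0 rk0 addn0 => rZ.
(* [Z] stays dependent when [e] is contracted. Hence [m.+2] of its elements, independent by girth,
   have [e] in their closure. *)
have [|G [GZ cG]] := q2 isT E2 Z (subset_trans ZA' A'X).
  by rewrite setU0 re [Z :|: _]setUC; have := rkU1 M e Z; nat_lia.
rewrite setU0 re addn1 [G :|: _]setUC => rG.
have GX' : G \subset X' by rewrite (subset_trans GZ) // (subset_trans ZA').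
have rG' : rk G = m.+2.
  by have := g1 G GX'; rewrite cG setU0 rk0 addn0; apply.
have eA : rk (e |: A') = rk A'.
  apply: (@rk_closure _ _ e G); last exact: subset_trans ZA'.
  by apply/eqP; rewrite eqn_leq rG' rG -rG' rk_mono ?subsetUr.
exists (e |: A'); split.
- by rewrite subUset sub1set eX (subset_trans A'X).
- by rewrite eA.
rewrite eA col eA'; congr (_ + #|pred_of_set _|); apply/setP => x; rewrite !inE.
by case: (x == e); rewrite ?andbF.
Qed.

End BrokenCircuits.

Section DirectSums.
Variables (T : finType).
Implicit Types (A B S : {set T}) (F G : {set {set T}}).

Lemma mem_dsum A B F G S : (forall I, I \in F -> I \subset A) -> (forall I, I \in G -> I \subset B) ->
  [disjoint A & B] -> (S \in dsum F G) = [&& S \subset A :|: B, S :&: A \in F & S :&: B \in G].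
Proof.
move=> FA GB dAB; apply/imset2P/and3P => [[I J IF JG ->]|[/setIidPl SAB SF SG]].
  have IA := FA I IF; have JB := GB J JG.
  have eA : (I :|: J) :&: A = I.
    rewrite setIUl (setIidPl IA) (disjoint_setI0 (A := J)) ?setU0 //.
    by rewrite (disjointWl JB) // disjoint_sym.
  have eB : (I :|: J) :&: B = J.
    by rewrite setIUl (setIidPl JB) (disjoint_setI0 (A := I)) ?set0U // (disjointWl IA).
  by rewrite eA eB setUSS.
by exists (S :&: A) (S :&: B) => //; rewrite -setIUr SAB.
Qed.

Lemma mem_uniform a A S : (S \in uniform a A) = (S \subset A) && (#|S| <= a).
Proof. by rewrite inE. Qed.

Lemma mem_dsum_uniform m A B S : [disjoint A & B] -> A :|: B = setT ->
  (S \in dsum (uniform m A) (uniform #|B| B)) = (#|S :&: A| <= m).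
Proof.
move=> dAB AB; rewrite (mem_dsum (A := A) (B := B)) //; last first.
- by move=> I; rewrite mem_uniform => /andP[].
- by move=> I; rewrite mem_uniform => /andP[].
by rewrite AB subsetT !mem_uniform !subsetIr subset_leq_card ?subsetIr //= andbT.
Qed.

Lemma mem_big_dsum (I : eqType) (s : seq I) (A : I -> {set T}) S : uniq s ->
  (forall i j, i != j -> [disjoint A i & A j]) ->
  (S \in \big[@dsum T/[set set0]]_(i <- s) uniform 1 (A i)) =
  (S \subset \bigcup_(i <- s) A i) && all (fun i => #|S :&: A i| <= 1) s.
Proof.
move=> us dA; elim: s us S => [|i s IH] /= us S; first by rewrite !big_nil inE subset0 andbT.
case/andP: us => nis us; rewrite !big_cons.
rewrite (mem_dsum (A := A i) (B := \bigcup_(j <- s) A j)); first last.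
- elim: s nis {IH us} => [|j s IH]; first by rewrite big_nil -setI_eq0 setI0.
  by rewrite inE negb_or big_cons -setI_eq0 setIUr setU_eq0 !setI_eq0 => /andP[/dA -> /IH].
- by move=> J; rewrite (IH us) => /andP[].
- by move=> J; rewrite mem_uniform => /andP[].
rewrite mem_uniform subsetIr (IH us) subsetIr /=; congr [&& _, _ & _].
apply: eq_in_all => j js; have jU : A j \subset \bigcup_(j <- s) A j.
  by rewrite (big_rem j js) subsetUl.
by rewrite -setIA (setIidPr jU).
Qed.

Lemma mem_rank1_dsum k (A : 'I_k -> {set T}) B S : (forall i j, i != j -> [disjoint A i & A j]) ->
  (forall i, [disjoint A i & B]) -> (\bigcup_i A i) :|: B = setT ->
  (S \in dsum (\big[@dsum T/[set set0]]_(i < k) uniform 1 (A i)) (uniform #|B| B)) =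
  [forall i, #|S :&: A i| <= 1].
Proof.
move=> dA dAB AB; have bE S' := @mem_big_dsum _ (index_enum 'I_k) A S' (index_enum_uniq _) dA.
rewrite (mem_dsum (A := \bigcup_i A i) (B := B)); first last.
- by rewrite disjoint_sym; apply/bigcup_disjointP => i _; rewrite disjoint_sym.
- by move=> J; rewrite mem_uniform => /andP[].
- by move=> J; rewrite bE => /andP[].
rewrite AB subsetT mem_uniform subsetIr bE subsetIr subset_leq_card ?subsetIr //= andbT.
have iU i : A i \subset \bigcup_i A i by apply: bigcup_sup.
apply/allP/forallP => h i => [|_]; have := h i; rewrite -setIA (setIidPr (iU i)) //.
by rewrite mem_index_enum; apply.
Qed.

End DirectSums.

Section Parallel.
Variables (T : finType) (M : matroid T).
Implicit Types (S : {set T}) (i j : T).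

Lemma dependent_neq0 S : dependent M S -> 0 < #|S|.
Proof.
by move=> dS; rewrite card_gt0; apply: contraTneq dS => ->; rewrite /dependent negbK indep0.
Qed.

Lemma loopless_dependent S : ~~ has_loop M -> dependent M S -> 1 < #|S|.
Proof.
move=> nl dS; rewrite ltn_neqAle dependent_neq0 // andbT eq_sym.
apply: contra nl => /cards1P[i e]; apply/existsP; exists i; by rewrite /loop -e.
Qed.

Lemma parallelE i j : ~~ has_loop M -> parallel M i j = (i != j) && dependent M [set i; j].
Proof.
move=> nl; rewrite /parallel; apply: andb_id2l => ij; apply/minsetP/idP => [[]//|d]; split=> // S dS Sij.
by apply/eqP; rewrite eqEcard Sij cards2 ij; apply: loopless_dependent.
Qed.

Lemma nontrivial_parallel_classP : ~~ has_loop M ->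
  reflect (exists i j, i != j /\ dependent M [set i; j]) (has_nontrivial_parallel_class M).
Proof.
move=> nl; apply: (iffP existsP) => [[X /andP[/maxsetp/forall_inP XP /card_gt1P[i [j [iX jX ij]]]]]|].
  exists i, j; split=> //; have /forall_inP/(_ j jX)/implyP/(_ ij) := XP i iX.
  by rewrite parallelE // => /andP[].
case=> i [j [ij dij]]; have : pairwise_parallel M [set i; j].
  apply/forall_inP => x xij; apply/forall_inP => y yij; apply/implyP => xy.
  rewrite parallelE // xy /=.
  suff -> : [set x; y] = [set i; j] by [].
  apply/eqP; rewrite eqEcard !cards2 ij xy andbT; apply/subsetP => z.
  by rewrite in_set2 => /orP[] /eqP ->.
move=> /maxset_exists[X XP sX]; exists X; rewrite /parallel_class XP.
by have := subset_leq_card sX; rewrite cards2 ij.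
Qed.

Lemma girth_simple : (forall S, dependent M S -> 2 < #|S|) -> simple_matroid M.
Proof.
move=> hd; have nl : ~~ has_loop M by apply/existsPn => i; apply/negP => /hd; rewrite cards1.
rewrite /simple_matroid nl; apply/(nontrivial_parallel_classP nl) => -[i [j [ij /hd]]].
by rewrite cards2 ij.
Qed.

End Parallel.

(** * Recognition of the two families of direct sums *)

Section Classification.
Variables (n : nat) (M : matroid 'I_n).
Local Notation rk := (rk M).
Implicit Types (S X Y Z A B I : {set 'I_n}) (i j : 'I_n).

Definition rank1_sum := exists (k f : nat) (A : 'I_k -> {set 'I_n}) (B : {set 'I_n}),
  [/\ forall i j : 'I_k, i != j -> [disjoint A i & A j],
      forall i : 'I_k, [disjoint A i & B],
      (\bigcup_i A i) :|: B = [set: 'I_n],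
      #|B| = f &
      indep M = dsum (\big[@dsum 'I_n/[set set0]]_(i < k) uniform 1 (A i))
                     (uniform f B)].

Definition uniform_sum m := exists (f : nat) (A B : {set 'I_n}),
  [/\ (f <= n)%N, [disjoint A & B], A :|: B = [set: 'I_n],
      #|A| = (n - f)%N /\ #|B| = f &
      indep M = dsum (uniform m A) (uniform f B)].

Lemma uniform_sumE m A : (forall S, (S \in indep M) = (#|S :&: A| <= m)) -> uniform_sum m.
Proof.
move=> h; have dA : [disjoint A & ~: A] by rewrite -setI_eq0 setICr.
exists #|~: A|, A, (~: A); split; rewrite ?setUCr //.
- by rewrite -[leqRHS](card_ord n) max_card.
- by split=> //; rewrite -[LHS](addnK #|~: A|) cardsC card_ord.
by apply/setP => S; rewrite h mem_dsum_uniform ?setUCr.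
Qed.

(** Without loops, being equal or parallel is an equivalence relation, and the blocks are its
    classes: a set with no parallel pair is independent by hypothesis. *)
Lemma pairs_rank1_sum : ~~ has_loop M ->
  (forall Y, dependent M Y -> exists2 Z : {set 'I_n}, Z \subset Y & dependent M Z /\ #|Z| = 2) -> rank1_sum.
Proof.
move=> nl pairs.
have rk1 i : rk [set i] = 1.
  have : [set i] \in indep M.
    by apply: contraT => di; case/existsP: nl; exists i.
  by rewrite rk_indep cards1 => /eqP.
have rk2 i j : (rk [set i; j] == 1) = (i == j) || dependent M [set i; j].
  have [->|ij] := eqVneq i j; first by rewrite setUid rk1.
  rewrite /dependent rk_indep cards2 ij /=.
  have := rk_card M [set i; j]; rewrite cards2 ij.
  have := @rk_mono _ M [set i] [set i; j]; rewrite rk1 => /(_ (subsetUl _ _)).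
  by case: (rk _) => [|[|[|?]]].
have par_trans i j l : rk [set i; j] == 1 -> rk [set j; l] == 1 -> rk [set i; l] == 1.
  move=> /eqP ij /eqP jl; rewrite eqn_leq; apply/andP; split; last first.
    by rewrite -(rk1 i) rk_mono // subsetUl.
  have e : rk (i |: [set j; l]) = rk [set j; l].
    by apply: (@rk_closure _ _ i [set j]); rewrite ?subsetUl // ij rk1.
  by rewrite -jl -e rk_mono // setUS // subsetUr.
pose par i j := rk [set i; j] == 1.
have parC i j : par i j = par j i by rewrite /par setUC.
(* [pick] depends only on the extension of its predicate, so parallel elements receive the same
   representative. *)
pose rep i := odflt i [pick j | par i j].
have repP i : par i (rep i).
  by rewrite /rep; case: pickP => [j //|/(_ i)]; rewrite /par setUid rk1.
have repE i j : (rep i == rep j) = par i j.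
  apply/eqP/idP => [e|ij].
    apply: (@par_trans _ (rep i)); first exact: repP.
    by rewrite e -/(par _ _) parC repP.
  have e : par i =1 par j.
    move=> l; apply/idP/idP; last exact: par_trans.
    by apply: par_trans; rewrite -/(par _ _) parC.
  by rewrite /rep (eq_pick e); case: pickP => // /(_ j); rewrite /par setUid rk1.
pose A i := [set j | rep j == i].
(* There is one block for each element of the ground set, empty unless that element is a chosen
   representative, and no free part. *)
exists n, 0, A, set0; have AU : \bigcup_i A i :|: set0 = setT.
  apply/setP => j; rewrite setU0 in_setT; apply/bigcupP; exists (rep j) => //.
  by rewrite inE.
have dA i j : i != j -> [disjoint A i & A j].
  move=> ij; rewrite -setI_eq0; apply/eqP/setP => l; rewrite !inE.
  by case: eqP => // ->; apply: negPf.
have d0 i : [disjoint A i & set0] by rewrite -setI_eq0 setI0.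
split; rewrite ?cards0 //; have -> : uniform 0 (set0 : {set 'I_n}) = uniform #|(set0 : {set 'I_n})| set0 by rewrite cards0.
apply/setP => S; rewrite mem_rank1_dsum //; apply/idP/forallP => [iS l|h].
  rewrite leqNgt; apply/negP => /card_gt1P[x [y [/setIP[xS]]]].
  rewrite inE => /eqP xl /setIP[yS]; rewrite inE -{}xl eq_sym repE /par rk2 => /orP[->//|/negP + _].
  by case; apply: indepS iS; rewrite subUset !sub1set xS.
apply: contraT => /pairs[Z ZS [dZ /eqP /cards2P[x [y [xy e]]]]].
have := h (rep x); rewrite leqNgt => /negP[]; apply/card_gt1P; exists x, y.
have xS : x \in S by rewrite (subsetP ZS) // e set21.
have yS : y \in S by rewrite (subsetP ZS) // e set22.
rewrite !inE xS yS eqxx xy; split=> //.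
by rewrite eq_sym repE /par rk2 -e dZ orbT.
Qed.

(** The rank condition says that the complement of [A] consists of coloops. An independent part of
    [A] extends to a basis of the matroid, which by counting contains the whole complement. *)
Lemma split_uniform m A : (forall S, dependent M S -> m < #|S|) -> rk A <= m ->
  rk setT = rk A + #|setT :\: A| -> forall S, (S \in indep M) = (#|S :&: A| <= m).
Proof.
move=> hd rA rT S; apply/idP/idP => [iS|cS].
  apply: leq_trans rA; rewrite -(eqP (etrans (esym (rk_indep M _)) (indepS (subsetIl S A) iS))).
  by rewrite rk_mono // subsetIr.
have iSA : S :&: A \in indep M by apply: contraT => /hd; rewrite ltnNge cS.
have [I [Ii SI IA cI]] := rk_extend iSA (subsetIr _ _).
have [J [Ji IJ _ cJ]] := rk_extend Ii (subsetT _).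
have JA : #|J :&: A| <= rk A by apply: rk_ge; rewrite ?subsetIr // (indepS (subsetIl _ _) Ji).
have JB : ~: A \subset J.
  have := cardsID A J; rewrite cJ rT setTD => cE.
  suff : J :\: A == ~: A by move=> /eqP <-; apply: subsetDl.
  rewrite eqEcard -setTD setSD ?subsetT //= setTD -(leq_add2l (rk A)) -cE.
  by rewrite leq_add2r.
apply: indepS Ji; rewrite -(setID S A) subUset (subset_trans SI IJ).
by rewrite (subset_trans _ JB) // -setTD setSD // subsetT.
Qed.

End Classification.

Import Order.TTheory GRing.Theory Num.Theory.
Local Open Scope ring_scope.

(** * Koszul families *)

Section Koszul.
Variables (V Y : zmodType) (op : V -> Y -> Y).
Hypothesis opB : forall w, {morph op w : x y / x - y}.
Hypothesis opC : forall u w y, op u (op w y) = - op w (op u y).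
Hypothesis op2 : forall w y, op w (op w y) = 0.
Implicit Types (w : V) (ws : seq V) (f g : seq nat -> Y) (a : seq nat).
Implicit Types (Q : nat -> Y -> Prop).

Lemma op0 w : op w 0 = 0.
Proof. by rewrite -[X in op w X](subrr 0) opB subrr. Qed.
Lemma opN w y : op w (- y) = - op w y.
Proof. by rewrite -[X in op w X]sub0r opB op0 sub0r. Qed.
Lemma opD w x y : op w (x + y) = op w x + op w y.
Proof. by rewrite -[X in x + X]opprK opB opN opprK. Qed.

(* A family [f] stands for the polynomial with coefficient [f a] at the monomial
   of exponent [a]; [delta ws] is multiplication by the sum of the [x_j w_j],
   with one variable for each entry of [ws]. *)
Fixpoint delta ws f a : Y :=
  match ws, a with
  | w :: ws', i :: a' =>
      (if i is j.+1 then op w (f (j :: a')) else 0)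
      + delta ws' (fun b => f (i :: b)) a'
  | _, _ => 0
  end.

Lemma eq_delta_size ws f g a : (forall b, size b = size ws -> f b = g b) ->
  size a = size ws -> delta ws f a = delta ws g a.
Proof.
elim: ws f g a => [|w ws IH] f g [|i a] //= efg [sa].
rewrite (IH _ (fun b => g (i :: b))) //; last by move=> b sb; apply: efg; rewrite /= sb.
by case: i => // j; rewrite efg //= sa.
Qed.

Lemma eq_delta ws f g a : f =1 g -> delta ws f a = delta ws g a.
Proof.
elim: ws f g a => [|w ws IH] f g [|i a] //= efg.
rewrite (IH _ (fun b => g (i :: b))) //.
by case: i => // j; rewrite efg.
Qed.

Lemma deltaD ws f g a :
  delta ws (fun b => f b + g b) a = delta ws f a + delta ws g a.
Proof.
elim: ws f g a => [|w ws IH] f g [|i a] /=; rewrite ?addr0 //.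
by rewrite IH addrACA; case: i => [|j]; rewrite ?addr0 // opD.
Qed.

Lemma deltaN ws f a : delta ws (fun b => - f b) a = - delta ws f a.
Proof.
elim: ws f a => [|w ws IH] f [|i a] /=; rewrite ?oppr0 //.
by rewrite IH opprD; case: i => [|j]; rewrite ?oppr0 // opN.
Qed.

Lemma deltaB ws f g a :
  delta ws (fun b => f b - g b) a = delta ws f a - delta ws g a.
Proof. by rewrite deltaD deltaN. Qed.

Lemma delta0 ws a : delta ws (fun=> 0) a = 0.
Proof.
elim: ws a => [|w ws IH] [|i a] //=; rewrite IH addr0.
by case: i => // j; rewrite op0.
Qed.

Lemma delta_op ws u f a : delta ws (fun b => op u (f b)) a = - op u (delta ws f a).
Proof.
elim: ws f a => [|w ws IH] f [|i a] /=; rewrite ?op0 ?oppr0 //.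
rewrite IH opD opprD; case: i => [|j]; rewrite ?op0 ?oppr0 //.
by congr (_ + _); rewrite opC.
Qed.

Lemma delta_delta ws f a : delta ws (delta ws f) a = 0.
Proof.
elim: ws f a => [|w ws IH] f [|i a] //=.
rewrite deltaD IH addr0; case: i => [|[|j]].
- by rewrite delta0 addr0.
- by rewrite add0r delta_op addrN.
- by rewrite opD op2 add0r delta_op addrN.
Qed.

(** Truncation in the polynomial degree [sumn a]; since [delta] raises this degree by one, it is
    used to make solutions homogeneous. *)
Definition degpart (P : pred nat) f : seq nat -> Y :=
  fun a => if P (sumn a) then f a else 0.

Lemma delta_degpart ws P f a :
  delta ws (degpart (fun s => P s.+1) f) a = if P (sumn a) then delta ws f a else 0.
Proof.
elim: ws P f a => [|w ws IH] P f [|i a] /=; rewrite ?if_same //.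
rewrite (eq_delta _ _ (_ : _ =1 degpart (fun s => P (i + s.+1)%N) (fun b => f (i :: b)))); last first.
  by move=> b; rewrite /degpart /= addnS.
rewrite (IH (fun s => P (i + s)%N)); case: i => [|j].
  by rewrite !add0r.
by rewrite /degpart /= addSn; case: ifP; rewrite // op0 addr0.
Qed.

Definition homfam i f := forall a, sumn a != i -> f a = 0.

Lemma homfam_delta ws i f a : homfam i f -> sumn a != i.+1 -> delta ws f a = 0.
Proof.
move=> hf na; rewrite (eq_delta _ _ (_ : _ =1 degpart (fun s => s.+1 == i.+1)%N f)).
  by rewrite (delta_degpart _ (fun s => s == i.+1)) (negPf na).
by move=> b; rewrite /degpart eqSS; case: eqP => // /eqP /hf.
Qed.

Lemma delta_degree0 ws f a : sumn a = 0 -> delta ws f a = 0.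
Proof.
elim: ws f a => [|w ws IH] f [|[|i] a] //= sa.
by rewrite add0r IH.
Qed.

Lemma delta_closed ws f a : (forall w b, op w (f b) = 0) -> delta ws f a = 0.
Proof.
elim: ws f a => [|w ws IH] f [|i a] //= fw; rewrite IH ?addr0 //.
by case: i => // j; rewrite fw.
Qed.

Lemma delta_closed_degree0 ws f : (forall a, size a = size ws -> delta ws f a = 0) ->
  forall w, w \in ws -> op w (f (nseq (size ws) 0%N)) = 0.
Proof.
elim: ws f => [|u ws IH] f df w //; rewrite inE => /predU1P[->|wws] /=.
  have := df (1%N :: nseq (size ws) 0%N); rewrite /= size_nseq => /(_ erefl).
  by rewrite delta_degree0 ?addr0 // sumn_nseq.
apply: (IH (fun a => f (0%N :: a))) => // a sa.
by have := df (0%N :: a) (congr1 S sa); rewrite /= add0r.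
Qed.

(* [Q d] plays the role of the elements of degree at least [d]. *)
Definition filtered Q :=
  [/\ forall d, Q d 0,
      forall d x y, Q d x -> Q d y -> Q d (x - y) &
      forall w d x, Q d.+1 x -> Q d (op w x)].

Section Filtered.
Variable Q : nat -> Y -> Prop.
Hypothesis FQ : filtered Q.

Lemma filtered0 d : Q d 0. Proof. by case: FQ. Qed.
Lemma filteredB d x y : Q d x -> Q d y -> Q d (x - y). Proof. by case: FQ => _ + _; apply. Qed.
Lemma filteredN d x : Q d x -> Q d (- x).
Proof. by move=> Qx; rewrite -sub0r; apply: filteredB Qx; apply: filtered0. Qed.
Lemma filteredD d x y : Q d x -> Q d y -> Q d (x + y).
Proof. by move=> Qx Qy; rewrite -(opprK y); apply/filteredB/filteredN. Qed.
Lemma filtered_op w d x : Q d.+1 x -> Q d (op w x). Proof. by case: FQ => _ _; apply. Qed.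

Lemma filtered_delta ws d f a : (forall b, Q d.+1 (f b)) -> Q d (delta ws f a).
Proof.
elim: ws f a => [|w ws IH] f [|i a] Qf /=; try exact: filtered0.
apply: filteredD; last exact: IH.
by case: i => [|j]; [apply: filtered0|apply: filtered_op].
Qed.

End Filtered.

(** For functionals vanishing on a module, this is dual to dividing further by the multiples of
    [w]. *)
Definition kerQ w Q d y := Q d y /\ op w y = 0.

Lemma filtered_ker w Q : filtered Q -> filtered (kerQ w Q).
Proof.
move=> FQ; split=> [d|d x y [Qx wx] [Qy wy]|u d x [Qx wx]]; split.
- exact: filtered0.
- exact: op0.
- exact: filteredB.
- by rewrite opB wx wy subr0.
- exact: filtered_op.
- by rewrite opC wx op0 oppr0.
Qed.

(** Dual of exterior regularity, where the annihilator of [w] consists of multiples of [w]; only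
    degrees at least [m] are controlled. *)
Definition exact_on m w Q := forall d y, (m <= d)%N -> Q d y -> op w y = 0 ->
  exists2 z, Q d.+1 z & op w z = y.

(* If [Q] is the filtration by degree of the functionals vanishing on a module [Z],
   this is dual to the vanishing of the [i]-th syzygies of the quotient by [Z] in
   degrees too high for a linear resolution. *)
Definition reg i m ws Q := forall d f, (m <= d)%N -> homfam i f ->
  (forall a, Q d (f a)) -> (forall a, size a = size ws -> delta ws f a = 0) ->
  exists2 g, forall a, Q d.+1 (g a) & forall a, size a = size ws -> delta ws g a = f a.

Section Head.
Variables (m : nat) (w : V) (ws : seq V) (Q : nat -> Y -> Prop).
Hypothesis FQ : filtered Q.
Hypothesis ex : exact_on m w Q.

Lemma exact_on_family d f : (m <= d)%N -> (forall a, Q d (f a)) ->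
  (forall a, size a = size ws -> op w (f a) = 0) ->
  exists2 g, forall a, Q d.+1 (g a) & forall a, size a = size ws -> op w (g a) = f a.
Proof.
move=> md Qf wf.
have /functional_choice [g gP] : forall a, exists z,
    Q d.+1 z /\ (size a = size ws -> op w z = f a).
  move=> a; case: (eqVneq (size a) (size ws)) => [sa|na].
    by case: (ex md (Qf a) (wf a sa)) => z; exists z.
  by exists 0; split; [apply: filtered0|move/eqP; rewrite (negPf na)].
by exists g => a; case: (gP a).
Qed.

(* The part of [f] involving the first variable is removed from the top. *)
Lemma head_variable_free t d f : (m <= d)%N -> (forall a, Q d (f a)) ->
  (forall j a, (t < j)%N -> size a = size ws -> f (j :: a) = 0) ->
  (forall j a, size a = size ws -> delta (w :: ws) f (j.+1 :: a) = 0) ->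
  exists2 g, forall a, Q d.+1 (g a) &
    forall j a, size a = size ws -> f (j.+1 :: a) = delta (w :: ws) g (j.+1 :: a).
Proof.
move=> md; elim: t f => [|t IH] f Qf f0 df0.
  exists (fun=> 0) => [a|j a sa]; first exact: filtered0.
  by rewrite delta0 f0.
have wf a : size a = size ws -> op w (f (t.+1 :: a)) = 0.
  move=> sa; have /= := df0 t.+1 a sa.
  by rewrite (eq_delta_size (g := fun=> 0)) ?delta0 ?addr0 // => b sb; apply: f0.
have [h Qh wh] := exact_on_family md (fun a => Qf (t.+1 :: a)) wf.
(* The preimage [h] of the top coefficient is placed one exponent lower, so that subtracting its
   [delta] clears exponent [t.+1]. *)
pose h' a := if a is j :: b then if j == t then h b else 0 else 0.
have Qh' a : Q d.+1 (h' a).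
  by case: a => [|j b] /=; [apply: filtered0|case: ifP => _ //; apply: filtered0].
have dh' j a : (t < j)%N -> size a = size ws ->
    delta (w :: ws) h' (j :: a) = if j == t.+1 then f (j :: a) else 0.
  case: j => // j tj sa /=.
  rewrite -[X in _ + X]/(delta ws (fun b => if j.+1 == t then h b else 0) a).
  rewrite (negPf (_ : j.+1 != t)) ?delta0 ?addr0; last by rewrite gtn_eqF.
  by rewrite eqSS; case: eqP => [->|_]; rewrite ?wh ?op0.
pose f' a := f a - delta (w :: ws) h' a.
case: (IH f') => [a|j a tj sa|j a sa|g Qg gP].
- by apply: (filteredB FQ) => //; apply: (filtered_delta FQ).
- rewrite /f' dh' //; case: eqP => [_|/eqP nj]; first by rewrite subrr.
  by rewrite subr0 f0 // ltn_neqAle eq_sym nj.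
- by rewrite deltaB df0 // delta_delta subr0.
exists (fun a => h' a + g a) => [a|j a sa]; first exact: filteredD.
by rewrite deltaD -gP // /f' addrC subrK.
Qed.

Lemma homfam_bound i f : homfam i f ->
  forall j a, (i < j)%N -> size a = size ws -> f (j :: a) = 0.
Proof.
move=> hf j a ij _; apply: hf => /=.
by rewrite gtn_eqF // ltn_addr.
Qed.

(** Subtracting a boundary removes the first variable from [f]. Closedness at exponent 1 of that
    variable then says that what remains lies in the kernel of [op w], where the hypothesis
    applies. *)
Lemma reg_cons i : reg i m ws (kerQ w Q) -> reg i m (w :: ws) Q.
Proof.
move=> rws d f md hf Qf df.
have [h Qh hP] := head_variable_free md Qf (homfam_bound hf)
  (fun j a sa => df (j.+1 :: a) (congr1 S sa)).
pose h' := degpart (fun s => s.+1 == i) h.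
pose f' a := f a - delta (w :: ws) h' a.
have hP' a : delta (w :: ws) h' a = if sumn a == i then delta (w :: ws) h a else 0.
  exact: (delta_degpart (w :: ws) (fun s => s == i) h a).
have f'0 j a : size a = size ws -> f' (j.+1 :: a) = 0.
  move=> sa; rewrite /f' hP' -hP //; case: eqP => [_|/eqP na]; first exact: subrr.
  by rewrite (hf _ na) subrr.
have df' a : size a = size (w :: ws) -> delta (w :: ws) f' a = 0.
  by move=> sa; rewrite deltaB df // delta_delta subrr.
have Qf' a : Q d (f' a).
  apply: (filteredB FQ) => //; apply: (filtered_delta FQ) => b.
  by rewrite /h' /degpart; case: ifP => // _; apply: filtered0.
pose k a := if size a == size ws then f' (0%N :: a) else 0.
case: (rws d k) => // [a na|a|a sa|g Qg gP].
- rewrite /k; case: ifP => // _; rewrite /f' hP' /= add0n (negPf na) subr0.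
  by apply: hf; rewrite /= add0n.
- rewrite /k; case: ifP => [/eqP sa|_]; last by split; [apply: filtered0|apply: op0].
  split=> //; have := df' (1%N :: a) (congr1 S sa); rewrite /=.
  by rewrite (eq_delta_size (g := fun=> 0)) ?delta0 ?addr0 // => b /f'0.
- have /= := df' (0%N :: a) (congr1 S sa); rewrite add0r => <-.
  by apply: eq_delta_size => // b sb; rewrite /k sb eqxx.
pose g' a := if a is j :: b then if j == 0%N then g b else 0 else 0.
exists (fun a => h' a + g' a) => [a|[//|j a] [sa]].
  apply: filteredD => //.
    by rewrite /h' /degpart; case: ifP => // _; apply: filtered0.
  case: a => [|j a] /=; first exact: filtered0.
  by case: ifP => [_|_]; [case: (Qg a)|apply: filtered0].
rewrite deltaD; suff -> : delta (w :: ws) g' (j :: a) = f' (j :: a) by rewrite /f' addrC subrK.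
case: j => [|j] /=; first by rewrite add0r gP // /k sa eqxx.
rewrite delta0 addr0 f'0 //; case: eqP => [_|_]; last exact: op0.
by case: (Qg a).
Qed.

(** A closed family with values in the kernel of [op w] stays closed when the first variable is
    added without occurring in it. A solution there is corrected by a boundary until it no longer
    involves that variable, and the equation at exponent 1 puts its values in the kernel. *)
Lemma reg_behead i : reg i m (w :: ws) Q -> reg i m ws (kerQ w Q).
Proof.
move=> rws d f md hf Qf df.
pose f' a := if a is j :: b then if j == 0%N then f b else 0 else 0.
have hf' : homfam i f'.
  by move=> [|[|j] a] //=; rewrite add0n => /hf.
case: (rws d f' md hf') => [a|a|g0 Qg0 g0P].
- case: a => [|j a] /=; first exact: filtered0.
  by case: ifP => _; [case: (Qf a)|apply: filtered0].
- case: a => [|[|[|j]] a] //= [sa]; first by rewrite add0r df.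
    by rewrite delta0 addr0; case: (Qf a).
  by rewrite delta0 addr0 op0.
pose g := degpart (fun s => s.+1 == i) g0.
have Qg a : Q d.+1 (g a).
  by rewrite /g /degpart; case: ifP => _ //; apply: filtered0.
have gP a : size a = size (w :: ws) -> delta (w :: ws) g a = f' a.
  move=> sa; rewrite [LHS](delta_degpart (w :: ws) (fun s => s == i) g0 a) g0P //.
  by case: eqP => // /eqP /hf' ->.
have g_bound j a : (i < j)%N -> size a = size ws -> g (j :: a) = 0.
  by move=> ij _; rewrite /g /degpart /= gtn_eqF // ltnS (leq_trans (ltnW ij)) ?leq_addr.
case: (head_variable_free (leqW md) Qg g_bound) => [j a sa|h Qh hP].
  by rewrite gP //= sa.
pose g' a := g a - delta (w :: ws) h a.
have Qg' a : Q d.+1 (g' a) by apply: (filteredB FQ) => //; apply: (filtered_delta FQ).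
have g'P a : size a = size (w :: ws) -> delta (w :: ws) g' a = f' a.
  by move=> sa; rewrite deltaB delta_delta subr0 gP.
have g'0 j a : size a = size ws -> g' (j.+1 :: a) = 0.
  by move=> sa; rewrite /g' hP // subrr.
exists (fun a => if size a == size ws then g' (0%N :: a) else 0) => [a|a sa].
  case: eqP => [sa|_]; last by split; [apply: filtered0|apply: op0].
  split=> //; have := g'P (1%N :: a) (congr1 S sa); rewrite /= => <-.
  by rewrite (eq_delta_size (g := fun=> 0)) ?delta0 ?addr0 // => b /g'0.
have := g'P (0%N :: a) (congr1 S sa); rewrite /= add0r => <-.
by apply: eq_delta_size => // b ->; rewrite eqxx.
Qed.

End Head.

Fixpoint kerQs ws Q := if ws is w :: ws' then kerQs ws' (kerQ w Q) else Q.

(** Dual form of an almost regular sequence: each form is exact on the common kernel of its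
    predecessors. *)
Fixpoint exact_chain m ws Q :=
  if ws is w :: ws' then exact_on m w Q /\ exact_chain m ws' (kerQ w Q) else True.

Lemma filtered_kers ws Q : filtered Q -> filtered (kerQs ws Q).
Proof. by elim: ws Q => //= w ws IH Q FQ; apply/IH/filtered_ker. Qed.

Lemma kerQsP ws Q d y :
  kerQs ws Q d y <-> Q d y /\ forall w, w \in ws -> op w y = 0.
Proof.
elim: ws Q => [|w ws IH] Q /=; first by split=> [|[]].
rewrite IH; split=> [[[Qy wy] h]|[Qy h]]; split=> //.
- by move=> u; rewrite inE => /predU1P[->|/h].
- by split=> //; apply: h; rewrite inE eqxx.
- by move=> u uws; apply: h; rewrite inE uws orbT.
Qed.

(** Lets an exact initial segment be divided out. When [ws2] is empty only polynomial degree 0 has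
    content. *)
Lemma reg_cat i m ws1 ws2 Q : filtered Q -> exact_chain m ws1 Q ->
  reg i m ws2 (kerQs ws1 Q) <-> reg i m (ws1 ++ ws2) Q.
Proof.
elim: ws1 Q => [|w ws IH] Q FQ //= [ex /(IH _ (filtered_ker w FQ)) ->].
by split; [apply: reg_cons|apply: reg_behead].
Qed.

(** [h w] is a contracting homotopy for [op w]. Anticommuting with the other [op u], it preserves
    their kernels and so still works at every later stage of the chain. *)
Lemma exact_chain_dual m ws Q (h : V -> Y -> Y) : filtered Q -> uniq ws ->
  (forall w, w \in ws -> h w 0 = 0) ->
  (forall w y, w \in ws -> op w (h w y) + h w (op w y) = y) ->
  (forall u w y, u \in ws -> w \in ws -> u != w -> op u (h w y) = - h w (op u y)) ->
  (forall w d y, w \in ws -> (m <= d)%N -> Q d y -> Q d.+1 (h w y)) ->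
  exact_chain m ws Q.
Proof.
elim: ws Q => [|w ws IH] Q FQ //= /andP[wws uws] h0 hK hC Qh; split.
  move=> d y md Qy wy; exists (h w y); first by apply: Qh; rewrite ?mem_head.
  by have := hK w y (mem_head _ _); rewrite wy h0 ?mem_head ?addr0.
have sub u : u \in ws -> u \in w :: ws by rewrite inE orbC => ->.
apply: IH => //.
- exact: filtered_ker.
- by move=> u /sub; apply: h0.
- by move=> u y /sub; apply: hK.
- by move=> u v y /sub uws' /sub; apply: hC.
move=> u d y uw md [Qy wy]; split; first by apply: Qh; rewrite ?sub.
rewrite hC ?mem_head ?sub // ?wy ?h0 ?oppr0 ?sub //.
by apply: contraNneq wws => ->.
Qed.

End Koszul.

Lemma delta_morph (V Y Y' : zmodType) (op : V -> Y -> Y) (op' : V -> Y' -> Y')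
  (T : {additive Y -> Y'}) (ws : seq V) (f : seq nat -> Y) a :
  (forall w y, T (op w y) = op' w (T y)) ->
  delta op' ws (fun b => T (f b)) a = T (delta op ws f a).
Proof.
move=> Top; elim: ws f a => [|w ws IH] f [|i a] /=; rewrite ?raddf0 //.
by rewrite IH raddfD; case: i => [|j]; rewrite ?raddf0 ?Top.
Qed.

Arguments op0 [V Y op].
Arguments opN [V Y op].
Arguments opD [V Y op].

(** * The exterior algebra and its functionals *)

HB.instance Definition _ (K : fieldType) (n : nat) :=
  Vector.copy (ext K n) {ffun {set 'I_n} -> K^o}.

Section Contraction.
Variables (K : fieldType) (n : nat).
Local Notation E := (ext K n).
Local Notation V := 'rV[K]_n.
Implicit Types (S T : {set 'I_n}) (i j : 'I_n) (x y z : E) (c w : V).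

Definition pos i S := #|[set j in S | (j < i)%N]|.

Lemma posE i S : pos i S = (\sum_(b in S) (b < i)%N)%N.
Proof.
rewrite /pos -sum1_card big_mkcond [in RHS]big_mkcond; apply: eq_bigr => j _.
by rewrite !inE; case: (j \in S); case: (j < i)%N.
Qed.

Lemma pos_setD1 i S : pos i (S :\ i) = pos i S.
Proof.
congr #|pred_of_set _|; apply/setP => j; rewrite !inE.
by case: eqVneq => //= ->; rewrite ltnn andbF.
Qed.

Lemma posU1 i j S : j \notin S -> pos i (j |: S) = ((j < i) + pos i S)%N.
Proof. by move=> jS; rewrite !posE big_setU1. Qed.

Lemma pos_D1 i j S : j \in S -> pos i S = ((j < i) + pos i (S :\ j))%N.
Proof. by move=> jS; rewrite -posU1 ?setD1K // !inE eqxx. Qed.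

Lemma ext_coefN x S : ext_coef (- x) S = - ext_coef x S.
Proof. by rewrite -scaleN1r ext_coefZ mulN1r. Qed.

Lemma ext_coefB x y S : ext_coef (x - y) S = ext_coef x S - ext_coef y S.
Proof. by rewrite ext_coefD ext_coefN. Qed.

Lemma ext_coef_sum (I : Type) (r : seq I) (P : pred I) (F : I -> E) S :
  ext_coef (\sum_(i <- r | P i) F i) S = \sum_(i <- r | P i) ext_coef (F i) S.
Proof.
apply: (big_morph (fun x => ext_coef x S)) => [x y|]; first exact: ext_coefD.
exact: ext_coef0.
Qed.

Lemma ext_expand x : x = \sum_S ext_coef x S *: ext_basis K S.
Proof.
apply: ext_coefP => S; rewrite ext_coef_sum (bigD1 S) //= big1 ?addr0.
  by rewrite ext_coefZ ext_coef_basis eqxx mulr1.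
by move=> T nT; rewrite ext_coefZ ext_coef_basis eq_sym (negPf nT) mulr0.
Qed.

Lemma ext_coef_genM i x S : ext_coef (ext_gen K i * x) S =
  if i \in S then (-1) ^+ pos i S * ext_coef x (S :\ i) else 0.
Proof.
rewrite ext_coefM; case: ifP => iS; last first.
  rewrite big1 // => A sA; rewrite ext_coef_basis; case: eqP => [eA|_].
    by rewrite eA sub1set iS in sA.
  by rewrite mul0r mulr0.
rewrite (bigD1 [set i]) ?sub1set //= big1 ?addr0 => [|A /andP[_ /negPf nA]].
  rewrite ext_coef_basis eqxx mul1r; congr (_ ^+ _ * _).
  by rewrite /ninv big_set1 -posE pos_setD1.
by rewrite ext_coef_basis nA mul0r mulr0.
Qed.

(** Left contraction with the dual basis vector of [e_i]; [ctr_genM] is its Clifford relation with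
    multiplication by generators. *)
Definition ctr i x : E :=
  [ffun S : {set 'I_n} => if i \in S then 0 else (-1) ^+ pos i S * ext_coef x (i |: S)].

Lemma ext_coef_ctr i x S : ext_coef (ctr i x) S =
  if i \in S then 0 else (-1) ^+ pos i S * ext_coef x (i |: S).
Proof. by rewrite /ext_coef ffunE. Qed.

Lemma ctr_genM i j x : ctr i (ext_gen K j * x) = (i == j)%:R *: x - ext_gen K j * ctr i x.
Proof.
apply: ext_coefP => S; rewrite ext_coefB ext_coefZ ext_coef_ctr !ext_coef_genM !ext_coef_ctr.
case: (eqVneq i j) => [<-|ij].
  case: ifP => iS.
    by rewrite setD11 pos_setD1 mul1r setD1K // mulrA -expr2 sqrr_sign mul1r subrr.
  by rewrite setU11 setU1K ?iS // posU1 ?iS // ltnn mulrA -expr2 sqrr_sign subr0.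
rewrite mul0r sub0r !inE ij /= eq_sym (negPf ij) /=.
case: (boolP (i \in S)) => iS; first by rewrite mulr0 if_same oppr0.
case: (boolP (j \in S)) => jS; last by rewrite mulr0 oppr0.
have -> : (i |: S) :\ j = i |: S :\ j.
  by apply/setP => k; rewrite !inE; case: (eqVneq k i) => // ->; rewrite ij.
rewrite posU1 // (pos_D1 i jS) !mulrA -mulNr; congr (_ * _).
rewrite !exprD; have := ltngtP i j; rewrite -val_eqE /= in ij.
case: (ltngtP i j) => [_|_|eij]; last by rewrite eij eqxx in ij.
  by rewrite !expr1 !expr0 mul1r mulN1r mulrN mulrC.
by rewrite !expr1 !expr0 mul1r mulN1r mulNr mulrC.
Qed.

Lemma ctr_is_linear i : linear (ctr i).
Proof.
move=> a x y; apply: ext_coefP => S.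
rewrite ext_coefD ext_coefZ !ext_coef_ctr ext_coefD ext_coefZ.
by case: ifP => _; rewrite ?mulr0 ?addr0 // mulrDr mulrCA.
Qed.
HB.instance Definition _ i := GRing.isLinear.Build K E E *:%R (ctr i) (ctr_is_linear i).

Definition vec w : E := \sum_i w 0 i *: ext_gen K i.
Definition contr c x : E := \sum_i c 0 i *: ctr i x.
Definition dot c w : K := \sum_i c 0 i * w 0 i.

Lemma contr_is_linear c : linear (contr c).
Proof.
move=> a x y; rewrite /contr scaler_sumr -big_split; apply: eq_bigr => i _ /=.
by rewrite linearP scalerDr !scalerA mulrC.
Qed.
HB.instance Definition _ c := GRing.isLinear.Build K E E *:%R (contr c) (contr_is_linear c).

Lemma contrD c x y : contr c (x + y) = contr c x + contr c y.
Proof. exact: raddfD. Qed.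
Lemma contrB c x y : contr c (x - y) = contr c x - contr c y.
Proof. exact: raddfB. Qed.
Lemma contrZ c a x : contr c (a *: x) = a *: contr c x.
Proof. exact: linearZ. Qed.

Lemma contr_genM c j x :
  contr c (ext_gen K j * x) = c 0 j *: x - ext_gen K j * contr c x.
Proof.
rewrite /contr mulr_sumr.
have -> : c 0 j *: x = \sum_i c 0 i *: ((i == j)%:R *: x).
  rewrite (bigD1 j) //= eqxx scale1r big1 ?addr0 // => i /negPf ->.
  by rewrite scale0r scaler0.
rewrite -sumrB /=; apply: eq_bigr => i _.
by rewrite ctr_genM scalerBr -scalerAr.
Qed.

Lemma contr_vecM c w x : contr c (vec w * x) = dot c w *: x - vec w * contr c x.
Proof.
rewrite /vec mulr_suml linear_sum mulr_suml /dot scaler_suml -sumrB.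
apply: eq_bigr => i _.
by rewrite -!scalerAl linearZ /= contr_genM scalerBr scalerA mulrC.
Qed.

Lemma ext_gen_sqr i : ext_gen K i * ext_gen K i = 0.
Proof.
by rewrite ext_basisM disjoints1 !inE eqxx.
Qed.

Lemma ext_genC i j : ext_gen K i * ext_gen K j = - (ext_gen K j * ext_gen K i).
Proof.
case: (eqVneq i j) => [->|ij]; first by rewrite ext_gen_sqr oppr0.
rewrite !ext_basisM !disjoints1 !inE (eq_sym j i) (negPf ij) setUC -scaleNr.
congr (_ *: _); rewrite /ninv !big_set1 -val_eqE /= in ij *.
by case: ltngtP ij; rewrite ?expr0 ?expr1 ?opprK.
Qed.

Lemma vecC u w : vec u * vec w = - (vec w * vec u).
Proof.
rewrite /vec !mulr_suml -sumrN.
under eq_bigr do rewrite mulr_sumr.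
rewrite exchange_big /=; apply: eq_bigr => j _.
rewrite mulr_sumr -sumrN; apply: eq_bigr => i _.
by rewrite -!scalerAl -!scalerAr ext_genC !scalerN !scalerA mulrC.
Qed.

Lemma vec_sqr w : vec w * vec w = 0.
Proof.
rewrite /vec; elim: (index_enum _) => [|i r IH]; first by rewrite big_nil mul0r.
set v := \sum_(j <- r) _ in IH *.
rewrite big_cons -/v mulrDl !mulrDr IH addr0 -!scalerAl -!scalerAr ext_gen_sqr.
rewrite !scaler0 add0r -scalerDr /v mulr_sumr mulr_suml -big_split big1 ?scaler0 // => j _.
by rewrite /= -scalerAl -scalerAr ext_genC scalerN addNr.
Qed.

Lemma ext_basis_D1 i S : i \in S ->
  ext_basis K S = (-1) ^+ pos i S *: (ext_gen K i * ext_basis K (S :\ i)).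
Proof.
move=> iS; rewrite ext_basisM disjoints1 setD11 setD1K // scalerA /ninv big_set1.
by rewrite -posE pos_setD1 -expr2 sqrr_sign scale1r.
Qed.

Lemma ext_ind (P : E -> Prop) : P 1 -> (forall x y, P x -> P y -> P (x + y)) ->
  (forall a x, P x -> P (a *: x)) -> (forall i x, P x -> P (ext_gen K i * x)) ->
  forall x, P x.
Proof.
move=> P1 PD PZ PM x; rewrite [x]ext_expand.
apply: big_ind => // [|S _]; first by rewrite -(scale0r 1); apply: PZ.
apply: (PZ); move: {2}#|S| (erefl #|S|) => k; elim: k S => [|k IH] S.
  by move/eqP; rewrite cards_eq0 => /eqP ->.
move=> sS; have /card_gt0P [i iS] : (0 < #|S|)%N by rewrite sS.
rewrite (ext_basis_D1 iS); apply/PZ/PM/IH.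
by move: sS; rewrite (cardsD1 i) iS => -[].
Qed.

Definition sgnE x : E := [ffun S : {set 'I_n} => (-1) ^+ #|S| * ext_coef x S].

Lemma ext_coef_sgn x S : ext_coef (sgnE x) S = (-1) ^+ #|S| * ext_coef x S.
Proof. by rewrite /ext_coef ffunE. Qed.

Lemma sgnE_genM i x : sgnE (ext_gen K i * x) = - (ext_gen K i * sgnE x).
Proof.
apply: ext_coefP => S; rewrite ext_coefN ext_coef_sgn !ext_coef_genM ext_coef_sgn.
case: ifP => iS; last by rewrite mulr0 oppr0.
by rewrite (cardsD1 i S) iS exprS mulrCA -!mulrA !mulN1r mulrN.
Qed.

Lemma contr1 c : contr c 1 = 0.
Proof.
rewrite /contr big1 // => i _; apply/eqP; rewrite scaler_eq0; apply/orP; right.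
apply/eqP/ext_coefP => S; rewrite ext_coef_ctr ext_coef0 ext_coef_basis.
case: ifP => // iS; case: eqP => [e|_]; last by rewrite mulr0.
by have := setU11 i S; rewrite e inE.
Qed.

(* [contr c] is the antiderivation extending the linear form [c]. *)
Lemma contrM c x y : contr c (x * y) = contr c x * y + sgnE x * contr c y.
Proof.
elim/ext_ind: x => [|x1 x2 h1 h2|a x h|i x h].
- rewrite contr1 mul1r mul0r add0r.
  suff -> : sgnE 1 = 1 by rewrite mul1r.
  apply: ext_coefP => S; rewrite ext_coef_sgn ext_coef_basis.
  by case: eqP => [->|_]; rewrite ?cards0 ?mul1r ?mulr0.
- rewrite mulrDl !linearD /= h1 h2 mulrDl addrACA; congr (_ + _); rewrite -mulrDl.
  by congr (_ * _); apply: ext_coefP => S; rewrite ext_coefD !ext_coef_sgn ext_coefD mulrDr.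
- rewrite -scalerAl !linearZ /= h /= scalerDr -!scalerAl; congr (_ + _).
  rewrite scalerAl; congr (_ * _).
  by apply: ext_coefP => S; rewrite ext_coefZ !ext_coef_sgn ext_coefZ mulrCA.
rewrite -mulrA contr_genM h sgnE_genM contr_genM mulrDr mulrBl opprD !mulrA addrA.
by rewrite -scalerAl mulNr.
Qed.

Lemma contrC c d x : contr c (contr d x) = - contr d (contr c x).
Proof.
elim/ext_ind: x => [|x1 x2 h1 h2|a x h|i x h].
- by rewrite !contr1 !raddf0.
- by rewrite !contrD h1 h2 opprD.
- by rewrite !contrZ h scalerN.
rewrite !contr_genM !contrB !contrZ !contr_genM h mulrN.
by rewrite !opprB addrA.
Qed.

Lemma contr_sqr c x : contr c (contr c x) = 0.
Proof.
elim/ext_ind: x => [|x1 x2 h1 h2|a x h|i x h].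
- by rewrite contr1 raddf0.
- by rewrite !contrD h1 h2 addr0.
- by rewrite !contrZ h scaler0.
by rewrite contr_genM contrB contrZ contr_genM h mulr0 subr0 subrr.
Qed.

Definition ones : V := const_mx 1.

Lemma ctr_basis i S : ctr i (ext_basis K S) =
  if i \in S then (-1) ^+ pos i S *: ext_basis K (S :\ i) else 0.
Proof.
case: ifP => iS.
  rewrite {1}(ext_basis_D1 iS) linearZ /= ctr_genM eqxx scale1r.
  suff -> : ctr i (ext_basis K (S :\ i)) = 0 by rewrite mulr0 subr0.
  apply: ext_coefP => T; rewrite ext_coef_ctr ext_coef0 ext_coef_basis.
  case: ifP => // _; case: eqP => [e|_]; last by rewrite mulr0.
  by have := setU11 i T; rewrite e setD11.
apply: ext_coefP => T; rewrite ext_coef_ctr ext_coef0 ext_coef_basis.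
case: ifP => // _; case: eqP => [e|_]; last by rewrite mulr0.
by have := setU11 i T; rewrite e iS.
Qed.

(** The boundary map is the antiderivation sending each [e_i] to 1, hence a contraction; its square
    is zero and it anticommutes with all other contractions. *)
Lemma ext_partialE S : ext_partial K S = contr ones (ext_basis K S).
Proof.
rewrite /ext_partial /contr big_mkcond; apply: eq_bigr => i _.
by rewrite ctr_basis mxE scale1r /pos; case: ifP.
Qed.

End Contraction.

Section Degrees.
Variables (K : fieldType) (n : nat).
Local Notation E := (ext K n).
Implicit Types (S T : {set 'I_n}) (x y z : E) (P : pred int).

(** Projection onto the degrees selected by a predicate: one operator for single degrees and for
    truncations, with integers as degrees so that shifts may be negative. *)
Definition prE P x : E :=
  [ffun S : {set 'I_n} => if P #|S|%:Z then ext_coef x S else 0].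

Lemma ext_coef_pr P x S : ext_coef (prE P x) S = if P #|S|%:Z then ext_coef x S else 0.
Proof. by rewrite /ext_coef ffunE. Qed.

Lemma prE_is_linear P : linear (prE P).
Proof.
move=> a x y; apply: ext_coefP => S; rewrite ext_coefD ext_coefZ !ext_coef_pr.
by case: ifP => _; rewrite ?mulr0 ?addr0 // ext_coefD ext_coefZ.
Qed.
HB.instance Definition _ P := GRing.isLinear.Build K E E *:%R (prE P) (prE_is_linear P).

Lemma eq_prE P1 P2 x : P1 =1 P2 -> prE P1 x = prE P2 x.
Proof. by move=> e; apply: ext_coefP => S; rewrite !ext_coef_pr e. Qed.

Lemma prE_mulr P q x y : homogeneous q y ->
  prE P (x * y) = prE (fun t => P (t + q)) x * y.
Proof.
move=> hy; apply: ext_coefP => S; rewrite ext_coef_pr !ext_coefM.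
transitivity (\sum_(A : {set 'I_n} | A \subset S) if P #|S|%:Z then
    (-1) ^+ ninv A (S :\: A) * (ext_coef x A * ext_coef y (S :\: A)) else 0).
  by case: (P #|S|%:Z) => //; rewrite big1.
apply: eq_bigr => A sAS; rewrite ext_coef_pr.
case: (eqVneq (ext_coef y (S :\: A)) 0) => [->|/hy hq]; first by rewrite !mulr0 if_same.
suff -> : #|S|%:Z = #|A|%:Z + q by case: ifP => //; rewrite mul0r mulr0.
by rewrite -hq -PoszD -(cardsID A S) (setIidPr sAS).
Qed.

Lemma prE_mull P q x y : homogeneous q y ->
  prE P (y * x) = y * prE (fun t => P (t + q)) x.
Proof.
move=> hy; apply: ext_coefP => S; rewrite ext_coef_pr !ext_coefM.
transitivity (\sum_(A : {set 'I_n} | A \subset S) if P #|S|%:Z then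
    (-1) ^+ ninv A (S :\: A) * (ext_coef y A * ext_coef x (S :\: A)) else 0).
  by case: (P #|S|%:Z) => //; rewrite big1.
apply: eq_bigr => A sAS; rewrite ext_coef_pr.
case: (eqVneq (ext_coef y A) 0) => [->|/hy hq]; first by rewrite !mul0r mulr0 if_same.
suff -> : #|S|%:Z = #|S :\: A|%:Z + q by case: ifP => //; rewrite !mulr0.
by rewrite -hq -PoszD -(cardsID A S) (setIidPr sAS) addnC.
Qed.

Lemma homogeneous_basis S : homogeneous #|S|%:Z (ext_basis K S).
Proof. by move=> T; rewrite ext_coef_basis; case: (T =P S) => [->//|_]; rewrite eqxx. Qed.

Lemma homogeneous_gen i : homogeneous 1 (ext_gen K i : E).
Proof. by have h := @homogeneous_basis [set i]; rewrite cards1 in h. Qed.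

Lemma homogeneousD q x y : homogeneous q x -> homogeneous q y -> homogeneous q (x + y).
Proof.
move=> hx hy S; rewrite ext_coefD.
case: (eqVneq (ext_coef x S) 0) => [->|/hx //]; rewrite add0r; exact: hy.
Qed.

Lemma homogeneousZ q a x : homogeneous q x -> homogeneous q (a *: x).
Proof.
move=> hx S; rewrite ext_coefZ.
by case: (eqVneq (ext_coef x S) 0) => [->|/hx //]; rewrite mulr0 eqxx.
Qed.

Lemma homogeneous0 q : homogeneous q (0 : E).
Proof. by move=> S; rewrite ext_coef0 eqxx. Qed.

Lemma homogeneous_sum q (I : Type) (r : seq I) (P : pred I) (F : I -> E) :
  (forall i, P i -> homogeneous q (F i)) -> homogeneous q (\sum_(i <- r | P i) F i).
Proof.
move=> h; elim/big_ind: _ => //; [exact: homogeneous0|exact: homogeneousD].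
Qed.

Lemma homogeneous_vec w : homogeneous 1 (vec w : E).
Proof. by apply: homogeneous_sum => i _; apply/homogeneousZ/homogeneous_gen. Qed.

Lemma homogeneous_prP q x : homogeneous q x <-> prE (pred1 q) x = x.
Proof.
split=> [h|<- S]; last by rewrite ext_coef_pr /=; case: ifP => [/eqP//|_]; rewrite eqxx.
apply: ext_coefP => S; rewrite ext_coef_pr /=.
case: (eqVneq (ext_coef x S) 0) => [->|/h ->]; rewrite ?eqxx ?if_same //.
Qed.

Lemma homogeneous_pr q x : homogeneous q (prE (pred1 q) x).
Proof. by move=> S; rewrite ext_coef_pr /=; case: ifP => [/eqP//|_]; rewrite eqxx. Qed.

Lemma prE_comp P1 P2 x : prE P1 (prE P2 x) = prE (predI P1 P2) x.
Proof. by apply: ext_coefP => S; rewrite !ext_coef_pr /=; case: (P1 _). Qed.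

Lemma prE_none P x : (forall S, P #|S|%:Z = false) -> prE P x = 0.
Proof. by move=> h; apply: ext_coefP => S; rewrite ext_coef_pr h ext_coef0. Qed.

Lemma prE_homogeneous P q x : homogeneous q x -> prE P x = if P q then x else 0.
Proof.
move=> h; apply: ext_coefP => S; rewrite ext_coef_pr.
case: (eqVneq (ext_coef x S) 0) => [e|/h ->]; last by case: ifP => // _; rewrite ext_coef0.
by rewrite e if_same; case: ifP; rewrite ?e ?ext_coef0.
Qed.

Lemma ext_sum_degrees x : x = \sum_(d < n.+1) prE (pred1 d%:Z) x.
Proof.
apply: ext_coefP => S; rewrite ext_coef_sum.
have hS : (#|S| < n.+1)%N by rewrite ltnS (leq_trans (max_card _)) ?card_ord.
rewrite (bigD1 (Ordinal hS)) //= ext_coef_pr /= eqxx big1 ?addr0 // => d nd.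
by rewrite ext_coef_pr /=; case: eqP => // -[e]; case/eqP: nd; apply: val_inj.
Qed.

End Degrees.

Notation fmod K n r := {ffun 'I_r -> ext K n}.

(** * Free modules and their functionals *)

Section FreeModules.
Variables (K : fieldType) (n : nat).
Local Notation E := (ext K n).
Local Notation V := 'rV[K]_n.
Local Notation X r := (fmod K n r).
Implicit Types (r : nat).

Definition fmk r (f : 'I_r -> E) : X r := [ffun k => f k].

Lemma fmkE r (f : 'I_r -> E) k : fmk f k = f k. Proof. by rewrite ffunE. Qed.
Lemma fmodP r (x y : X r) : x =1 y <-> x = y. Proof. exact: ffunP. Qed.

Lemma fmod_sumE r (I : Type) (s : seq I) (P : pred I) (F : I -> X r) k :
  (\sum_(i <- s | P i) F i) k = \sum_(i <- s | P i) F i k.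
Proof. by apply: (big_morph (fun x : X r => x k)) => [x y|]; rewrite ffunE. Qed.

Lemma fmap_is_linear r (f : 'I_r -> {linear E -> E}) :
  linear (fun x : X r => fmk (fun k => f k (x k))).
Proof. by move=> a x y; apply/ffunP => k; rewrite !ffunE linearP. Qed.
Definition fmap_fun r (f : 'I_r -> {linear E -> E}) (x : X r) := fmk (fun k => f k (x k)).
HB.instance Definition _ r f := GRing.isLinear.Build K (X r) (X r) *:%R
  (@fmap_fun r f) (@fmap_is_linear r f).
Definition fmap r f : 'End(X r) := linfun (@fmap_fun r f).

Lemma fmapE r f (x : X r) k : fmap f x k = f k (x k).
Proof. by rewrite lfunE /= fmkE. Qed.

Lemma lmul_is_linear (u : E) : linear (fun x : E => u * x).
Proof. by move=> a x y; rewrite mulrDr -scalerAr. Qed.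
Definition lmul_fun (u x : E) := u * x.
HB.instance Definition _ u := GRing.isLinear.Build K E E *:%R (lmul_fun u) (lmul_is_linear u).

Definition lmulX r (u : E) : 'End(X r) := fmap (fun=> lmul_fun u).
Definition contrX r (c : V) : 'End(X r) := fmap (fun=> contr c).
Definition prX r (P : 'I_r -> pred int) : 'End(X r) := fmap (fun k => prE (P k)).

Lemma lmulXE r u (x : X r) k : lmulX r u x k = u * x k. Proof. by rewrite fmapE. Qed.
Lemma contrXE r c (x : X r) k : contrX r c x k = contr c (x k). Proof. by rewrite fmapE. Qed.
Lemma prXE r P (x : X r) k : prX P x k = prE (P k) (x k). Proof. by rewrite fmapE. Qed.

Lemma act_is_linear r s (D : 'M[E]_(r, s)) :
  linear (fun x : X r => fmk (fun l => \sum_k x k * D k l)).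
Proof.
move=> a x y; apply/ffunP => l; rewrite !ffunE scaler_sumr -big_split.
by apply: eq_bigr => k _; rewrite !ffunE mulrDl -scalerAl.
Qed.
Definition act_fun r s (D : 'M[E]_(r, s)) (x : X r) : X s :=
  fmk (fun l => \sum_k x k * D k l).
HB.instance Definition _ r s D := GRing.isLinear.Build K (X r) (X s) *:%R
  (@act_fun r s D) (@act_is_linear r s D).
Definition act r s (D : 'M[E]_(r, s)) : 'Hom(X r, X s) := linfun (act_fun D).

Lemma actE r s (D : 'M[E]_(r, s)) x l : act D x l = \sum_k x k * D k l.
Proof. by rewrite lfunE /= fmkE. Qed.

Lemma act_lmul r s (D : 'M[E]_(r, s)) u x : act D (lmulX r u x) = lmulX s u (act D x).
Proof.
apply/fmodP => l; rewrite lmulXE !actE mulr_sumr.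
by apply: eq_bigr => k _; rewrite lmulXE mulrA.
Qed.

Lemma act_pr r s (D : 'M[E]_(r, s)) (d : 'I_r -> int) (d' : 'I_s -> int) (P : pred int) x :
  (forall k l, homogeneous (d k - d' l) (D k l)) ->
  prX (fun l t => P (d' l + t)) (act D x) = act D (prX (fun k t => P (d k + t)) x).
Proof.
move=> hD; apply/fmodP => l; rewrite prXE !actE linear_sum.
apply: eq_bigr => k _; rewrite /= (prE_mulr _ _ (hD k l)) prXE; congr (_ * _).
by apply: eq_prE => t; congr (P _); rewrite addrCA (addrC t) [d' l + _]addrC subrK addrC.
Qed.

Lemma pr_lmul r (P : 'I_r -> pred int) w x :
  prX P (lmulX r (vec w) x) = lmulX r (vec w) (prX (fun k t => P k (t + 1)) x).
Proof.
by apply/fmodP => k; rewrite prXE !lmulXE prXE (prE_mull _ _ (@homogeneous_vec _ _ w)).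
Qed.

Definition dualX r := 'Hom(X r, K^o).
Implicit Types (w c : V).

Definition op r w (f : dualX r) : dualX r := (f \o lmulX r (vec w))%VF.
Definition hop r c (f : dualX r) : dualX r := (f \o contrX r c)%VF.

Lemma opE r w (f : dualX r) x : op w f x = f (lmulX r (vec w) x).
Proof. by rewrite comp_lfunE. Qed.
Lemma hopE r c (f : dualX r) x : hop c f x = f (contrX r c x).
Proof. by rewrite comp_lfunE. Qed.

Lemma opX_B r w : {morph @op r w : f g / f - g}.
Proof. by move=> f g; apply/lfunP => x; rewrite opE add_lfunE opp_lfunE add_lfunE opp_lfunE !opE. Qed.
Lemma opX_0 r w : @op r w 0 = 0.
Proof. by apply/lfunP => x; rewrite opE !zero_lfunE. Qed.
Lemma hop0 r c : @hop r c 0 = 0.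
Proof. by apply/lfunP => x; rewrite hopE !zero_lfunE. Qed.

Lemma opX_C r u w (f : dualX r) : op u (op w f) = - op w (op u f).
Proof.
apply/lfunP => x; rewrite opp_lfunE !opE -linearN; congr (f _).
by apply/fmodP => k; rewrite !lmulXE [RHS]ffunE !lmulXE !mulrA vecC mulNr.
Qed.

Lemma opX_2 r w (f : dualX r) : op w (op w f) = 0.
Proof.
apply/lfunP => x; rewrite zero_lfunE !opE -[RHS](linear0 f); congr (f _).
by apply/fmodP => k; rewrite !lmulXE [RHS]ffunE mulrA vec_sqr mul0r.
Qed.

(** The transpose of [contr_vecM]. When [dot c w] is 1, [hop c] is a contracting homotopy for
    [op w]; when it is 0, the two anticommute. *)
Lemma op_hop r c w (f : dualX r) : op w (hop c f) + hop c (op w f) = dot c w *: f.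
Proof.
apply/lfunP => x; rewrite add_lfunE scale_lfunE opE !hopE opE -linearD -linearZ; congr (f _).
apply/fmodP => k; rewrite !ffunE contrXE !lmulXE contrXE.
by rewrite contr_vecM subrK.
Qed.

Lemma dual_basis (ws : seq V) : basis_of fullv ws ->
  exists cs : V -> V, forall u w, u \in ws -> w \in ws -> dot (cs w) u = (u == w)%:R.
Proof.
move=> bws; have fws := basis_free bws.
exists (fun w => \row_i odflt 0 (omap (fun j => coord (in_tuple ws) j (delta_mx 0 i))
  (insub (index w ws)))) => u w uws wws.
have iw : (index w ws < size ws)%N by rewrite index_mem.
rewrite /dot; under eq_bigr do rewrite mxE insubT /= mulrC.
have -> : \sum_(i < n) u 0 i * coord (in_tuple ws) (Sub (index w ws) iw) (delta_mx 0 i)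
    = coord (in_tuple ws) (Sub (index w ws) iw) u.
  rewrite [u in RHS]row_sum_delta linear_sum; apply: eq_bigr => i _.
  by rewrite linearZ.
have iu : (index u ws < size ws)%N by rewrite index_mem.
have {1}-> : u = (in_tuple ws)`_(Ordinal iu) by rewrite /= nth_index.
rewrite coord_free //; congr (_%:R); congr nat_of_bool.
rewrite -val_eqE /=; apply/eqP/eqP => [|->//]; first exact: index_inj.
Qed.

(** Contractions with the dual basis make all of [ws] an exact chain, leaving no variable.
    Polynomial degree 0 is excluded because functionals of the constant terms survive there. *)
Lemma reg_free r i m ws : basis_of fullv ws -> (0 < i)%N ->
  reg (@op r) i m ws (fun _ _ => True).
Proof.
move=> bws i0; have [cs csP] := dual_basis bws.
rewrite -[ws]cats0; apply/(reg_cat (@opX_B r) (@opX_C r) (@opX_2 r)) => //.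
  apply: (exact_chain_dual (@opX_B r) (@opX_C r) _ _ (h := @hop r \o cs)) => //.
  - exact: free_uniq (basis_free bws).
  - by move=> w _; rewrite /= hop0.
  - by move=> w f wws; rewrite op_hop csP // eqxx scale1r.
  move=> u w f uws wws uw; apply/eqP; rewrite -addr_eq0 op_hop csP //.
  by rewrite (negPf uw) scale0r.
move=> d f _ hf _ _; exists (fun=> 0) => [a|a].
  by apply: filtered0; apply: filtered_kers => //; [exact: opX_B|exact: opX_C].
by move/size0nil => ->; rewrite hf // eq_sym -lt0n.
Qed.

Lemma fmod_expand r (x : X r) :
  x = \sum_k \sum_S ext_coef (x k) S *: lmulX r (ext_basis K S) (fmk (fun l => (l == k)%:R)).
Proof.
apply/fmodP => k; rewrite fmod_sumE (bigD1 k) //= [Z in _ + Z]big1 ?addr0; last first.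
  move=> l nl; rewrite fmod_sumE big1 // => S _.
  by rewrite ffunE lmulXE fmkE eq_sym (negPf nl) mulr0 scaler0.
rewrite fmod_sumE [LHS]ext_expand; apply: eq_bigr => S _.
by rewrite ffunE lmulXE fmkE eqxx mulr1.
Qed.

(** A functional killed by all linear forms vanishes on the multiples of the generators, so it sees
    only constant terms. *)
Lemma op_closed0 r (ws : seq V) (f : dualX r) : basis_of fullv ws ->
  (forall w, w \in ws -> op w f = 0) ->
  forall x, f x = f (fmk (fun k => ext_aug (x k) *: 1)).
Proof.
move=> bws fws.
have fop w : op w f = 0.
  have /= wE := coord_basis (X := in_tuple ws) bws (memvf w); rewrite wE.
  apply/lfunP => x; rewrite opE zero_lfunE.
  have -> : lmulX r (vec (\sum_i coord (in_tuple ws) i w *: ws`_i)) x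
      = \sum_i coord (in_tuple ws) i w *: lmulX r (vec ws`_i) x.
    apply/fmodP => k; rewrite lmulXE fmod_sumE.
    have -> : vec (\sum_i coord (in_tuple ws) i w *: ws`_i) =
        \sum_i coord (in_tuple ws) i w *: vec ws`_i :> E.
      rewrite {1}/vec; under eq_bigr do rewrite summxE scaler_suml.
      rewrite exchange_big; apply: eq_bigr => i _ /=; rewrite scaler_sumr.
      by apply: eq_bigr => j _; rewrite mxE scalerA.
    by rewrite mulr_suml; apply: eq_bigr => i _; rewrite ffunE lmulXE -scalerAl.
  rewrite linear_sum big1 // => i _; rewrite linearZ /=.
  by rewrite -opE fws ?zero_lfunE ?scaler0 // mem_nth.
have fgen i x : f (lmulX r (ext_gen K i) x) = 0.
  have := fop (delta_mx 0 i); move/lfunP/(_ x); rewrite opE zero_lfunE => <-.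
  congr (f (lmulX r _ _)); rewrite /vec (bigD1 i) //= mxE !eqxx scale1r big1 ?addr0 //.
  by move=> j nj; rewrite mxE (negPf nj) andbF scale0r.
move=> x; rewrite {1}(fmod_expand x) linear_sum.
have -> : fmk (fun k => ext_aug (x k) *: 1) =
    \sum_k ext_aug (x k) *: fmk (fun l => (l == k)%:R) :> X r.
  apply/fmodP => k; rewrite fmkE fmod_sumE (bigD1 k) //= big1 ?addr0.
    by rewrite ffunE fmkE eqxx.
  by move=> l nl; rewrite ffunE fmkE eq_sym (negPf nl) scaler0.
rewrite [RHS]linear_sum; apply: eq_bigr => k _; rewrite linear_sum (bigD1 set0) //= big1 ?addr0.
  rewrite !linearZ; congr (_ *: f _); apply/fmodP => l.
  by rewrite lmulXE [Z in Z * _]/(1 : E) mul1r.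
move=> S S0; rewrite linearZ /=.
have /set0Pn [i iS] := S0.
rewrite (ext_basis_D1 _ iS) /=.
have -> : lmulX r ((-1) ^+ pos i S *: (ext_gen K i * ext_basis K (S :\ i)))
    (fmk (fun l => (l == k)%:R)) = (-1) ^+ pos i S *:
    lmulX r (ext_gen K i) (lmulX r (ext_basis K (S :\ i)) (fmk (fun l => (l == k)%:R))).
  by apply/fmodP => l; rewrite ffunE !lmulXE -scalerAl mulrA.
by rewrite linearZ /= fgen !scaler0.
Qed.

End FreeModules.
Arguments prX {K n r}.

(** * Linear resolutions and Koszul families *)

Lemma lfun_factor (K : fieldType) (X1 X2 X3 : vectType K) (g : 'Hom(X1, X2))
    (f : 'Hom(X1, X3)) :
  (forall x, g x = 0 -> f x = 0) -> f = ((f \o g^-1) \o g)%VF.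
Proof.
move=> gf; apply/lfunP => x; rewrite !comp_lfunE; apply/eqP.
rewrite -subr_eq0 -linearB; apply/eqP/gf.
by rewrite linearB /= limg_lfunVK ?subrr // memv_img ?memvf.
Qed.

Section Pullback.
Variables (K : fieldType) (n : nat).
Local Notation E := (ext K n).

Definition pullback r s (D : 'M[E]_(r, s)) (f : dualX K n s) : dualX K n r :=
  (f \o act D)%VF.

Lemma pullbackE r s (D : 'M[E]_(r, s)) f x : pullback D f x = f (act D x).
Proof. by rewrite comp_lfunE. Qed.

Lemma pullback_is_additive r s (D : 'M[E]_(r, s)) : zmod_morphism (pullback D).
Proof. by move=> f g; apply/lfunP => x; rewrite add_lfunE opp_lfunE !pullbackE add_lfunE opp_lfunE. Qed.
HB.instance Definition _ r s D := GRing.isZmodMorphism.Build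
  (dualX K n s) (dualX K n r) (@pullback r s D) (@pullback_is_additive r s D).

Lemma pullback_op r s (D : 'M[E]_(r, s)) w f : pullback D (op w f) = op w (pullback D f).
Proof. by apply/lfunP => x; rewrite !(pullbackE, opE) act_lmul. Qed.

Lemma delta_pullback r s (D : 'M[E]_(r, s)) ws f a :
  delta (@op K n r) ws (fun b => pullback D (f b)) a
  = pullback D (delta (@op K n s) ws f a).
Proof. by apply: delta_morph => w y; apply: pullback_op. Qed.

Definition cutoff r (P : 'I_r -> pred int) (f : dualX K n r) : dualX K n r :=
  (f \o prX P)%VF.

Lemma cutoffE r P (f : dualX K n r) x : cutoff P f x = f (prX P x).
Proof. by rewrite comp_lfunE. Qed.

Lemma eq_cutoff r (P Q : 'I_r -> pred int) (f : dualX K n r) :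
  (forall k t, P k t = Q k t) -> cutoff P f = cutoff Q f.
Proof.
move=> e; apply/lfunP => x; rewrite !cutoffE; congr (f _); apply/fmodP => k.
by rewrite !prXE; apply: eq_prE.
Qed.

Lemma op_cutoff r (P : 'I_r -> pred int) w f :
  op w (cutoff P f) = cutoff (fun k t => P k (t + 1)) (op w f).
Proof. by apply/lfunP => x; rewrite !(cutoffE, opE) pr_lmul. Qed.

Lemma delta_cutoff r (P : 'I_r -> pred int) ws f a :
  delta (@op K n r) ws (fun b => cutoff P (f b)) a
  = cutoff (fun k t => P k (t + 1)) (delta (@op K n r) ws f a).
Proof.
have cutoff0 Q : @cutoff r Q 0 = 0 by apply/lfunP => x; rewrite cutoffE !zero_lfunE.
have cutoffD Q : {morph @cutoff r Q : g h / g + h}.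
  by move=> g h; apply/lfunP => x; rewrite !(cutoffE, add_lfunE).
elim: ws f a => [|w ws IH] f [|i a] /=; rewrite ?cutoff0 //.
by rewrite IH cutoffD; case: i => [|j]; rewrite ?cutoff0 // op_cutoff.
Qed.

Lemma resf_is_linear r (c : 'I_r -> K) :
  linear (fun x : fmod K n r => \sum_k ext_aug (x k) * c k : K^o).
Proof.
move=> a x y; rewrite scaler_sumr -big_split; apply: eq_bigr => k _.
by rewrite !ffunE /ext_aug ext_coefD ext_coefZ mulrDl -mulrA.
Qed.
Definition resf_fun r (c : 'I_r -> K) (x : fmod K n r) : K^o := \sum_k ext_aug (x k) * c k.
HB.instance Definition _ r c := GRing.isLinear.Build K (fmod K n r) K^o *:%R
  (@resf_fun r c) (@resf_is_linear r c).
(** The functionals on [K (x) F], regarded as functionals on [F]; by [op_resf] and [op_closedE] they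
    are exactly those killed by every [op w]. *)
Definition resf r c : dualX K n r := linfun (@resf_fun r c).

Lemma resfE r c (x : fmod K n r) : resf c x = \sum_k ext_aug (x k) * c k.
Proof. by rewrite lfunE. Qed.

Lemma ext_augM (x y : E) : ext_aug (x * y) = ext_aug x * ext_aug y.
Proof.
rewrite /ext_aug ext_coefM (big_pred1 set0) => [|A]; last by rewrite /= subset0.
by rewrite ninv0l setD0 mul1r.
Qed.

Lemma ext_aug_vec (w : 'rV[K]_n) : ext_aug (vec w : E) = 0.
Proof.
apply/eqP; apply: contraT => /(@homogeneous_vec K n w set0).
by rewrite cards0.
Qed.

Lemma op_resf r w (c : 'I_r -> K) : op w (resf c) = 0.
Proof.
apply/lfunP => x; rewrite opE resfE zero_lfunE big1 // => k _.
by rewrite lmulXE ext_augM ext_aug_vec !mul0r.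
Qed.

Lemma ext_aug_sum (I : Type) (s : seq I) (P : pred I) (F : I -> E) :
  ext_aug (\sum_(i <- s | P i) F i) = \sum_(i <- s | P i) ext_aug (F i).
Proof. exact: ext_coef_sum. Qed.

Lemma op_closedE r ws (f : dualX K n r) : basis_of fullv ws ->
  (forall w, w \in ws -> op w f = 0) -> f = resf (fun k => f (fmk (fun l => (l == k)%:R))).
Proof.
move=> bws fws; apply/lfunP => x; rewrite resfE (op_closed0 bws fws).
have -> : fmk (fun k => ext_aug (x k) *: 1) =
    \sum_k ext_aug (x k) *: fmk (fun l => (l == k)%:R) :> fmod K n r.
  apply/fmodP => k; rewrite fmkE fmod_sumE (bigD1 k) //= big1 ?addr0.
    by rewrite ffunE fmkE eqxx.
  by move=> l nl; rewrite ffunE fmkE eq_sym (negPf nl) scaler0.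
by rewrite linear_sum; apply: eq_bigr => k _; rewrite linearZ.
Qed.

End Pullback.
Arguments resf {K n r}.

(** * From vanishing Tor to exactness of Koszul families *)

Section Chase.
Variables (K : fieldType) (n : nat) (N : ext K n -> Prop).
Variable F : graded_free_resolution N.
Local Notation E := (ext K n).

(* The augmented complex, with [E] in homological degree 0. *)
Definition Grk p : nat := if p is q.+1 then fr_rank F q else 1%N.
Definition Gdeg p : 'I_(Grk p) -> int :=
  match p with 0 => fun=> 0 | q.+1 => @fr_degree _ _ _ F q end.
Definition Gmap p : 'M[E]_(Grk p.+1, Grk p) :=
  match p with 0 => fr_aug F | q.+1 => fr_diff F q end.

Definition rowX r (x : fmod K n r) : 'rV[E]_r := \row_k x k.
Definition Xrow r (v : 'rV[E]_r) : fmod K n r := fmk (fun k => v 0 k).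

Lemma rowXK r : cancel (@rowX r) (@Xrow r).
Proof. by move=> x; apply/fmodP => k; rewrite fmkE mxE. Qed.
Lemma XrowK r : cancel (@Xrow r) (@rowX r).
Proof. by move=> v; apply/rowP => k; rewrite mxE fmkE. Qed.

Lemma rowX_act r s (D : 'M[E]_(r, s)) x : rowX (act D x) = rowX x *m D.
Proof.
by apply/rowP => l; rewrite mxE actE mxE; apply: eq_bigr => k _; rewrite mxE.
Qed.

Lemma act_eq0 r s (D : 'M[E]_(r, s)) x : act D x = 0 <-> rowX x *m D = 0.
Proof.
rewrite -rowX_act; split=> [->|h]; first by apply/rowP => k; rewrite !mxE ffunE.
by rewrite -(rowXK (act D x)) h; apply/fmodP => k; rewrite fmkE mxE ffunE.
Qed.

Lemma Gmap_exact p x : act (Gmap p) x = 0 <-> exists y, x = act (Gmap p.+1) y.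
Proof.
rewrite act_eq0; have -> : rowX x *m Gmap p = 0 <-> exists w, rowX x = w *m Gmap p.+1.
  by case: p x => [|p] x; [apply: fr_exact0|apply: fr_exactS].
split=> [[w xw]|[y ->]]; last by exists (rowX y); rewrite rowX_act.
by exists (Xrow w); rewrite -(rowXK x) xw -[w in LHS](XrowK w) -rowX_act rowXK.
Qed.

Lemma Gmap_homogeneous p k l : homogeneous (Gdeg k - Gdeg l) (Gmap p k l).
Proof.
case: p k l => [|p] k l; last exact: fr_diff_homogeneous.
by rewrite (ord1 l) subr0; apply: fr_aug_homogeneous.
Qed.

Lemma Gmap_image x : N x <-> exists y, fmk (fun=> x) = act (Gmap 0) y.
Proof.
rewrite (fr_aug_image F); split=> [[v xv]|[y xy]].
  exists (Xrow v); apply/fmodP => l; rewrite (ord1 l) fmkE xv.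
  have /rowP/(_ 0) := rowX_act (Gmap 0) (Xrow v).
  by rewrite XrowK mxE => ->.
exists (rowX y); have /rowP/(_ 0) := rowX_act (Gmap 0) y.
by rewrite mxE -xy fmkE.
Qed.

(* Vanishing of the homology of [K (x) F] gives vanishing of the dual one. *)
Lemma tor_dual p (P : pred int) (c : 'cV[K]_(fr_rank F p)) :
  (forall d, P d -> tor_dim F p d = 0%N) ->
  (forall k, ~~ P (fr_degree k) -> c k 0 = 0) ->
  tensor_diff F p *m c = 0 ->
  forall x : 'rV[K]_(fr_rank F p), (x <= tensor_kernel F p)%MS -> x *m c = 0.
Proof.
move=> torP cP Tc x xker.
(* [x] is split by internal degree: vanishing Tor makes its components in the degrees of [P]
   boundaries, and [c] vanishes on the others. *)
pose ds := undup [seq fr_degree k | k : 'I_(fr_rank F p)].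
have xE : x = \sum_(d <- ds) x *m tensor_degree F p d.
  apply/rowP => k; rewrite summxE.
  have kds : fr_degree k \in ds by rewrite mem_undup map_f ?mem_enum.
  rewrite (big_rem _ kds) /= big_seq big1 => [|d].
    by rewrite addr0 mul_mx_diag !mxE eqxx mulr1.
  rewrite mem_rem_uniq ?undup_uniq // inE => /andP[nd _].
  by rewrite mul_mx_diag !mxE eq_sym (negPf nd) mulr0.
rewrite xE mulmx_suml big1_seq // => d _.
have [Pd|nPd] := boolP (P d); last first.
  apply/matrixP => i j; rewrite (ord1 j) mxE [RHS]mxE big1 // => k _.
  rewrite mul_mx_diag !mxE; case: eqP => [e|_]; last by rewrite mulr0 mul0r.
  by rewrite cP ?mulr0 // e.
have xker' : (x *m tensor_degree F p d <= tensor_kernel F p)%MS.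
  case: p => [|q] in c torP cP Tc x xker ds xE d Pd *; first by rewrite submx1.
  have Tdeg : tensor_degree F q.+1 d *m tensor_diff F q
      = tensor_diff F q *m tensor_degree F q d.
    apply/matrixP => k l; rewrite mul_diag_mx mul_mx_diag !mxE mulrC.
    case: (eqVneq (ext_aug (fr_diff F q k l)) 0) => [->|/(@fr_diff_homogeneous _ _ _ F q k l _)].
      by rewrite !mul0r.
    by rewrite cards0 => /esym/eqP; rewrite subr_eq0 => /eqP ->.
  apply/sub_kermxP; rewrite -mulmxA Tdeg mulmxA.
  by move/sub_kermxP: xker => ->; rewrite mul0mx.
have xcyc : (x *m tensor_degree F p d <= tensor_cycles F p d)%MS.
  by rewrite sub_capmx submxMl.
have cb : (tensor_cycles F p d <= tensor_boundaries F p d)%MS.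
  have /eqP := torP d Pd; rewrite /tor_dim mxrank_eq0 => /eqP e0.
  rewrite -(addsmx_diff_cap_eq (tensor_cycles F p d) (tensor_boundaries F p d)).
  by rewrite e0 adds0mx capmxSr.
have /submxP[y ->] := submx_trans xcyc cb.
by rewrite /tensor_boundaries -!mulmxA Tc !mulmx0.
Qed.

Lemma kermx_factor (p q : nat) (T : 'M[K]_(p, q)) (c : 'cV[K]_p) :
  kermx T *m c = 0 -> c = T *m (pinvmx T *m c).
Proof.
move=> kc; apply/eqP; rewrite -subr_eq0 mulmxA -[X in X - _]mul1mx -mulmxBl.
have /submxP[y ->] : (1%:M - T *m pinvmx T <= kermx T)%MS.
  by apply/sub_kermxP; rewrite mulmxBl mul1mx mulmxKpV ?subrr ?submx_refl.
by rewrite -mulmxA kc mulmx0.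
Qed.

Variables (ws : seq 'rV[K]_n).
Hypothesis bws : basis_of fullv ws.

Definition supported p (P : pred int) (f : dualX K n (Grk p)) :=
  cutoff (fun k t => P (Gdeg k + t)) f = f.

(** A closed functional comes from [K (x) F_p], and its vanishing pull-back makes it a cocycle of
    the dual complex. In the degrees of [P] that complex is exact, so it is a coboundary; for
    [p = 0] there is no earlier term and it is zero. *)
Lemma residue_step p (P : pred int) (f : dualX K n (Grk p.+1)) :
  (forall d, P d -> tor_dim F p d = 0%N) -> supported P f ->
  (forall w, w \in ws -> op w f = 0) -> pullback (Gmap p.+1) f = 0 ->
  exists g : dualX K n (Grk p), [/\ forall w, op w g = 0, f = pullback (Gmap p) g
    & p = 0%N -> f = 0].
Proof.
move=> torP Pf fws fG.
have [c [fE cP Tc]] : exists c : 'cV[K]_(fr_rank F p),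
    [/\ forall x, f x = \sum_k ext_aug (x k) * c k 0,
        forall k, ~~ P (fr_degree k) -> c k 0 = 0 & tensor_diff F p *m c = 0].
  pose e k : fmod K n (fr_rank F p) := fmk (fun l => (l == k)%:R).
  have fE x : f x = \sum_k ext_aug (x k) * (\col_k f (e k)) k 0.
    by rewrite {1}(op_closedE bws fws) resfE; apply: eq_bigr => k _; rewrite mxE.
  exists (\col_k f (e k)); split=> // [k nP|].
    rewrite mxE -Pf cutoffE -[RHS](linear0 f); congr (f _).
    apply/fmodP => l; rewrite prXE fmkE [RHS]ffunE.
    case: eqP => [->|_]; last by rewrite raddf0.
    apply: ext_coefP => S; rewrite ext_coef_pr ext_coef0.
    rewrite [ext_coef _ _]ext_coef_basis; case: (S =P set0) => [->|_]; last by rewrite if_same.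
    by rewrite cards0 addr0 (negPf nP).
  apply/colP => k; rewrite mxE [RHS]mxE.
  have /lfunP/(_ (fmk (fun l => (l == k)%:R))) := fG.
  rewrite pullbackE zero_lfunE fE => {2}<-; apply: eq_bigr => l _.
  congr (_ * _); rewrite mxE actE; congr ext_aug.
  by rewrite (bigD1 k) //= big1 ?addr0 ?fmkE ?eqxx ?mul1r // => j /negPf nj; rewrite fmkE nj mul0r.
have xc := tor_dual torP cP Tc.
case: p => [|q] in f torP Pf fws fG c fE cP Tc xc *.
  have f0 : f = 0.
    apply/lfunP => x; rewrite fE zero_lfunE.
    have := xc (\row_k ext_aug (x k)) (submx1 _).
    by move/matrixP/(_ 0 0); rewrite mxE [RHS]mxE => {2}<-; apply: eq_bigr => k _; rewrite mxE.
  by exists 0; split=> // [w|]; [exact: opX_0|rewrite f0 raddf0].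
have kc : kermx (tensor_diff F q) *m c = 0.
  by apply/row_matrixP => i; rewrite row_mul row0; apply/xc/row_sub.
exists (resf (fun l => (pinvmx (tensor_diff F q) *m c) l 0)); split=> // [w|].
  exact: op_resf.
apply/lfunP => x; rewrite fE pullbackE resfE.
have cE k : c k 0 = \sum_l ext_aug (fr_diff F q k l) * (pinvmx (tensor_diff F q) *m c) l 0.
  by rewrite {1}(kermx_factor kc) mxE; apply: eq_bigr => l _; rewrite mxE.
under eq_bigr do rewrite cE mulr_sumr.
rewrite exchange_big; apply: eq_bigr => l _ /=.
rewrite actE ext_aug_sum mulr_suml; apply: eq_bigr => k _.
by rewrite ext_augM mulrA.
Qed.

Lemma supported_pullback p (P : pred int) (f : dualX K n (Grk p)) :
  supported P f -> supported P (pullback (Gmap p) f).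
Proof.
move=> Pf; apply/lfunP => x; rewrite cutoffE !pullbackE -[in RHS]Pf cutoffE.
by rewrite (act_pr _ _ (@Gmap_homogeneous p)).
Qed.

Lemma cutoff_idem r (P : 'I_r -> pred int) (f : dualX K n r) :
  cutoff P (cutoff P f) = cutoff P f.
Proof.
apply/lfunP => x; rewrite !cutoffE; congr (f _); apply/fmodP => k.
rewrite !prXE prE_comp; apply: eq_prE => t /=; exact: andbb.
Qed.

Lemma cutoff_shift r (d : 'I_r -> int) (P : pred int) (f : dualX K n r) :
  cutoff (fun k t => (fun e => P (e - 1)) (d k + (t + 1))) f = cutoff (fun k t => P (d k + t)) f.
Proof.
apply/lfunP => x; rewrite !cutoffE; congr (f _); apply/fmodP => k; rewrite !prXE.
by apply: eq_prE => t; rewrite addrA addrK.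
Qed.

(* The comparison of the complexes of functionals on [F] and of the residue
   complex, by induction on the polynomial degree. *)
Lemma chase i p (P : pred int) (f : seq nat -> dualX K n (Grk p.+1)) :
  (forall d j, P d -> tor_dim F (p + j) (d + j%:Z) = 0%N) ->
  homfam i f -> (forall a, supported P (f a)) ->
  (forall a, size a = size ws -> delta (@op K n _) ws f a = 0) ->
  (forall a, pullback (Gmap p.+1) (f a) = 0) ->
  exists g : seq nat -> dualX K n (Grk p),
    [/\ homfam i g, forall a, size a = size ws -> delta (@op K n _) ws g a = 0
       & forall a, size a = size ws -> f a = pullback (Gmap p) (g a)].
Proof.
elim: i p P f => [|i IH] p P f torP hf Pf df fG.
  pose z := nseq (size ws) 0%N.
  have zP a : size a = size ws -> sumn a = 0%N -> a = z.
    rewrite /z => <-; elim: a => [|[|j] a IHa] //= /IHa {1}->; rewrite ?size_nseq //.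
  case: (@residue_step p P (f z)) => // [d Pd||g [gw gP _]].
  - by have := torP d 0%N Pd; rewrite addn0 addr0.
  - exact: (delta_closed_degree0 df).
  exists (fun a => if a == z then g else 0); split=> [a na|a sa|a sa].
  - by case: (a =P z) na => // ->; rewrite /z sumn_nseq.
  - apply: delta_closed => w b.
    by case: ifP => _ //; apply: opX_0.
  - case: eqP => [->//|/eqP na]; rewrite raddf0 hf //.
    by apply: contraNneq na => /zP ->.
(* [f] is a [delta] over the free module. The trimmed preimage [u] becomes closed on the next
   module, one polynomial degree lower and one internal degree higher, where the induction
   hypothesis applies. *)
have [h _ hP] := reg_free bws (ltn0Sn i) (leqnn 0) hf (fun=> I) df.
pose P' : pred int := fun e => P (e - 1).
pose u a := cutoff (fun k t => P' (Gdeg k + t)) (degpart (fun s => s.+1 == i.+1)%N h a).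
have Pu a : supported P' (u a) by exact: cutoff_idem.
have hu : homfam i u.
  move=> a na; rewrite /u /degpart eqSS (negPf na).
  by apply/lfunP => x; rewrite cutoffE !zero_lfunE.
have du a : size a = size ws -> delta (@op K n _) ws u a = f a.
  move=> sa; rewrite delta_cutoff.
  rewrite (delta_degpart (@opX_B K n _) ws (fun s => s == i.+1)) hP // cutoff_shift.
  by case: eqP => [_|/eqP /hf ->]; [exact: Pf|apply/lfunP => x; rewrite cutoffE !zero_lfunE].
case: (IH p.+1 P' (fun a => pullback (Gmap p.+1) (u a))) => [d j Pd|a na|a|a sa|a|v [hv dv vP]].
- by have := torP (d - 1) j.+1 Pd; rewrite addnS addSn -addrA intS addKr.
- by rewrite hu // raddf0.
- exact: supported_pullback.
- by rewrite delta_pullback du.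
- apply/lfunP => x; rewrite !pullbackE zero_lfunE -[RHS](linear0 (u a)); congr (u a _).
  by apply/Gmap_exact; exists x.
(* [u - v] vanishes on the image of the next map, that is on the kernel of [Gmap p], and so factors
   through [Gmap p]. As [v] is closed, the [delta] of the factor pulls back to [f]. *)
pose y a := if size a == size ws then u a - v a else 0.
have yG a x : act (Gmap p) x = 0 -> y a x = 0.
  move=> /Gmap_exact[x' ->]; rewrite /y; case: eqP => [sa|_]; last by rewrite zero_lfunE.
  have /lfunP/(_ x') := vP a sa; rewrite !pullbackE => ux.
  by rewrite add_lfunE opp_lfunE ux subrr.
pose q a := (y a \o (act (Gmap p))^-1)%VF.
have yE a : y a = pullback (Gmap p) (q a) by apply: lfun_factor => x; apply: yG.
exists (delta (@op K n _) ws q); split=> [a na|a sa|a sa].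
- apply: (homfam_delta (@opX_B K n _)) na => b nb; rewrite /q /y hu // hv // subrr if_same.
  by apply/lfunP => x; rewrite comp_lfunE !zero_lfunE.
- exact: (delta_delta (@opX_B K n _) (@opX_C K n _) (@opX_2 K n _)).
rewrite -delta_pullback; transitivity (delta (@op K n _) ws (fun b => u b - v b) a).
  by rewrite (deltaB (@opX_B K n _)) du // dv // subr0.
by apply: eq_delta_size => // b sb; rewrite -yE /y sb eqxx.
Qed.

End Chase.

Section Annihilator.
Variables (K : fieldType) (n r : nat) (Z : fmod K n r -> Prop).

Definition annih d (f : dualX K n r) : Prop :=
  (forall x, Z x -> f x = 0) /\ cutoff (fun _ t => d%:Z <= t) f = f.

Lemma cutoffB (P : 'I_r -> pred int) : {morph @cutoff K n r P : f g / f - g}.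
Proof. by move=> f g; apply/lfunP => x; rewrite !(cutoffE, add_lfunE, opp_lfunE). Qed.

Lemma cutoff0 (P : 'I_r -> pred int) : @cutoff K n r P 0 = 0.
Proof. by apply/lfunP => x; rewrite cutoffE !zero_lfunE. Qed.

Lemma op_cutoff_ge d w (f : dualX K n r) :
  op w (cutoff (fun _ t => d.+1%:Z <= t) f) = cutoff (fun _ t => d%:Z <= t) (op w f).
Proof.
rewrite op_cutoff; apply/lfunP => x; rewrite !cutoffE; congr (_ _).
by apply/fmodP => k; rewrite !prXE; apply: eq_prE => t; rewrite intS addrC lerD2r.
Qed.

Lemma filtered_annih : (forall w x, Z x -> Z (lmulX r (vec w) x)) -> filtered (@op K n r) annih.
Proof.
move=> ZM; split=> [d|d f g [Zf df] [Zg dg]|w d f [Zf df]]; split.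
- by move=> x _; rewrite zero_lfunE.
- exact: cutoff0.
- by move=> x Zx; rewrite add_lfunE opp_lfunE Zf // Zg // subr0.
- by rewrite cutoffB df dg.
- by move=> x Zx; rewrite opE Zf //; apply: ZM.
- by rewrite -op_cutoff_ge df.
Qed.

End Annihilator.

Section Linear.
Variables (K : fieldType) (n m : nat) (N : ext K n -> Prop).
Variable F : graded_free_resolution N.
Hypothesis Flin : forall (i : nat) (j : int), j != m%:Z -> tor_dim F i (i%:Z + j) = 0%N.
Variables (ws : seq 'rV[K]_n).
Hypothesis bws : basis_of fullv ws.

Lemma resolved_mul y x : N x -> N (y * x).
Proof.
move=> /(Gmap_image F)[z xz]; apply/(Gmap_image F); exists (lmulX _ y z).
by rewrite act_lmul -xz; apply/fmodP => k; rewrite lmulXE !fmkE.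
Qed.

Lemma resolved_pr P x : N x -> N (prE P x).
Proof.
move=> /(Gmap_image F)[z xz]; apply/(Gmap_image F).
exists (prX (fun k t => P (Gdeg k + t)) z).
rewrite -(act_pr _ _ (@Gmap_homogeneous _ _ _ F 0)) -xz.
by apply/fmodP => k; rewrite prXE !fmkE; apply: eq_prE => t; rewrite add0r.
Qed.

Definition sub1 (x : fmod K n 1) := N (x 0).

Lemma fmod1E (x : fmod K n 1) : x = fmk (fun=> x 0).
Proof. by apply/fmodP => k; rewrite fmkE (ord1 k). Qed.

Lemma sub1_Gmap x : sub1 x <-> exists y, x = act (Gmap F 0) y.
Proof. by rewrite /sub1 (Gmap_image F) -fmod1E. Qed.

Lemma filtered_sub1 : filtered (@op K n 1) (annih sub1).
Proof. by apply: filtered_annih => w x; rewrite /sub1 lmulXE; apply: resolved_mul. Qed.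

(** Write [f] as the [delta] of some [u] in degrees above [d]. On [F_0] the pull-back of [u] is
    closed because [f] kills [N]. It lives in degrees above [m], where Tor vanishes, so it is also
    the pull-back of a closed [v]; then [u - v] kills [N] and has the same [delta]. *)
Lemma reg_of_linear i : (0 < m)%N -> reg (@op K n 1) i m ws (annih sub1).
Proof.
move=> m0 d f md hf Qf df; case: i hf => [|i] hf.
  (* In polynomial degree 0 a closed functional sees only internal degree 0, whereas [f] lives in
     degrees at least [m], which is positive. *)
  have f0 a : size a = size ws -> f a = 0.
    move=> sa; have [sa0|na] := eqVneq (sumn a) 0%N; last exact: hf.
    have az : a = nseq (size ws) 0%N.
      by rewrite -sa; elim: a sa0 {sa} => [|[|j] a IHa] //= /IHa {1}->.
    have fa := op_closedE bws (delta_closed_degree0 df); rewrite -az in fa.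
    case: (Qf a) => _ <-; apply/lfunP => x; rewrite cutoffE zero_lfunE fa resfE big1 // => k _.
    rewrite prXE [ext_aug _]ext_coef_pr cards0 ifF ?mul0r //.
    by apply/negbTE; rewrite -ltNge ltz_nat (leq_trans m0).
  by exists (fun=> 0) => [a|a sa]; [apply: (filtered0 filtered_sub1)|rewrite delta0 ?f0 //; apply: opX_B].
have [h _ hP] := reg_free bws (ltn0Sn i) (leqnn 0) hf (fun=> I) df.
pose P : pred int := fun e => d.+1%:Z <= e.
pose u a := cutoff (fun _ => P) (degpart (fun s => s.+1 == i.+1)%N h a).
have Pu a : cutoff (fun _ => P) (u a) = u a by exact: cutoff_idem.
have hu : homfam i u by move=> a na; rewrite /u /degpart eqSS (negPf na) cutoff0.
have du a : size a = size ws -> delta (@op K n _) ws u a = f a.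
  move=> sa; rewrite delta_cutoff.
  rewrite (delta_degpart (@opX_B K n _) ws (fun s => s == i.+1)) hP //.
  have -> : cutoff (fun _ t => P (t + 1)) (if sumn a == i.+1 then f a else 0) =
            cutoff (fun _ t => d%:Z <= t) (f a).
    case: eqP => [_|/eqP /hf ->]; last by rewrite !cutoff0.
    apply/lfunP => x; rewrite !cutoffE; congr (_ _); apply/fmodP => k; rewrite !prXE.
    by apply: eq_prE => t; rewrite /P intS addrC lerD2r.
  by case: (Qf a).
case: (@chase _ _ _ F ws bws i 0 P (fun a => pullback (Gmap F 0) (u a)))
    => [e j Pe|a na|a|a sa|a|v [hv dv vP]].
- rewrite add0n addrC; apply: Flin; apply: contraTneq Pe => ->.
  by rewrite /P -ltNge ltz_nat ltnS.
- by rewrite hu // raddf0.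
- apply: supported_pullback; rewrite /supported; etransitivity; last exact: Pu.
  by apply: eq_cutoff => k t; rewrite /= add0r.
- rewrite delta_pullback du //; apply/lfunP => x; rewrite pullbackE zero_lfunE.
  by case: (Qf a) => fN _; apply/fN/sub1_Gmap; exists x.
- apply/lfunP => x; rewrite !pullbackE zero_lfunE -[RHS](linear0 (u a)); congr (u a _).
  by apply/(@Gmap_exact _ _ _ F 0); exists x.
pose g a := if size a == size ws then cutoff (fun _ => P) (u a - v a) else 0.
exists g => [a|a sa].
  rewrite /g; case: eqP => [sa|_]; last exact: (filtered0 filtered_sub1).
  split=> [x Nx|]; last exact: cutoff_idem.
  have /sub1_Gmap[y xy] : sub1 (prX (fun _ => P) x) by rewrite /sub1 prXE; apply: resolved_pr.
  have /lfunP/(_ y) := vP a sa; rewrite !pullbackE => uv.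
  by rewrite cutoffE xy add_lfunE opp_lfunE uv subrr.
transitivity (delta (@op K n _) ws (fun b => cutoff (fun _ => P) (u b - v b)) a).
  by apply: eq_delta_size => // b sb; rewrite /g sb eqxx.
rewrite delta_cutoff (deltaB (@opX_B K n _)) du // dv // subr0.
case: (Qf a) => _ <-; apply/lfunP => x; rewrite !cutoffE; congr (_ _); apply/fmodP => k.
by rewrite !prXE prE_comp; apply: eq_prE => t; rewrite /= /P intS addrC lerD2r andbb.
Qed.

(** A coordinate functional of degree [d], pulled back to [F_0], is closed because [N] has nothing
    in degree [d - 1]. If [d] differed from [m], the vanishing of Tor in homological degree 0 would
    make it zero, and with it every coordinate of [x]. *)
Lemma resolved_low_degree (d : nat) x : N x -> homogeneous d%:Z x -> x != 0 ->
  (forall y, N y -> homogeneous (d%:Z - 1) y -> y = 0) -> d = m.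
Proof.
move=> Nx hx x0 low; apply/eqP; apply: contraNT x0 => ndm; apply/eqP/ext_coefP => S.
rewrite ext_coef0; apply/eqP; apply: contraT => xS; exfalso; move/eqP: xS; apply.
have cS_lin : linear (fun z : fmod K n 1 => ext_coef (z 0) S : K^o).
  by move=> a y z; rewrite !ffunE ext_coefD ext_coefZ.
pose cS := GRing.isLinear.Build K (fmod K n 1) K^o *:%R _ cS_lin.
pose lS : {linear fmod K n 1 -> K^o} := HB.pack (fun z : fmod K n 1 => ext_coef (z 0) S : K^o) cS.
pose f : dualX K n 1 := cutoff (fun _ => pred1 d%:Z) (linfun lS).
have fE z : f z = if #|S|%:Z == d%:Z then ext_coef (z 0) S else 0.
  by rewrite cutoffE lfunE /= prXE ext_coef_pr.
pose g := pullback (Gmap F 0) f.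
have g0 : g = 0.
  case: (@residue_step _ _ _ F ws bws 0 (pred1 d%:Z) g) => [e /eqP ->|||| h [_ _ /(_ erefl)]] //.
  - by rewrite -[d%:Z]add0r; apply: Flin; rewrite eqz_nat.
  - apply: supported_pullback; rewrite /supported; etransitivity; last exact: cutoff_idem.
    by apply: eq_cutoff => k t; rewrite /= add0r.
  - move=> w wws; apply/lfunP => z; rewrite opE pullbackE act_lmul fE lmulXE zero_lfunE.
    case: eqP => // eS; set y := act _ z 0.
    have Ny : N y by apply/sub1_Gmap; exists z.
    have y0 := low _ (resolved_pr (pred1 (d%:Z - 1)) Ny) (@homogeneous_pr _ _ _ _).
    have := ext_coef_pr (pred1 d%:Z) (vec w * y) S; rewrite /= eS eqxx => <-.
    rewrite (prE_mull _ _ (@homogeneous_vec _ _ w)) (_ : prE _ y = 0) ?mulr0 ?ext_coef0 //.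
    by rewrite -[RHS]y0; apply: eq_prE => t; rewrite /= [RHS]eq_sym subr_eq eq_sym.
  - apply/lfunP => z; rewrite !pullbackE zero_lfunE -[RHS](linear0 f); congr (f _).
    by apply/(@Gmap_exact _ _ _ F 0); exists z.
have [y xy] := (Gmap_image F x).1 Nx.
have [eS|/eqP nS] := #|S|%:Z =P d%:Z; last by apply/eqP; apply: contraT => /hx /eqP; rewrite (negPf nS).
by have := congr1 (fun h : dualX K n (Grk F 1) => h y) g0; rewrite pullbackE -xy fE fmkE eS eqxx zero_lfunE.
Qed.

End Linear.

(** * Generic linear forms *)

Section IteratedPolynomials.
Variable K : fieldType.

(** Polynomials are nested so that their coefficients are indexed by the exponent lists on which
    [delta] recurses. *)
Fixpoint polyN k : idomainType := if k is k'.+1 then {poly polyN k'} else K.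

Fixpoint polyNC k : {rmorphism K -> polyN k} :=
  match k return {rmorphism K -> polyN k} with
  | 0 => idfun
  | k'.+1 => (@polyC (polyN k')) \o polyNC k'
  end.

Fixpoint evalN k (c : seq K) : {rmorphism polyN k -> K} :=
  match k return {rmorphism polyN k -> K} with
  | 0 => idfun
  | k'.+1 => horner_eval (head 0 c) \o map_poly (evalN k' (behead c))
  end.

Fixpoint coefN k (a : seq nat) : {additive polyN k -> K} :=
  match k return {additive polyN k -> K} with
  | 0 => idfun
  | k'.+1 => coefN k' (behead a) \o coefp (head 0%N a)
  end.

Lemma evalN_C k c x : evalN k c (polyNC k x) = x.
Proof.
elim: k c => //= k IH c.
by rewrite map_polyC /= horner_evalE hornerC.
Qed.

Lemma coefN_C k a x y : coefN k a (polyNC k x * y) = x * coefN k a y.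
Proof. by elim: k a y => //= k IH a y; rewrite coefCM IH. Qed.

Lemma coefN_inj k (p : polyN k) : (forall a, size a = k -> coefN k a p = 0) -> p = 0.
Proof.
elim: k p => [|k IH] p pa; first exact: (pa [::]).
by apply/polyP => i; rewrite coef0; apply: IH => a sa; apply: (pa (i :: a)); rewrite /= sa.
Qed.

Lemma coefN_bounded k (p : polyN k) :
  exists b, forall a, size a = k -> (b <= sumn a)%N -> coefN k a p = 0.
Proof.
elim: k p => [|k IH] p; first by exists 1%N => -[].
have [b bP] : exists b, forall i, (i < size p)%N -> forall a, size a = k ->
    (b <= sumn a)%N -> coefN k a p`_i = 0.
  elim: (size p) => [|s [b bP]]; first by exists 0%N.
  have [b' b'P] := IH p`_s; exists (maxn b b') => i; rewrite ltnS leq_eqVlt.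
  case/predU1P => [->|/bP h] a sa; rewrite geq_max => /andP[ba b'a]; first exact: b'P.
  exact: h.
exists (b + size p)%N => -[//|i a] [sa] /= ba.
have [ip|/(nth_default 0) ->] := ltnP i (size p); last exact: raddf0.
by apply: bP => //; rewrite -(leq_add2l i) (leq_trans _ ba) // addnC leq_add2l ltnW.
Qed.

Fixpoint buildN k b (f : seq nat -> K) : polyN k :=
  match k return polyN k with
  | 0 => f [::]
  | k'.+1 => \poly_(i < b) buildN k' b (fun a => f (i :: a))
  end.

Lemma coefN_build k b f a : size a = k ->
  (forall a', size a' = k -> (b <= sumn a')%N -> f a' = 0) -> coefN k a (buildN k b f) = f a.
Proof.
elim: k f a => [|k IH] f [|i a] //= [sa] fb.
rewrite coef_poly; case: ltnP => bi.
  by rewrite IH // => a' sa' ba'; apply: fb; rewrite /= ?sa' // (leq_trans ba') ?leq_addl.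
by rewrite raddf0 fb //= ?sa // (leq_trans bi) ?leq_addr.
Qed.

Lemma evalN_neq0 k (p : polyN k) : (forall s : seq K, exists x, x \notin s) -> p != 0 ->
  exists2 c, size c = k & evalN k c p != 0.
Proof.
move=> Kinf; elim: k p => [|k IH] p p0; first by exists [::].
have [c sc lc] : exists2 c, size c = k & evalN k c (lead_coef p) != 0.
  by apply: IH; rewrite lead_coef_eq0.
have q0 : map_poly (evalN k c) p != 0.
  by apply: contraNneq lc => /polyP/(_ (size p).-1); rewrite coef_map coef0 => ->.
set q := map_poly _ _ in q0.
have [rs urs srs] : exists2 rs : seq K, uniq rs & size rs = size q.
  elim: (size q) => [|s [rs urs srs]]; first by exists [::].
  by have [x xrs] := Kinf rs; exists (x :: rs); rewrite /= ?xrs ?srs.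
have /allPn[x _ qx] : ~~ all (root q) rs.
  by apply/negP => /(max_poly_roots q0)/(_ urs); rewrite srs ltnn.
by exists (x :: c); rewrite /= ?sc // horner_evalE.
Qed.

End IteratedPolynomials.

Section Generic.
Variables (K : fieldType) (N : nat).
Local Notation op := (fun (D : 'M[K]_N) (y : 'rV[K]_N) => y *m D).
Implicit Types (D : 'M[K]_N) (Ds : seq 'M[K]_N).

Let opB D : {morph op D : x y / x - y}.
Proof. by move=> x y; rewrite mulmxBl. Qed.

Fixpoint genmx Ds : 'M[polyN K (size Ds)]_N :=
  match Ds return 'M[polyN K (size Ds)]_N with
  | [::] => 0
  | D :: Ds' => 'X *: map_mx (polyNC K (size (D :: Ds'))) D + map_mx polyC (genmx Ds')
  end.

Fixpoint combmx Ds (c : seq K) : 'M[K]_N :=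
  if Ds is D :: Ds' then head 0 c *: D + combmx Ds' (behead c) else 0.

Lemma evalN_genmx Ds c : map_mx (evalN (size Ds) c) (genmx Ds) = combmx Ds c.
Proof.
elim: Ds c => [|D Ds IH] c /=; first by apply/matrixP => i j; rewrite !mxE.
rewrite -IH; apply/matrixP => i j; rewrite !mxE /= rmorphD rmorphM /= !map_polyC /=.
by rewrite map_polyX !horner_evalE hornerD hornerM hornerX !hornerC evalN_C.
Qed.

(** Coefficientwise, multiplication by the generic matrix is [delta]; exactness of families thus
    becomes exactness over the polynomial ring. *)
Lemma coefN_genmx Ds (f : 'rV[polyN K (size Ds)]_N) a : size a = size Ds ->
  map_mx (coefN K (size Ds) a) (f *m genmx Ds)
  = delta op Ds (fun b => map_mx (coefN K (size Ds) b) f) a.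
Proof.
elim: Ds f a => [|D Ds IH] f [|i a] //.
  by move=> _; rewrite mulmx0; apply/matrixP => i j; rewrite !mxE.
move=> [sa].
pose fi : 'rV[polyN K (size Ds)]_N := map_mx (coefp i) f.
have e : delta op Ds (fun b => map_mx (coefN K (size (D :: Ds)) (i :: b)) f) a =
         delta op Ds (fun b => map_mx (coefN K (size Ds) b) fi) a.
  by apply: eq_delta => b; apply/rowP => l; rewrite !mxE.
rewrite /delta -/(delta op) e -IH //; apply/rowP => l; rewrite !mxE raddf_sum.
under eq_bigr do rewrite !mxE mulrDr raddfD.
rewrite big_split /=; congr (_ + _); last first.
  rewrite raddf_sum; apply: eq_bigr => k _.
  by rewrite !mxE coefMC.
case: i {fi e} => [|j].
  rewrite mxE big1 // => k _.
  by rewrite mulrA mulrAC coefMX /= raddf0.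
rewrite mxE; apply: eq_bigr => k _.
by rewrite mulrA mulrAC coefMX /= coefMC mulrC coefN_C mxE mulrC.
Qed.

Lemma common_denom (R : idomainType) p q (A : 'M[{fraction R}]_(p, q)) :
  exists d (B : 'M[R]_(p, q)), d != 0 /\ map_mx (@tofrac R) B = tofrac d *: A.
Proof.
have [d d0 dP] : exists2 d : R, d != 0 &
    forall ij, ij \in enum {: 'I_p * 'I_q} -> exists b, tofrac b = tofrac d * A ij.1 ij.2.
  elim: (enum _) => [|ij s [d d0 dP]]; first by exists 1 => //; apply: oner_neq0.
  have [b [e [e0 be]]] : exists b e, e != 0 /\ tofrac b = tofrac e * A ij.1 ij.2.
    move: (A _ _) => x; elim/quotW: x => r.
    exists \n_r, \d_r; split; first exact: denom_ratioP.
    unlock tofrac; rewrite -[RHS]FracField.pi_mul; apply/eqmodP => /=.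
    rewrite FracField.equivfE /FracField.mulf !numden_Ratio ?mulr1 ?mul1r ?oner_neq0 ?denom_ratioP //.
    by rewrite mulrC.
  exists (e * d) => [|kl]; first by rewrite mulf_neq0.
  rewrite inE => /predU1P[->|/dP[b' b'P]].
    by exists (d * b); rewrite !tofracM be mulrA (mulrC (tofrac d)).
  by exists (e * b'); rewrite !tofracM b'P mulrA.
have /fin_all_exists[B BP] : forall ij : 'I_p * 'I_q,
    exists b, tofrac b = tofrac d * A ij.1 ij.2.
  by move=> ij; apply: dP; rewrite mem_enum.
exists d, (\matrix_(i, j) B (i, j)); split=> //.
by apply/matrixP => i j; rewrite !mxE BP.
Qed.

Lemma map_tofrac_inj (R : idomainType) p q : injective (@map_mx R {fraction R} (@tofrac R) p q).
Proof.
move=> A B /matrixP e; apply/matrixP => i j.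
by have /eqP := e i j; rewrite !mxE tofrac_eq => /eqP.
Qed.

(** Certifies a rank over the fraction field by an identity without denominators, so that the rank
    does not drop at any point where [d] is nonzero. *)
Lemma rank_witness (R : idomainType) p q (A : 'M[R]_(p, q)) :
  let r := \rank (map_mx (@tofrac R) A) in
  exists d (B : 'M[R]_(r, p)) (C : 'M[R]_(q, r)), d != 0 /\ B *m A *m C = d%:M.
Proof.
move=> r; set AF := map_mx _ A in r *.
have [B BP] := row_fullP (col_base_full AF).
have [C CP] := row_freeP (row_base_free AF).
have [d [B' [d0 B'P]]] := common_denom B.
have [e [C' [e0 C'P]]] := common_denom C.
exists (d * e), B', C'; split; first by rewrite mulf_neq0.
apply: map_tofrac_inj.
rewrite !map_mxM B'P C'P -/AF map_scalar_mx rmorphM /=.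
have eBC : B *m AF *m C = 1%:M.
  by rewrite -[X in B *m X *m C](mulmx_base AF) mulmxA BP mul1mx CP.
rewrite -!scalemxAl -scalemxAr eBC.
by rewrite scalerA scale_scalar_mx mulr1.
Qed.

(** Exactness over polynomials gives the rank inequality [rk] over the fraction field, which
    survives at a point where both certificates are nonzero. There the image of [U2], which lies in
    the kernel on [U1], is large enough to fill it. The nonzero head of [c] later lets the
    combination replace the first form of a basis. *)
Lemma generic_exact Ds (U1 U2 : 'M[K]_N) (Kinf : forall s : seq K, exists x, x \notin s) :
  (forall i f, homfam i f -> (forall a, (f a <= U1)%MS) ->
    (forall a, size a = size Ds -> delta op Ds f a = 0) ->
    exists2 g, forall a, (g a <= U2)%MS & forall a, size a = size Ds -> delta op Ds g a = f a) ->
  (forall c, (U2 *m combmx Ds c <= U1)%MS) ->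
  (forall c, U2 *m combmx Ds c *m combmx Ds c = 0) ->
  exists c, [/\ size c = size Ds, Ds != [::] -> head 0 c != 0 &
    forall y : 'rV_N, (y <= U1)%MS -> y *m combmx Ds c = 0 -> (y <= U2 *m combmx Ds c)%MS].
Proof.
move=> ex UD DD; set k := size Ds; pose R := polyN K k.
pose io p q := @map_mx K R (polyNC K k) p q.
pose P := row_base U1; pose A1 := io _ _ P *m genmx Ds; pose A2 := io _ _ U2 *m genmx Ds.
(* Homogeneous exactness is extended to families of bounded degree, such as the coefficients of
   polynomials, by splitting off the top degree. *)
have exb b f : (forall a, size a = k -> (b <= sumn a)%N -> f a = 0) ->
    (forall a, (f a <= U1)%MS) -> (forall a, size a = k -> delta op Ds f a = 0) ->
    exists g, [/\ forall a, (g a <= U2)%MS, forall a, (b <= sumn a)%N -> g a = 0 &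
      forall a, size a = k -> delta op Ds g a = f a].
  elim: b f => [|b IHb] f fb fU fD.
    exists (fun=> 0); split=> [a|//|a sa]; first exact: sub0mx.
    by rewrite delta0 ?fb //; apply: opB.
  case: (IHb (degpart (fun s => s < b)%N f)) => [a sa ba|a|a sa|g [gU gb gP]].
  - by rewrite /degpart ltnNge ba.
  - by rewrite /degpart; case: ifP => // _; apply: sub0mx.
  - by rewrite (delta_degpart opB Ds (fun s => s < b.+1)%N) fD // if_same.
  case: (ex b (degpart (fun s => s == b) f)) => [a /negPf na|a|a sa|h hU hP].
  - by rewrite /degpart na.
  - by rewrite /degpart; case: ifP => // _; apply: sub0mx.
  - by rewrite (delta_degpart opB Ds (fun s => s == b.+1)%N) fD // if_same.
  exists (fun a => g a + degpart (fun s => s.+1 == b) h a); split=> [a|a ba|a sa].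
  - by rewrite addmx_sub // /degpart; case: ifP => // _; apply: sub0mx.
  - rewrite gb ?(ltnW ba) // /degpart gtn_eqF ?addr0 //.
    by rewrite ltnS ltnW.
  rewrite (deltaD opB) gP // (delta_degpart opB Ds (fun s => s == b)) hP // /degpart.
  case: (ltngtP (sumn a) b) => [_|ba|_]; rewrite ?addr0 ?add0r //.
  by rewrite fb.
have solve (x : 'rV[R]_(\rank U1)) : x *m A1 = 0 ->
    exists y : 'rV[R]_N, x *m io _ _ P = y *m A2.
  move=> xA1.
  have coef_io p q (B : 'M[K]_(p, q)) (u : 'rV[R]_p) a :
      map_mx (coefN K k a) (u *m io _ _ B) = map_mx (coefN K k a) u *m B.
    apply/rowP => l; rewrite !mxE raddf_sum; apply: eq_bigr => j _.
    by rewrite !mxE mulrC coefN_C mulrC.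
  pose f a := map_mx (coefN K k a) (x *m io _ _ P).
  have fE a : f a = map_mx (coefN K k a) x *m P by exact: coef_io.
  have [b fb] : exists b, forall a, size a = k -> (b <= sumn a)%N -> f a = 0.
    have /fin_all_exists[b bP] l := coefN_bounded ((x *m io _ _ P) 0 l).
    exists (\max_l b l)%N => a sa ba; apply/rowP => l; rewrite [LHS]mxE [RHS]mxE.
    by apply: bP => //; rewrite (leq_trans _ ba) // leq_bigmax.
  have [g [gU gb gP]] : exists g, [/\ forall a, (g a <= U2)%MS,
      forall a, (b <= sumn a)%N -> g a = 0 & forall a, size a = k -> delta op Ds g a = f a].
    apply: exb => // [a|a sa]; first by rewrite fE (submx_trans (submxMl _ _)) ?eq_row_base.
    rewrite -coefN_genmx // -mulmxA -/A1 xA1.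
    by apply/rowP => l; rewrite !mxE raddf0.
  pose y : 'rV[R]_N := \row_l buildN k b (fun a => (g a *m pinvmx U2) 0 l).
  have yE a : size a = k -> map_mx (coefN K k a) (y *m io _ _ U2) = g a.
    move=> sa; rewrite coef_io -[RHS](mulmxKpV (gU a)); congr (_ *m _).
    apply/rowP => l; rewrite [LHS]mxE [y _ _]mxE coefN_build // => a' _ ba'.
    by rewrite gb // mul0mx mxE.
  exists y; apply/eqP; rewrite -subr_eq0; apply/eqP/rowP => l; rewrite [RHS]mxE.
  apply: coefN_inj => a sa; rewrite mxE raddfD /=.
  have : f a = map_mx (coefN K k a) (y *m A2).
    rewrite /A2 mulmxA coefN_genmx // -gP //.
    by apply: eq_delta_size => // a' sa'; rewrite yE.
  move/rowP/(_ l); rewrite mxE [RHS]mxE => ->.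
  by rewrite [X in _ + coefN _ _ _ X]mxE raddfN subrr.
pose F := @tofrac R.
have rk : (\rank U1 <= \rank (map_mx F A1) + \rank (map_mx F A2))%N.
  rewrite -leq_subLR -mxrank_ker.
  have freeP : row_free (map_mx F (io _ _ P)).
    by rewrite -map_mx_comp (row_free_map (@tofrac R \o polyNC K k : {rmorphism K -> {fraction R}})) row_base_free.
  rewrite -(mxrankMfree _ freeP) mxrankS //; apply/row_subP => i; rewrite row_mul.
  have [d [x [d0 xE]]] := common_denom (row i (kermx (map_mx F A1))).
  have [|y yE] := solve x.
    apply: map_tofrac_inj.
    by rewrite map_mxM xE -scalemxAl -row_mul mulmx_ker row0 scaler0 map_mx0.
  have F0 : F d != 0 by rewrite tofrac_eq0.
  rewrite -[row i _](scalerK F0) -xE -scalemxAl scalemx_sub // -map_mxM yE map_mxM.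
  exact: submxMl.
have [d1 [B1 [C1 [d10 E1]]]] := rank_witness A1.
have [d2 [B2 [C2 [d20 E2]]]] := rank_witness A2.
have [z z0 zP] : exists2 z : R, z != 0 & forall c, evalN k c z != 0 -> Ds != [::] -> head 0 c != 0.
  rewrite /R /k; case: (Ds) => [|D Ds'] /=; first by exists 1; rewrite ?oner_neq0.
  exists 'X => [|c]; first by rewrite polyX_eq0.
  by rewrite map_polyX horner_evalE hornerX.
have [c sc] : exists2 c, size c = k & evalN k c (d1 * d2 * z) != 0.
  by apply: evalN_neq0 => //; rewrite !mulf_neq0.
rewrite !rmorphM !mulf_eq0 !negb_or => /andP[/andP[c1 c2] /zP cz].
exists c; split=> //.
have rank_ev p (A : 'M[R]_(p, N)) r (B : 'M_(r, p)) (C : 'M_(N, r)) d :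
    evalN k c d != 0 -> B *m A *m C = d%:M -> (r <= \rank (map_mx (evalN k c) A))%N.
  move=> dc /(congr1 (map_mx (evalN k c))); rewrite !map_mxM map_scalar_mx => e.
  have <- : \rank (map_mx (evalN k c) B *m map_mx (evalN k c) A *m map_mx (evalN k c) C) = r.
    by rewrite e -scalemx1 mxrank_scale_nz // mxrank1.
  by rewrite (leq_trans (mxrankM_maxl _ _)) // mxrankM_maxr.
have ev_io p q (A : 'M[K]_(p, q)) : map_mx (evalN k c) (io _ _ A) = A.
  by apply/matrixP => i j; rewrite !mxE evalN_C.
have := leq_trans rk (leq_add (rank_ev _ _ _ _ _ _ c1 E1) (rank_ev _ _ _ _ _ _ c2 E2)).
rewrite !map_mxM !ev_io evalN_genmx; set v := combmx Ds c => rkv y yU yv.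
pose W := U2 *m v *m pinvmx P.
have WP : W *m P = U2 *m v by rewrite mulmxKpV // eq_row_base UD.
have sWk : (W <= kermx (P *m v))%MS by apply/sub_kermxP; rewrite mulmxA WP DD.
have skW : (kermx (P *m v) <= W)%MS.
  rewrite -(mxrank_leqif_sup sWk) eqn_leq mxrankS //= mxrank_ker leq_subLR.
  by rewrite (leq_trans rkv) // leq_add2l -WP mxrankM_maxl.
have /submxP[t yE] : (y <= P)%MS by rewrite eq_row_base.
rewrite yE -WP submxMr // (submx_trans _ skW) //.
by apply/sub_kermxP; rewrite mulmxA -yE.
Qed.

End Generic.

Lemma delta_map (U V Y : zmodType) (h : U -> V) (op : V -> Y -> Y) ws f a :
  delta op (map h ws) f a = delta (fun w => op (h w)) ws f a.
Proof. by elim: ws f a => [|w ws IH] f [|i a] //=; rewrite IH. Qed.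

Section GenericVect.
Import VectorInternalTheory.
Variables (K : fieldType) (Y : vectType K) (V : zmodType) (op : V -> 'End(Y)).

Fixpoint combop ws (c : seq K) : 'End(Y) :=
  if ws is w :: ws' then head 0 c *: op w + combop ws' (behead c) else 0.

Let M w : 'M[K]_(dim Y) := f2mx (op w).

Let v2rM w y : v2r (op w y) = v2r y *m M w.
Proof. by rewrite unlock /= r2vK. Qed.

Lemma combmxE ws c y : v2r (combop ws c y) = v2r y *m combmx (map M ws) c.
Proof.
elim: ws c => [|w ws IH] c /=; first by rewrite zero_lfunE linear0 mulmx0.
by rewrite add_lfunE scale_lfunE linearD linearZ /= IH v2rM mulmxDr scalemxAr.
Qed.

Let memvK (U : {vspace Y}) v : (v \in U) = (v2r v <= vs2mx U)%MS.
Proof. by rewrite -genmxE. Qed.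

Lemma generic_exact_vect ws (V1 V2 : {vspace Y}) (Kinf : forall s : seq K, exists x, x \notin s) :
  (forall i f, homfam i f -> (forall a, f a \in V1) ->
    (forall a, size a = size ws -> delta op ws f a = 0) ->
    exists2 g, forall a, g a \in V2 & forall a, size a = size ws -> delta op ws g a = f a) ->
  (forall c y, y \in V2 -> combop ws c y \in V1) ->
  (forall c y, combop ws c (combop ws c y) = 0) ->
  exists c, [/\ size c = size ws, ws != [::] -> head 0 c != 0 &
    forall y, y \in V1 -> combop ws c y = 0 -> exists2 z, z \in V2 & combop ws c z = y].
Proof.
move=> ex opV op2.
have v2r_delta (F : seq nat -> Y) a :
    delta (fun D y => y *m D) (map M ws) (fun b => v2r (F b)) a = v2r (delta op ws F a).
  by rewrite delta_map; apply: delta_morph => w y; apply: v2rM.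
have r2v_delta f a : delta (fun D y => y *m D) (map M ws) f a = v2r (delta op ws (r2v \o f) a).
  by rewrite -v2r_delta; apply: eq_delta => b; rewrite /= r2vK.
case: (@generic_exact K (dim Y) (map M ws) (vs2mx V1) (vs2mx V2) Kinf).
- move=> i f hf fV df; case: (ex i (r2v \o f)) => [a na|a|a sa|g gV gP].
  + by rewrite /= hf // linear0.
  + by rewrite memvK r2vK.
  + by apply: v2r_inj; rewrite linear0 -r2v_delta df ?size_map.
  exists (v2r \o g) => [a|a]; first by rewrite -memvK.
  by rewrite size_map => sa; rewrite v2r_delta gP //= r2vK.
- move=> c; apply/row_subP => i; rewrite row_mul.
  have := opV c (r2v (row i (vs2mx V2))); rewrite !memvK combmxE r2vK.
  by apply; apply: row_sub.
- move=> c; apply/row_matrixP => i; rewrite !row_mul row0.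
  have := congr1 v2r (op2 c (r2v (row i (vs2mx V2)))).
  by rewrite !combmxE r2vK linear0.
move=> c [sc c0 cP]; rewrite size_map in sc; exists c; split=> // [nws|y yV cy].
  by apply: c0; case: (ws) nws.
have /submxP[x xE] : (v2r y <= vs2mx V2 *m combmx (map M ws) c)%MS.
  by apply: cP; rewrite -?memvK // -combmxE cy linear0.
exists (r2v (x *m vs2mx V2)); first by rewrite memvK r2vK submxMl.
by apply: v2r_inj; rewrite combmxE r2vK xE mulmxA.
Qed.
End GenericVect.

Section Precomposition.
Variables (K : fieldType) (X1 X2 : vectType K).

Lemma precomp_is_linear (G : 'Hom(X1, X2)) : linear (fun f : 'Hom(X2, K^o) => (f \o G)%VF).
Proof. by move=> a f g; rewrite comp_lfunDl comp_lfunZl. Qed.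
Definition precomp_fun (G : 'Hom(X1, X2)) (f : 'Hom(X2, K^o)) : 'Hom(X1, K^o) := (f \o G)%VF.
HB.instance Definition _ G := GRing.isLinear.Build K 'Hom(X2, K^o) 'Hom(X1, K^o) *:%R
  (precomp_fun G) (precomp_is_linear G).
Definition precomp (G : 'Hom(X1, X2)) : 'Hom('Hom(X2, K^o), 'Hom(X1, K^o)) :=
  linfun (precomp_fun G).

Lemma precompE G f : precomp G f = (f \o G)%VF.
Proof. exact: lfunE. Qed.

End Precomposition.

(** * Functionals of one degree killed by given linear forms *)

Section Functionals.
Variables (K : fieldType) (n : nat).
Local Notation E := (ext K n).
Local Notation V := 'rV[K]_n.
Local Notation Y := (dualX K n 1).
Implicit Types (w : V) (ws : seq V) (f : Y) (A B : {vspace Y}).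

Lemma vecD u w : vec (u + w) = vec u + vec w :> E.
Proof. by rewrite /vec -big_split; apply: eq_bigr => i _; rewrite mxE scalerDl. Qed.
Lemma vecZ a w : vec (a *: w) = a *: vec w :> E.
Proof. by rewrite /vec scaler_sumr; apply: eq_bigr => i _; rewrite mxE scalerA. Qed.

Lemma op_vecD r u w (f : dualX K n r) : op (u + w) f = op u f + op w f.
Proof.
apply/lfunP => x; rewrite add_lfunE !opE -linearD; congr (f _).
by apply/fmodP => k; rewrite ffunE !lmulXE vecD mulrDl.
Qed.
Lemma op_vecZ r a w (f : dualX K n r) : op (a *: w) f = a *: op w f.
Proof.
apply/lfunP => x; rewrite scale_lfunE !opE -linearZ; congr (f _).
by apply/fmodP => k; rewrite ffunE !lmulXE vecZ scalerAl.
Qed.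

Definition opV w : 'End(Y) := precomp (lmulX 1 (vec w)).
Lemma opVE w f : opV w f = op w f. Proof. exact: precompE. Qed.

Definition degs (P : pred int) : {vspace Y} := lker (precomp (@prX K n 1 (fun _ => P)) - \1)%VF.

Lemma mem_degs P f : (f \in degs P) = (cutoff (fun _ => P) f == f).
Proof. by rewrite memv_ker add_lfunE opp_lfunE id_lfunE precompE subr_eq0. Qed.

Lemma degs_sub (P P' : pred int) f : (forall t, P t -> P' t) -> f \in degs P -> f \in degs P'.
Proof.
move=> PP'; rewrite !mem_degs => /eqP fP; apply/eqP/lfunP => x.
rewrite cutoffE -fP !cutoffE; congr (f _); apply/fmodP => k.
rewrite !prXE prE_comp; apply: eq_prE => t /=.
by apply: andb_idr; apply: PP'.
Qed.

Fixpoint kerV ws : {vspace Y} := if ws is w :: ws' then (lker (opV w) :&: kerV ws')%VS else fullv.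

Lemma mem_kerV ws f : reflect (forall w, w \in ws -> op w f = 0) (f \in kerV ws).
Proof.
elim: ws => [|w ws IH] /=; first by rewrite memvf; constructor.
rewrite memv_cap memv_ker opVE; apply: (iffP andP) => [[/eqP wf /IH wsf] u|h].
  by rewrite inE => /predU1P[->|/wsf].
split; first by rewrite h ?mem_head.
by apply/IH => u uws; apply: h; rewrite inE uws orbT.
Qed.

Definition kd A ws (d : nat) : {vspace Y} := (A :&: degs (pred1 d%:Z) :&: kerV ws)%VS.

Lemma mem_kd A ws d f : (f \in kd A ws d) = [&& f \in A, f \in degs (pred1 d%:Z) & f \in kerV ws].
Proof. by rewrite !memv_cap andbA. Qed.

Lemma kd_rcons A ws w d : kd A (rcons ws w) d = (kd A ws d :&: lker (opV w))%VS.
Proof.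
apply/vspaceP => f; rewrite memv_cap !mem_kd -!andbA; congr [&& _, _ & _].
rewrite memv_ker opVE; apply/mem_kerV/andP => [h|[/mem_kerV h /eqP wf] u].
  split; first by apply/mem_kerV => u uws; apply: h; rewrite mem_rcons inE uws orbT.
  by rewrite h // mem_rcons mem_head.
by rewrite mem_rcons inE => /predU1P[->|/h].
Qed.

Lemma degs_op d w f : f \in degs (pred1 d.+1%:Z) -> op w f \in degs (pred1 d%:Z).
Proof.
rewrite !mem_degs => /eqP {2}<-; rewrite op_cutoff; apply/eqP/eq_cutoff => _ t /=.
by rewrite intS addrC (inj_eq (addrI 1)).
Qed.

Lemma degs_op0 w f : f \in degs (pred1 0) -> op w f = 0.
Proof.
rewrite mem_degs => /eqP <-; rewrite op_cutoff; apply/lfunP => x.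
rewrite cutoffE zero_lfunE -[RHS](linear0 (op w f)); congr (_ _).
apply/fmodP => k; rewrite prXE ffunE; apply: prE_none => S /=.
by rewrite -PoszD addn1.
Qed.

Lemma pr_contr (P : pred int) c (x : E) : prE P (contr c x) = contr c (prE (fun t => P (t - 1)) x).
Proof.
rewrite /contr linear_sum; apply: eq_bigr => i _; rewrite linearZ /=; congr (_ *: _).
apply: ext_coefP => S; rewrite ext_coef_pr !ext_coef_ctr ext_coef_pr.
case: (boolP (i \in S)) => iS; first by rewrite if_same.
rewrite cardsU1 iS /= add1n intS addrAC subrr add0r.
by case: ifP; rewrite ?mulr0.
Qed.

Lemma degs_hop d c f : f \in degs (pred1 d%:Z) -> hop c f \in degs (pred1 d.+1%:Z).
Proof.
rewrite !mem_degs => /eqP {2}<-; apply/eqP/lfunP => x.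
rewrite !(cutoffE, hopE); congr (f _); apply/fmodP => k.
rewrite !(contrXE, prXE) pr_contr; congr (contr c _); apply: eq_prE => t /=.
by rewrite subr_eq intS addrC.
Qed.

Lemma op_image A B ws w d :
  (forall f, f \in A -> op w f \in B) ->
  (opV w @: kd A ws d.+1 <= kd B (rcons ws w) d)%VS.
Proof.
move=> AB; apply/subvP => _ /memv_imgP[f fK ->]; rewrite opVE kd_rcons memv_cap memv_ker opVE.
move: fK; rewrite !mem_kd => /and3P[fA fd /mem_kerV fw].
rewrite AB // degs_op //= opX_2 eqxx andbT; apply/mem_kerV => u uws.
by rewrite opX_C fw // opX_0 oppr0.
Qed.

(** Rank-nullity for [op w], whose image is killed by [ws] and also by [w]. *)
Lemma kd_step A B ws w d : (forall f, f \in A -> op w f \in B) ->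
  (\dim (kd A ws d.+1) <= \dim (kd A (rcons ws w) d.+1) + \dim (kd B (rcons ws w) d))%N.
Proof.
move=> AB; rewrite -(limg_ker_dim (opV w) (kd A ws d.+1)) -kd_rcons leq_add2l.
exact/dimvS/op_image.
Qed.

Lemma degs_dim d : \dim (degs (pred1 d%:Z)) = 'C(n, d).
Proof.
have eps_lin (S : {set 'I_n}) : linear (fun x : fmod K n 1 => ext_coef (x 0) S : K^o).
  by move=> a x y; rewrite !ffunE ext_coefD ext_coefZ.
pose eps S : Y := linfun (HB.pack (fun x : fmod K n 1 => ext_coef (x 0) S : K^o)
  (GRing.isLinear.Build K (fmod K n 1) K^o *:%R _ (eps_lin S)) : {linear fmod K n 1 -> K^o}).
have epsE S x : eps S x = ext_coef (x 0) S by rewrite lfunE.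
pose Ss := enum [set S : {set 'I_n} | #|S| == d].
have sS : size (map eps Ss) = 'C(n, d) by rewrite size_map -cardE card_draws card_ord.
rewrite -sS; apply/eqP; rewrite eqn_leq.
have sub : (degs (pred1 d%:Z) <= <<map eps Ss>>)%VS.
  apply/subvP => f; rewrite mem_degs => /eqP fd.
  have -> : f = \sum_(S <- Ss) f (fmk (fun=> ext_basis K S)) *: eps S.
    apply/lfunP => x; rewrite sum_lfunE.
    under eq_bigr do rewrite scale_lfunE epsE.
    rewrite /Ss big_enum -[in LHS]fd cutoffE.
    have -> : prX (fun _ => pred1 d%:Z) x = \sum_(S in [set S : {set 'I_n} | #|S| == d])
        ext_coef (x 0) S *: fmk (fun=> ext_basis K S).
      apply/fmodP => k; rewrite prXE fmod_sumE (ord1 k).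
      under eq_bigr do rewrite ffunE fmkE.
      rewrite {1}(ext_expand (x 0)) linear_sum [RHS]big_mkcond; apply: eq_bigr => S _.
      rewrite linearZ /= (prE_homogeneous _ (@homogeneous_basis _ _ S)) /= inE eqz_nat.
      by case: ifP; rewrite ?scaler0.
    rewrite linear_sum; apply: eq_bigr => S _.
    by rewrite linearZ; apply: mulrC.
  by rewrite big_seq memv_suml // => S SS; rewrite memvZ // memv_span // map_f.
rewrite (leq_trans (dimvS sub)) ?dim_span //=.
have frees : free (map eps Ss).
  apply/(freeP (X := in_tuple (map eps Ss))) => k k0 i.
  have iS : (i < size Ss)%N by rewrite -(size_map eps).
  have /lfunP/(_ (fmk (fun=> ext_basis K (nth set0 Ss i)))) := k0.
  rewrite sum_lfunE zero_lfunE (bigD1 i) //= big1 => [|j ji].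
    by rewrite addr0 scale_lfunE (nth_map set0) // epsE fmkE ext_coef_basis eqxx [_ *: _]mulr1.
  have jS : (j < size Ss)%N by rewrite -(size_map eps).
  rewrite scale_lfunE (nth_map set0) // epsE fmkE ext_coef_basis nth_uniq ?enum_uniq //.
  by rewrite -val_eqE in ji; rewrite (negPf ji) [_ *: _]mulr0.
rewrite -(eqnP frees) dimvS //; apply/span_subvP => _ /mapP[S SS ->].
rewrite mem_degs; apply/eqP/lfunP => x; rewrite cutoffE !epsE prXE ext_coef_pr.
by move: SS; rewrite mem_enum inE /= eqz_nat => ->.
Qed.

Lemma size_basis_rV ws : basis_of fullv ws -> size ws = n.
Proof.
move=> bws; have := size_basis (X := in_tuple ws) bws.
by rewrite dimvf /dim /= mul1n.
Qed.

(** Dually, the quotient of [E] by independent forms is an exterior algebra on fewer generators.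
    Here [op w] is onto by the dual homotopy, so rank-nullity becomes Pascal's rule. *)
Lemma full_dim ws ws' d : basis_of fullv (ws ++ ws') ->
  \dim (kd fullv ws d) = 'C(n - size ws, d).
Proof.
elim/last_ind: ws ws' d => [|ws w IH] ws' d.
  by move=> _; rewrite subn0 /kd capfv capvf degs_dim.
rewrite cat_rcons => bws; have {}IH := IH (w :: ws') _ bws.
have sn : (size ws < n)%N by have := size_basis_rV bws; rewrite size_cat /= -addSnnS => {2}<-; apply: leq_addr.
have [cs csP] := dual_basis bws.
have uws := free_uniq (basis_free bws).
rewrite size_rcons; have -> : (n - (size ws).+1 = (n - size ws).-1)%N by rewrite subnS.
have nw : (n - size ws = (n - size ws).-1.+1)%N by rewrite prednK // subn_gt0.
elim: d => [|d IHd].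
  rewrite bin0 -[RHS](bin0 (n - size ws)) -IH kd_rcons; congr (\dim _).
  apply/vspaceP => f; rewrite memv_cap; apply: andb_idr; rewrite mem_kd => /and3P[_ f0 _].
  by rewrite memv_ker opVE degs_op0.
apply/eqP; rewrite -(eqn_add2r (\dim (kd fullv (rcons ws w) d))) {2}IHd.
rewrite -binS -nw -IH eq_sym -(limg_ker_dim (opV w) (kd fullv ws d.+1)) -kd_rcons eqn_add2l.
apply/eqP; congr (\dim _); apply/eqP; rewrite eqEsubv op_image ?memvf //=; last by move=> *; apply: memvf.
apply/subvP => f; rewrite kd_rcons memv_cap memv_ker opVE mem_kd => /andP[/and3P[_ fd /mem_kerV fws] /eqP wf].
have wws : w \in ws ++ w :: ws' by rewrite mem_cat mem_head orbT.
apply/memv_imgP; exists (hop (cs w) f).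
  rewrite mem_kd memvf degs_hop //=; apply/mem_kerV => u uuws.
  have uin : u \in ws ++ w :: ws' by rewrite mem_cat uuws.
  have nuw : u != w.
    apply: contraTneq uws => <-; rewrite cat_uniq; apply/negP => /and3P[_ /hasPn/(_ u)].
    by rewrite mem_head uuws => /(_ isT).
  have := op_hop (cs w) u f; rewrite csP // (negPf nuw) scale0r fws // hop0 addr0 //.
have := op_hop (cs w) w f; rewrite csP // eqxx scale1r wf hop0 addr0 opVE => -> //.
Qed.

End Functionals.
Arguments degs {K n}.

(** * The dimension bound from generic linear forms *)

Section LowerBound.
Variables (K : fieldType) (n m r : nat) (N : ext K n -> Prop).
Local Notation E := (ext K n).
Local Notation V := 'rV[K]_n.
Local Notation Y := (dualX K n 1).
Hypothesis Kinf : forall s : seq K, exists x, x \notin s.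
Hypothesis m_gt0 : (0 < m)%N.
Hypothesis NM : forall x y, N x -> N (y * x).
Hypothesis Npr : forall P x, N x -> N (prE P x).
Hypothesis regN : forall ws i, basis_of fullv ws -> reg (@op K n 1) i m ws (annih (sub1 N)).
Hypothesis Ntop : forall f : Y, annih (sub1 N) r.+1 f -> f = 0.
Variable A : {vspace Y}.
Hypothesis AP : forall f, f \in A <-> forall x, sub1 N x -> f x = 0.
Implicit Types (w : V) (ws : seq V) (f : Y).

Let Q := annih (sub1 N).

Let FQ : filtered (@op K n 1) Q.
Proof. by apply: filtered_annih => w x; rewrite /sub1 lmulXE; apply: NM. Qed.

Let QP d f : Q d f <-> (f \in A) /\ (f \in degs (fun t => d%:Z <= t)).
Proof. by rewrite mem_degs AP; split=> -[h /eqP]; split=> //; apply/eqP. Qed.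

Lemma exact_chain_rcons ws w (R : nat -> Y -> Prop) : exact_chain (@op K n 1) m ws R ->
  exact_on (@op K n 1) m w (kerQs (@op K n 1) ws R) -> exact_chain (@op K n 1) m (rcons ws w) R.
Proof. by elim: ws R => [|u ws IH] R //= [ex exs] /(IH _ exs). Qed.

Fixpoint combv ws (c : seq K) : V := if ws is w :: ws' then head 0 c *: w + combv ws' (behead c) else 0.

Lemma combop_op ws c f : combop (@opV K n) ws c f = op (combv ws c) f.
Proof.
elim: ws c => [|w ws IH] c /=.
  by rewrite zero_lfunE -[0 in RHS](scale0r 0) op_vecZ scale0r.
by rewrite add_lfunE scale_lfunE opVE IH op_vecD op_vecZ.
Qed.

Lemma combv_span ws c : combv ws c \in <<ws>>%VS.
Proof.
elim: ws c => [|w ws IH] c /=; first exact: mem0v.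
by rewrite span_cons memv_add // memvZ // memv_line.
Qed.

Lemma delta_opV ws (f : seq nat -> Y) a : delta (@opV K n) ws f a = delta (@op K n 1) ws f a.
Proof. by elim: ws f a => [|w ws IH] f [|[|i] a] //=; rewrite IH // opVE. Qed.

Lemma cutoff_ge_le d d' f : (d <= d')%N -> f \in degs (fun t => d'%:Z <= t) ->
  f \in degs (fun t => d%:Z <= t).
Proof.
move=> dd; apply: degs_sub => t; apply: le_trans; by rewrite lez_nat.
Qed.

(** Regularity passes to the common kernel of the forms already chosen, so a generic combination of
    the remaining ones is exact there; its nonzero first coefficient keeps the list a basis. *)
Lemma exists_almost_regular t : (t <= n)%N -> exists ws1 ws2,
  [/\ size ws1 = t, basis_of fullv (ws1 ++ ws2) & exact_chain (@op K n 1) m ws1 Q].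
Proof.
elim: t => [|t IH] tn.
  exists [::], (vbasis fullv); split=> //; exact: vbasisP.
have [ws1 [ws2 [s1 b12 ex1]]] := IH (ltnW tn).
have s2 : ws2 != [::].
  apply: contraTneq tn => e; have := size_basis_rV b12.
  by rewrite e cats0 s1 => ->; rewrite ltnn.
have reg2 i : reg (@op K n 1) i m ws2 (kerQs (@op K n 1) ws1 Q).
  exact/(reg_cat (@opX_B K n 1) (@opX_C K n 1) (@opX_2 K n 1) i ws2 FQ ex1)/regN.
pose V' d : {vspace Y} := (A :&: degs (fun t => (d%:Z <= t)%R) :&: kerV ws1)%VS.
have V'P d f : reflect (kerQs (@op K n 1) ws1 Q d f) (f \in V' d).
  rewrite /V' !memv_cap; apply: (iffP andP) => [[/andP[fA fd] /mem_kerV fw]|].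
    by apply/kerQsP; split=> //; apply/QP.
  by move=> /kerQsP[/QP[-> ->] fw]; split=> //; apply/mem_kerV.
have FQ1 : filtered (@op K n 1) (kerQs (@op K n 1) ws1 Q).
  by apply: filtered_kers => //; [exact: opX_B|exact: opX_C].
case: (@generic_exact_vect K Y V (@opV K n) ws2 (V' m) (V' m.+1) Kinf) => [i f hf fV df|c f|c f|c [sc c0 cP]].
- case: (reg2 i m f (leqnn m) hf) => [a|a sa|g gQ gP].
  + exact/V'P.
  + by rewrite -delta_opV df.
  by exists g => [a|a sa]; [apply/V'P|rewrite delta_opV gP].
- by move=> /V'P fV; rewrite combop_op; apply/V'P/(filtered_op FQ1).
- by rewrite !combop_op opX_2.
move: c0 => /(_ s2) c0; case: ws2 => [//|w ws2] in s2 b12 reg2 sc cP *.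
set v := combv (w :: ws2) c.
exists (rcons ws1 v), ws2; split; first by rewrite size_rcons s1.
  rewrite basisEdim cat_rcons; apply/andP; split; last first.
    by have := size_basis (X := in_tuple (ws1 ++ w :: ws2)) b12 => ->; rewrite !size_cat.
  rewrite -(eqP (proj1 (andP b12))); apply/span_subvP => u.
  rewrite mem_cat inE => /or3P[u1|/eqP ->|u2].
  - by rewrite memv_span // mem_cat u1.
  - have -> : w = (head 0 c)^-1 *: (v - combv ws2 (behead c)) by rewrite addrK scalerK.
    rewrite memvZ // memvB //; first by rewrite memv_span // mem_cat mem_head orbT.
    apply: (subvP _ _ (combv_span _ _)); apply/span_subvP => x x2.
    by rewrite memv_span // mem_cat inE x2 !orbT.
  - by rewrite memv_span // mem_cat inE u2 !orbT.
(* The choice of [c] concerned only degrees at least [m] taken together; trimming the preimage to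
   degrees above [d] gives exactness for each [d]. *)
apply: exact_chain_rcons => // d y md /V'P yV vy.
have yVm : y \in V' m.
  move: yV; rewrite !memv_cap => /andP[/andP[-> yd] ->]; rewrite andbT /=.
  exact: cutoff_ge_le yd.
have [z /V'P zV zy] := cP y yVm (etrans (combop_op _ _ _) vy).
rewrite combop_op -/v in zy.
exists (cutoff (fun _ t => d.+1%:Z <= t) z); last first.
  rewrite op_cutoff_ge zy; move: yV; rewrite !memv_cap => /andP[/andP[_]].
  by rewrite mem_degs => /eqP.
move/kerQsP: zV => [[zN _] zw]; apply/kerQsP; split; first split.
- by move=> x Nx; rewrite cutoffE zN // /sub1 prXE; apply: Npr.
- exact: cutoff_idem.
by move=> u u1; rewrite op_cutoff_ge zw // cutoff0.
Qed.

(** Each form, being exact, lifts the functional by one degree, until it passes degree [r], where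
    nothing is left. *)
Lemma top_vanish ws d : exact_chain (@op K n 1) m ws Q -> (m <= d)%N -> (r < d + size ws)%N ->
  forall f, kerQs (@op K n 1) ws Q d f -> f = 0.
Proof.
elim/last_ind: ws d => [|ws w IH] d.
  rewrite addn0 => _ _ rd f [fN fd]; apply: Ntop; split=> //.
  by apply/eqP; rewrite -mem_degs; apply: cutoff_ge_le rd _; rewrite mem_degs fd.
rewrite size_rcons addnS -addSn => ex md rd f.
have [ex1 ex2] : exact_chain (@op K n 1) m ws Q /\
    exact_on (@op K n 1) m w (kerQs (@op K n 1) ws Q).
  by elim: ws (Q) ex {IH rd} => [|u ws IH] R /= [] // ? /IH[].
have -> : kerQs (@op K n 1) (rcons ws w) Q d f = (kerQ (@op K n 1) w (kerQs (@op K n 1) ws Q)) d f.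
  by elim: ws (Q) {IH rd ex ex1 ex2} => [|u ws IH] R //=.
move=> [fQ wf]; have [z zQ <-] := ex2 d f md fQ wf.
by rewrite (IH d.+1 ex1 (leqW md) rd z zQ) opX_0.
Qed.

(** With [s] forms nothing of degree [m] survives. Each cut loses at most the dimension given by
    [full_dim] in degree [m.-1], and these losses telescope by Pascal's rule. *)
Theorem annih_dim_bound : (m <= r.+1)%N -> (r.+1 - m <= n)%N ->
  (\dim (A :&: degs (pred1 m%:Z)) + 'C(n - (r.+1 - m), m) <= 'C(n, m))%N.
Proof.
set s := (r.+1 - m)%N => mr sn.
have [ws1 [ws2 [s1 b12 ex1]]] := exists_almost_regular sn.
have q0 : \dim (kd A ws1 m) = 0%N.
  apply/eqP; rewrite dimv_eq0 -subv0; apply/subvP => f; rewrite mem_kd memv0.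
  move=> /and3P[fA fm /mem_kerV fw]; apply/eqP/(top_vanish ex1 (leqnn m)).
    by rewrite s1 subnKC // .
  apply/kerQsP; split=> //; apply/QP; split=> //.
  by apply: degs_sub fm => t /eqP ->.
have key ws ws' : basis_of fullv (ws ++ ws') ->
    (\dim (A :&: degs (pred1 m%:Z)) + 'C(n - size ws, m) <= \dim (kd A ws m) + 'C(n, m))%N.
  elim/last_ind: ws ws' => [|ws w IH] ws' b; first by rewrite subn0 /kd capvf.
  rewrite cat_rcons in b; have {}IH := IH _ b.
  have sw : (size ws < n)%N.
    by have := size_basis_rV b; rewrite size_cat /= -addSnnS => {2}<-; apply: leq_addr.
  have h := @full_dim K n (rcons ws w) ws' m.-1; rewrite cat_rcons in h.
  have := @kd_step K n A fullv ws w m.-1 (fun _ _ => memvf _).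
  rewrite prednK // h // size_rcons => st.
  rewrite -(leq_add2r 'C(n - (size ws).+1, m.-1)) -addnA.
  have -> : ('C(n - (size ws).+1, m) + 'C(n - (size ws).+1, m.-1) = 'C(n - size ws, m))%N.
    by rewrite -[in LHS](prednK m_gt0) /= -binS prednK // subnSK.
  rewrite (leq_trans IH) // addnAC leq_add2r //.
by have := key ws1 ws2 b12; rewrite q0 add0n s1.
Qed.

End LowerBound.

(** * The Orlik-Solomon ideal *)

Section OrlikSolomon.
Variables (K : fieldType) (n : nat) (M : matroid 'I_n).
Local Notation E := (ext K n).
Local Notation J := (@orlik_solomon_ideal K n M).
Local Notation bd S := (contr (ones K n) (ext_basis K S)).
Implicit Types (S T A B : {set 'I_n}) (x y : E) (i : 'I_n).

Lemma os_gen S : dependent M S -> J (bd S).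
Proof.
move=> dS; exists [:: (1, bd S, 1)]; last by rewrite big_seq1 mul1r mulr1.
by move=> t; rewrite inE => /eqP ->; exists S => //; rewrite ext_partialE.
Qed.

Lemma os0 : J 0.
Proof. by exists [::] => //; rewrite big_nil. Qed.

Lemma osD x y : J x -> J y -> J (x + y).
Proof.
move=> [s sP ->] [t tP ->]; exists (s ++ t); last by rewrite big_cat.
by move=> u; rewrite mem_cat => /orP[/sP|/tP].
Qed.

Lemma osM x y z : J x -> J (y * x * z).
Proof.
move=> [s sP ->]; exists [seq (y * t.1.1, t.1.2, t.2 * z) | t <- s].
  by move=> _ /mapP[t /sP tG ->].
rewrite big_map mulr_sumr mulr_suml; apply: eq_bigr => t _ /=.
by rewrite !mulrA.
Qed.

Lemma osMl x y : J x -> J (y * x).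
Proof. by move=> /(osM y 1); rewrite mulr1. Qed.
Lemma osMr x y : J x -> J (x * y).
Proof. by move=> /(osM 1 y); rewrite mul1r. Qed.

Lemma osZ a x : J x -> J (a *: x).
Proof. by move=> Jx; rewrite -[x]mul1r scalerAl; apply: osMl. Qed.

Lemma osN x : J x -> J (- x).
Proof. by rewrite -scaleN1r; apply: osZ. Qed.

Lemma os_sum (I : Type) (s : seq I) (P : pred I) (F : I -> E) :
  (forall k, P k -> J (F k)) -> J (\sum_(k <- s | P k) F k).
Proof. by move=> h; elim/big_ind: _ => //; [exact: os0|exact: osD]. Qed.

Lemma os_ind (P : E -> Prop) : P 0 -> (forall x y, P x -> P y -> P (x + y)) ->
  (forall a x, P x -> P (a *: x)) ->
  (forall A S B, dependent M S -> P (ext_basis K A * bd S * ext_basis K B)) ->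
  forall x, J x -> P x.
Proof.
move=> P0 PD PZ PG x [s sP ->]; elim: s sP => [|[[a g] b] s IH] sP; first by rewrite big_nil.
rewrite big_cons; apply: (PD); last by apply: IH => t ts; apply: sP; rewrite inE ts orbT.
have [S dS /= ->] := sP _ (mem_head _ _); rewrite ext_partialE.
rewrite [a]ext_expand [b]ext_expand !mulr_suml; apply: (big_ind P P0 PD) => A _.
rewrite mulr_sumr; apply: (big_ind P P0 PD) => B _.
by rewrite -scalerAr -!scalerAl; apply/PZ/PZ/PG.
Qed.

Lemma homogeneousM d e x y : homogeneous d x -> homogeneous e y -> homogeneous (d + e) (x * y).
Proof.
move=> hx hy; apply/homogeneous_prP; rewrite (prE_mulr _ _ hy); congr (_ * _).
rewrite -[RHS](homogeneous_prP d x).1 //; apply: eq_prE => t /=.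
by rewrite (inj_eq (addIr e)).
Qed.

Lemma homogeneous_bd S : homogeneous (#|S|%:Z - 1) (bd S).
Proof.
rewrite -ext_partialE; apply: homogeneous_sum => i iS; apply: homogeneousZ.
by rewrite (cardsD1 i) iS intS addrAC subrr add0r; apply: homogeneous_basis.
Qed.

Lemma os_term_homogeneous A S B :
  homogeneous (#|A|%:Z + (#|S|%:Z - 1) + #|B|%:Z) (ext_basis K A * bd S * ext_basis K B).
Proof.
apply/homogeneousM; first apply/homogeneousM; first exact: homogeneous_basis.
  exact: homogeneous_bd.
exact: homogeneous_basis.
Qed.

Lemma os_pr P x : J x -> J (prE P x).
Proof.
elim/os_ind => [|y z|a y|A S B dS].
- by rewrite linear0; apply: os0.
- by rewrite linearD; apply: osD.
- by rewrite linearZ; apply: osZ.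
rewrite (prE_homogeneous _ (@os_term_homogeneous A S B)); case: ifP => _; last exact: os0.
exact/osM/os_gen.
Qed.

Definition os_generators : seq E := [seq if dependent M t.1.2
   then ext_basis K t.1.1 * bd t.1.2 * ext_basis K t.2 else 0
   | t <- enum {: {set 'I_n} * {set 'I_n} * {set 'I_n}}].

Definition os_space : {vspace E} := <<os_generators>>%VS.

Lemma os_spaceP x : J x <-> x \in os_space.
Proof.
split.
  elim/os_ind => [|y z|a y|A S B dS]; [exact: mem0v|exact: memvD|exact: memvZ|].
  apply: memv_span; apply/mapP; exists (A, S, B); first by rewrite mem_enum.
  by rewrite /= dS.
move=> xJ; have /= -> := coord_span (X := in_tuple os_generators) xJ.
apply: os_sum => i _; apply: osZ; have /mapP[t _ ->] := mem_nth 0 (ltn_ord i).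
by case: ifP => [dS|_]; [apply/osM/os_gen|apply: os0].
Qed.

Lemma os_low (d : nat) x : (forall S, dependent M S -> (d < #|S|)%N) -> J x ->
  prE (fun t => t < d%:Z) x = 0.
Proof.
move=> hd; elim/os_ind => [|y z hy hz|a y hy|A S B dS].
- by rewrite linear0.
- by rewrite linearD /= hy hz addr0.
- by rewrite linearZ /= hy scaler0.
rewrite (prE_homogeneous _ (@os_term_homogeneous A S B)) ifF //; apply/negbTE.
have := hd S dS; lia.
Qed.

Lemma os_low_degree (d : nat) x (e : int) : (forall S, dependent M S -> (d < #|S|)%N) ->
  J x -> homogeneous e x -> e < d%:Z -> x = 0.
Proof. by move=> hd /(os_low hd) + hx ed; rewrite (prE_homogeneous _ hx) ed. Qed.

(** Apply the boundary to the vanishing product of [e_i] and [e_T]. It follows that J contains [e_T]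
    for every dependent [T], hence everything in degrees above the rank. *)
Lemma basis_bd i T : i \in T -> ext_basis K T = ext_gen K i * bd T.
Proof.
move=> iT; have := contr_genM (ones K n) i (ext_basis K T).
rewrite mxE scale1r {1}(ext_basis_D1 _ iT) -scalerAr mulrA ext_gen_sqr mul0r scaler0 linear0.
by move/esym/eqP; rewrite subr_eq0 => /eqP.
Qed.

Lemma os_basis T : dependent M T -> J (ext_basis K T).
Proof.
move=> dT; have /set0Pn[i iT] : T != set0.
  by apply: contraTneq dT => ->; rewrite /dependent indep0.
by rewrite (basis_bd iT); apply/osMl/os_gen.
Qed.

Lemma bd_neq0 T : T != set0 -> bd T != 0.
Proof.
case/set0Pn => i iT; apply/eqP => e0; have := basis_bd iT; rewrite e0 mulr0 => /(congr1 (fun x => ext_coef x T)).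
by rewrite ext_coef_basis ext_coef0 eqxx => /eqP; rewrite oner_eq0.
Qed.

Local Notation Y := (dualX K n 1).
Implicit Types (f : Y).

Lemma os_top f : annih (sub1 J) (rk M setT).+1 f -> f = 0.
Proof.
move=> [fJ <-]; apply/lfunP => x; rewrite cutoffE zero_lfunE; apply: fJ.
rewrite /sub1 prXE (ext_expand (x 0)) linear_sum; apply: os_sum => S _.
rewrite linearZ /= (prE_homogeneous _ (@homogeneous_basis _ _ S)).
case: ifP => [rS|_]; last by rewrite scaler0; apply: os0.
apply/osZ/os_basis; apply: contraL rS => Si; rewrite -ltNge ltz_nat ltnS.
by apply: rk_ge; rewrite ?subsetT.
Qed.

End OrlikSolomon.

Section Evaluation.
Variables (K : fieldType) (X : vectType K).

Lemma eval_is_linear (x : X) : linear (fun f : 'Hom(X, K^o) => f x).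
Proof. by move=> a f g; rewrite add_lfunE scale_lfunE. Qed.
Definition eval_fun (x : X) (f : 'Hom(X, K^o)) : K^o := f x.
HB.instance Definition _ x := GRing.isLinear.Build K 'Hom(X, K^o) K^o *:%R
  (eval_fun x) (eval_is_linear x).
Definition eval (x : X) : 'Hom('Hom(X, K^o), K^o) := linfun (eval_fun x).

Lemma evalE x f : eval x f = f x.
Proof. exact: lfunE. Qed.

Lemma dim_kernels (Y : vectType K) (U : {vspace Y}) (fs : seq 'Hom(Y, K^o)) :
  (\dim U <= \dim (U :&: \bigcap_(f <- fs) lker f) + size fs)%N.
Proof.
elim: fs U => [|f fs IH] U; first by rewrite big_nil capvf addn0.
rewrite big_cons capvA /= addnS -(limg_ker_dim f U) -addn1.
by apply: leq_add (IH _) (leq_trans (dimvS (subvf _)) _); rewrite dimvf.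

Qed.

End Evaluation.

(** * The upper bound by broken sets *)

Section AnnihilatorDimension.
Variables (K : fieldType) (n : nat) (M : matroid 'I_n).
Local Notation E := (ext K n).
Local Notation J := (@orlik_solomon_ideal K n M).
Local Notation bd S := (contr (ones K n) (ext_basis K S)).
Local Notation Y := (dualX K n 1).
Local Notation rk := (rk M).
Implicit Types (S T W : {set 'I_n}) (i c : 'I_n) (f : Y).

Definition os_ann : {vspace Y} :=
  lker (precomp (fmap (fun=> projv (os_space K M)) : 'End(fmod K n 1))).

Lemma mem_os_ann f : f \in os_ann <-> forall x : fmod K n 1, sub1 J x -> f x = 0.
Proof.
rewrite memv_ker precompE; split=> [/eqP/lfunP h x /os_spaceP xJ|h].
  have := h x; rewrite comp_lfunE zero_lfunE => <-; congr (f _); apply/fmodP => k.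
  by rewrite fmapE /= (ord1 k) projv_id.
apply/eqP/lfunP => x; rewrite comp_lfunE zero_lfunE; apply: h; apply/os_spaceP.
by rewrite fmapE /= memv_proj.
Qed.

Lemma bd_relation T : \sum_(i in T) (-1) ^+ pos i T *: bd (T :\ i) = 0.
Proof.
rewrite -[RHS](contr_sqr (ones K n) (ext_basis K T)) -[in RHS]ext_partialE linear_sum.
by apply: eq_bigr => i _; rewrite linearZ.
Qed.

Variable m : nat.
Hypothesis m_gt0 : (0 < m)%N.
Hypothesis hd : forall S, dependent M S -> (m < #|S|)%N.

(** [c] is the least element of the closure of [W]; it need not lie outside [W]. *)
Definition minimal c W := (rk (c |: W) == rk W) && [forall d, (rk (d |: W) == rk W) ==> (c <= d)%N].

Definition closure_bd W : E := if [pick c | minimal c W] is Some c then bd (c |: W) else 0.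

Lemma closure_bdE c W : minimal c W -> closure_bd W = bd (c |: W).
Proof.
rewrite /closure_bd; case: pickP => [d|/(_ c) ->//] /andP[d1 /forallP d2] /andP[c1 /forallP c2].
suff -> : c = d by [].
by apply/val_inj/eqP; rewrite eqn_leq (implyP (c2 d)) // (implyP (d2 c)).
Qed.

Lemma small_rk W : (#|W| <= m)%N -> rk W = #|W|.
Proof.
move=> cW; apply/eqP; rewrite -rk_indep; apply: contraTT cW => /hd.
by rewrite -ltnNge.
Qed.

(* By [bd_relation], the [bd S] are spanned by those of the sets [c |: W] with [c]
   least in the closure of [W]. *)
Lemma os_ann_bound : ('C(n, m) <= \dim (os_ann :&: degs (pred1 m%:Z)) + #|broken M m set0 setT|)%N.
Proof.
pose fs := [seq eval (fmk (fun=> closure_bd W) : fmod K n 1) | W <- enum (broken M m set0 setT)].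
have := dim_kernels (degs (pred1 m%:Z)) fs.
rewrite degs_dim size_map -cardE => /leq_trans; apply; rewrite leq_add2r.
apply/dimvS/subvP => f; rewrite !memv_cap => /andP[fm fk]; rewrite fm andbT.
pose g (x : E) : K := f (fmk (fun=> x)).
have gD (x y : E) : g (x + y) = g x + g y.
  by rewrite /g -(linearD f); congr (f _); apply/fmodP => k; rewrite !ffunE.
have gZ a (x : E) : g (a *: x) = a * g x.
  have : f (a *: fmk (fun=> x)) = a * g x by rewrite linearZ.
  by move=> <-; rewrite /g; congr (f _); apply/fmodP => k; rewrite !ffunE.
have g0 : g 0 = 0 by rewrite -(scale0r 0) gZ mul0r.
have gm (x : E) : g (prE (pred1 m%:Z) x) = g x.
  move: fm; rewrite mem_degs => /eqP fm; rewrite /g -[in RHS]fm cutoffE; congr (f _).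
  by apply/fmodP => k; rewrite prXE !ffunE.
have gbr W : W \in broken M m set0 setT -> g (closure_bd W) = 0.
  move=> WB; have : eval (fmk (fun=> closure_bd W) : fmod K n 1) \in fs.
    by apply: map_f; rewrite mem_enum.
  elim: (fs) fk => // h fs2 IH; rewrite big_cons memv_cap inE => /andP[hf /IH{}IH] /predU1P[eh|/IH//].
  by move: hf; rewrite -eh memv_ker evalE => /eqP.
have gmin c W : minimal c W -> #|W| = m -> (forall x, x \in W -> (c < x)%N) -> g (bd (c |: W)) = 0.
  move=> cW sW lt; rewrite -(closure_bdE cW); apply: gbr; apply/brokenP; split; rewrite ?subsetT //.
  by exists c; rewrite !setU0 in_setT; split=> //; case/andP: cW => /eqP.
have gbd S : dependent M S -> #|S| = m.+1 -> g (bd S) = 0.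
  move=> dS cS; have /card_gt0P[s0 s0S] : (0 < #|S|)%N by rewrite cS.
  have [c cS0 cmin] := @arg_minnP _ s0 (mem S) (fun x : 'I_n => x : nat) s0S.
  have {}cS0 : c \in S := cS0; have {}cmin x : x \in S -> (c <= x)%N by apply: cmin.
  have cS' : #|S :\ c| = m by move: cS; rewrite (cardsD1 c) cS0 => -[].
  have rS : rk S = m.
    apply/eqP; rewrite eqn_leq -{2}cS' -small_rk ?cS' // rk_mono ?subsetDl // andbT.
    rewrite -ltnS -cS ltn_neqAle rk_card andbT.
    by move: dS; rewrite /dependent rk_indep.
  have rc : rk (c |: (S :\ c)) = rk (S :\ c) by rewrite setD1K // rS small_rk ?cS'.
  have [c0 c0P c0min] := @arg_minnP _ c (fun d => rk (d |: (S :\ c)) == rk (S :\ c))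
     (fun x : 'I_n => x : nat) (introT eqP rc).
  have mc0 : minimal c0 (S :\ c) by rewrite /minimal c0P; apply/forallP => d; apply/implyP/c0min.
  have c0c : (c0 <= c)%N by apply: c0min; rewrite rc.
  have ltc x : x \in S :\ c -> (c < x)%N.
    by rewrite !inE => /andP[xc xS]; rewrite ltn_neqAle eq_sym xc cmin.
  have [e|ne] := eqVneq c0 c.
    by rewrite -[S](setD1K cS0); apply: gmin; rewrite ?cS' // -{1}e.
  have lt0 : (c0 < c)%N by rewrite ltn_neqAle ne.
  have c0S : c0 \notin S by apply/negP => /cmin; rewrite leqNgt lt0.
  have rT : rk (c0 |: S) = m.
    by rewrite -rS; apply: (@rk_closure _ _ c0 (S :\ c)); [apply/eqP|apply: subsetDl].
  (* [c0] lies in the closure of [S], below all of [S]. The relation on [c0 |: S] expresses [bd S]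
     through the [bd (c0 |: S :\ i)], where [c0] is least in the closure of [S :\ i]. *)
  have rel := bd_relation (c0 |: S).
  rewrite (bigD1 c0) ?setU11 //= setU1K // in rel.
  have : g ((-1) ^+ pos c0 (c0 |: S) *: bd S) = 0.
    have := congr1 g rel; rewrite gD g0 => <-; rewrite -[LHS]addr0; congr (_ + _).
    apply/esym; elim/big_ind: _ => // [x y gx gy|i]; first by rewrite gD gx gy addr0.
    rewrite !inE => /andP[/predU1P[->|iS] ii0]; first by rewrite eqxx in ii0.
    rewrite gZ.
    have -> : (c0 |: S) :\ i = c0 |: S :\ i.
      by apply/setP => x; rewrite !inE; case: (x =P c0) => [->|//]; rewrite eq_sym ii0.
    have cSi : #|S :\ i| = m by move: cS; rewrite (cardsD1 i) iS => -[].
    have rSi : rk (S :\ i) = m by rewrite small_rk cSi.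
    have closed d : rk (d |: S :\ i) = rk (S :\ i) -> rk (d |: (S :\ c)) = rk (S :\ c).
      move=> rd; have rdS : rk (d |: S) = m.
        by rewrite -rS; apply: (rk_closure rd); apply: subsetDl.
      apply/eqP; rewrite eqn_leq [X in _ && X]rk_mono ?subsetUr // andbT.
      by rewrite (leq_trans (rk_mono _ (setUS _ (subsetDl _ _)))) // rdS small_rk ?cS'.
    rewrite gmin ?mulr0 //.
      rewrite /minimal; apply/andP; split.
        rewrite rSi eqn_leq -{1}rT rk_mono ?setUS ?subsetDl //=.
        by rewrite -{1}rSi rk_mono // subsetUr.
      apply/forallP => d; apply/implyP => /eqP/closed/eqP; exact: c0min.
    by move=> x; rewrite !inE => /andP[_ /cmin]; apply: leq_trans.
  rewrite gZ => /eqP; rewrite mulf_eq0 => /orP[|/eqP//].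
  by rewrite signr_eq0.
apply/mem_os_ann => x; rewrite /sub1 => xJ.
have -> : f x = g (x 0) by congr (f _); apply/fmodP => k; rewrite fmkE (ord1 k).
elim/os_ind: xJ => // [y z|a y|A S B dS].
- by rewrite gD => -> ->; rewrite addr0.
- by rewrite gZ => ->; rewrite mulr0.
rewrite -gm (prE_homogeneous _ (@os_term_homogeneous K n A S B)) /=.
(* As dependent sets have more than [m] elements, degree [m] leaves room only for those of size
   [m.+1], with no multiplier. *)
case: eqP => // dE; have := hd dS => mS.
have [A0 B0 cS] : [/\ #|A| = 0, #|B| = 0 & #|S| = m.+1]%N.
  by move: dE mS; move: #|A| #|B| #|S| => a b s; clear; split; lia.
move: A0 B0 => /eqP; rewrite cards_eq0 => /eqP -> /eqP; rewrite cards_eq0 => /eqP ->.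
by rewrite mulr1 mul1r; apply: gbd.
Qed.

End AnnihilatorDimension.

(** * A linear resolution determines the matroid *)

Section Forward.
Variables (K : fieldType) (n m : nat) (M : matroid 'I_n).
Local Notation E := (ext K n).
Local Notation J := (@orlik_solomon_ideal K n M).
Local Notation bd S := (contr (ones K n) (ext_basis K S)).
Hypothesis Kinf : forall s : seq K, exists x, x \notin s.
Hypothesis lin : linear_resolution m J.
Implicit Types (S : {set 'I_n}).

Lemma linear_min_dependent S : dependent M S -> (forall T, dependent M T -> (#|S| <= #|T|)%N) ->
  #|S| = m.+1.
Proof.
move=> dS minS; have [F Flin] := lin; have bV := vbasisP {:'rV[K]_n}.
have cS := dependent_neq0 dS; rewrite -(prednK cS); congr _.+1.
apply: (resolved_low_degree Flin bV (os_gen K dS)).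
- have := @homogeneous_bd K n S; congr homogeneous.
  by rewrite -{1}(prednK cS) intS addrAC subrr add0r.
- by apply: bd_neq0; rewrite -card_gt0.
move=> y Jy hy; apply: (os_low_degree (d := #|S|.-1) _ Jy hy); last by rewrite ltrBlDr ltrDl.
by move=> T /minS; rewrite prednK.
Qed.

Lemma linear_broken : (0 < m)%N -> (forall S, dependent M S -> (m < #|S|)%N) ->
  (exists2 S, dependent M S & #|S| = m.+1) ->
  #|broken M m set0 setT| = 'C(nullity M set0 setT + m.-1, m) /\
  forall S, dependent M S -> exists2 Z : {set 'I_n}, Z \subset S & dependent M Z /\ #|Z| = m.+1.
Proof.
move=> m_gt0 hd [S0 dS0 cS0]; have [F Flin] := lin.
have g : girth M m set0 setT.
  by move=> Y _ cY; rewrite setU0 (small_rk hd cY) (small_rk hd) ?cards0 ?addn0.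
have rk0 : rk M set0 = 0%N by rewrite (small_rk hd) ?cards0.
have [b q] := bc_bound (erefl #|[set: 'I_n]|) g.
have rn : (rk M setT <= n)%N by have := rk_card M setT; rewrite cardsT card_ord.
have mr : (m <= rk M setT)%N.
  have /card_gt0P[x xS] : (0 < #|S0|)%N by rewrite cS0.
  have cx : #|S0 :\ x| = m by move: cS0; rewrite (cardsD1 x) xS => -[].
  by rewrite -{1}cx -(small_rk hd) ?cx // rk_mono ?subsetT.
have rn' : ((rk M setT).+1 - m <= n)%N.
  by move: rn mr m_gt0; move: (rk M setT) => r; clear; lia.
have lb := @annih_dim_bound K n m (rk M setT) J Kinf m_gt0 (fun x y => @resolved_mul _ _ _ F y x)
  (@resolved_pr _ _ _ F) (fun ws i bws => @reg_of_linear _ _ _ _ _ Flin _ bws i m_gt0) (@os_top K n M)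
  (os_ann K M) (@mem_os_ann K n M) (leqW mr) rn'.
have ub := os_ann_bound K hd.
(* The two bounds involve the same binomial, which forces equality in the count of broken sets. *)
have nE : (n - ((rk M setT).+1 - m) = nullity M set0 setT + m.-1)%N.
  rewrite /nullity cardsT card_ord setU0 rk0 addn0.
  by move: rn mr m_gt0; move: (rk M setT) => r; clear; lia.
rewrite nE in lb.
have e : #|broken M m set0 setT| = 'C(nullity M set0 setT + m.-1, m).
  apply/eqP; rewrite eqn_leq b /= -(leq_add2l (\dim (os_ann K M :&: degs (pred1 m%:Z)))).
  exact: leq_trans lb ub.
split=> // S dS; have [|Z [ZS cZ rZ]] := q m_gt0 e S (subsetT _).
  rewrite setU0 rk0 addn0 ltn_neqAle rk_card andbT.
  by move: dS; rewrite /dependent rk_indep.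
rewrite setU0 rk0 addn0 in rZ.
by exists Z => //; split=> //; rewrite /dependent rk_indep cZ neq_ltn ltnS rZ.
Qed.

Lemma linear_classification :
  [\/ has_loop M /\ m = 0%N,
      [/\ ~~ has_loop M, has_nontrivial_parallel_class M, m = 1%N & rank1_sum M] |
      simple_matroid M /\ uniform_sum M m].
Proof.
(* Without dependent sets J is zero and no [m] is singled out; the matroid is then written with an
   empty uniform part. *)
have [/existsP[S0 dS0]|free] := boolP [exists S, dependent M S]; last first.
  have iS S : S \in indep M by apply: contraT => dS; case/negP: free; apply/existsP; exists S.
  apply: Or33; split; first by apply: girth_simple => S; rewrite /dependent iS.
  by apply: (@uniform_sumE _ _ _ set0) => S; rewrite iS setI0 cards0.
have [S dS minS] := @arg_minnP _ S0 (dependent M) (fun S => #|S|) dS0.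
have cS := linear_min_dependent dS minS.
have hd T : dependent M T -> (m < #|T|)%N by move=> /minS; rewrite cS.
have [loop|nl] := boolP (has_loop M).
  apply: Or31; split=> //; case/existsP: loop => i /hd; rewrite cards1.
  by case: (m).
have m_gt0 : (0 < m)%N by have := loopless_dependent nl dS; rewrite cS.
have [e Zs] := linear_broken m_gt0 hd (ex_intro2 _ _ S dS cS).
case: (m) m_gt0 hd cS e Zs => [//|[|k]] _ hd cS e Zs; [apply: Or32|apply: Or33]; split=> //.
- apply/(nontrivial_parallel_classP nl); move/eqP/cards2P: cS => [x [y [xy eS]]].
  by exists x, y; rewrite -eS.
- exact: pairs_rank1_sum.
- by apply: girth_simple => T /hd; apply: leq_trans.
have g : girth M k.+2 set0 setT.
  by move=> Y _ cY; rewrite setU0 (small_rk hd cY) (small_rk hd) ?cards0 ?addn0.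
have [A [_ rA rT]] := uniform_part (erefl _) g e.
exact: uniform_sumE (split_uniform hd rA rT).
Qed.

End Forward.

(** * Construction of linear resolutions *)

Lemma functional_separation (K : fieldType) (X : vectType K) (W : {vspace X}) (x : X) :
  (forall f : 'Hom(X, K^o), (forall y, y \in W -> f y = 0) -> f x = 0) -> x \in W.
Proof.
move=> h; pose p := (\1 - projv W)%VF.
have pE y : p y = y - projv W y by rewrite add_lfunE opp_lfunE id_lfunE.
suff : p x = 0 by rewrite pE => /eqP; rewrite subr_eq0 => /eqP ->; apply: memv_proj.
rewrite (coord_vbasis (memvf (p x))) big1 // => i _.
have := h (linfun (coord (vbasis fullv) i : X -> K^o) \o p)%VF; rewrite !comp_lfunE lfunE /= => ->; first by rewrite scale0r.
by move=> y yW; rewrite !comp_lfunE lfunE /= pE projv_id // subrr linear0.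
Qed.

Lemma delta_mem (V Y : zmodType) (op : V -> Y -> Y) (P : Y -> Prop) ws f a : P 0 ->
  (forall x y, P x -> P y -> P (x + y)) -> (forall w b, P (op w (f b))) -> P (delta op ws f a).
Proof.
move=> P0 PD Pop; elim: ws f a Pop => [|w ws IH] f [|i a] Pop //=.
by apply: PD; [case: i|apply: IH].
Qed.

Section LinearModules.
Variables (K : fieldType) (n : nat) (ws : seq 'rV[K]_n).
Hypothesis bws : basis_of fullv ws.
Local Notation E := (ext K n).
Implicit Types (r e d : nat) (u : E).

Lemma cutoff_sub r (P P' : 'I_r -> pred int) (f : dualX K n r) :
  (forall k t, P k t -> P' k t) -> cutoff P f = f -> cutoff P' f = f.
Proof.
move=> PP' fP; apply/lfunP => x; rewrite cutoffE -fP !cutoffE; congr (f _); apply/fmodP => k.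
by rewrite !prXE prE_comp; apply: eq_prE => t /=; apply/andb_idr/PP'.
Qed.

Lemma closed_high r d (f : dualX K n r) : (0 < d)%N -> cutoff (fun _ t => d%:Z <= t) f = f ->
  (forall w, w \in ws -> op w f = 0) -> f = 0.
Proof.
move=> d0 df fws; apply/lfunP => x; rewrite (op_closed0 bws fws) -df cutoffE zero_lfunE.
rewrite -[RHS](linear0 f); congr (f _); apply/fmodP => k; rewrite prXE fmkE [RHS]ffunE linearZ /=.
by rewrite (prE_homogeneous _ (@homogeneous_basis K n set0)) cards0 lez_nat leqNgt d0 scaler0.
Qed.

(* A graded submodule of a free module with generators in degree 0, all of whose
   Koszul relations of degree at least [e] are trivial: it is generated in degree
   [e] and has a linear resolution. *)
Record linear_module r e (Z : {vspace fmod K n r}) : Prop := LinearModule {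
  lm_mul : forall u x, x \in Z -> lmulX r u x \in Z;
  lm_pr : forall P x, x \in Z -> prX (fun _ => P) x \in Z;
  lm_low : forall x, x \in Z -> prX (fun _ t => t < e%:Z) x = 0;
  lm_reg : forall i, reg (@op K n r) i e ws (annih (fun x => x \in Z))
}.

Definition homog_part r e (Z : {vspace fmod K n r}) : {vspace fmod K n r} :=
  (Z :&: lker (@prX K n r (fun _ => pred1 e%:Z%R) - \1)%VF)%VS.

Lemma mem_homog_part r e (Z : {vspace fmod K n r}) x :
  (x \in homog_part e Z) = (x \in Z) && (prX (fun _ => pred1 e%:Z) x == x).
Proof. by rewrite memv_cap memv_ker add_lfunE opp_lfunE id_lfunE subr_eq0. Qed.

(** The rows form a [K]-basis of the degree [e] part, so they satisfy no nonzero relation with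
    constant coefficients. *)
Definition gens r e (Z : {vspace fmod K n r}) : 'M[E]_(\dim (homog_part e Z), r) :=
  \matrix_(k, l) (vbasis (homog_part e Z))`_k l.

Lemma gens_homogeneous r e (Z : {vspace fmod K n r}) k l : homogeneous e%:Z (gens e Z k l).
Proof.
rewrite mxE; apply/homogeneous_prP.
have : (vbasis (homog_part e Z))`_k \in homog_part e Z by apply/vbasis_mem/mem_nth; rewrite size_tuple.
by rewrite mem_homog_part => /andP[_ /eqP {2}<-]; rewrite prXE.
Qed.

Lemma act_gens r e (Z : {vspace fmod K n r}) x :
  act (gens e Z) x = \sum_k lmulX r (x k) (vbasis (homog_part e Z))`_k.
Proof. by apply/fmodP => l; rewrite actE fmod_sumE; apply: eq_bigr => k _; rewrite lmulXE mxE. Qed.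

Lemma act_gens_scalars r e (Z : {vspace fmod K n r}) (c : 'I_(\dim (homog_part e Z)) -> K) :
  act (gens e Z) (fmk (fun k => c k *: 1)) = \sum_k c k *: (vbasis (homog_part e Z))`_k.
Proof.
rewrite act_gens; apply: eq_bigr => k _; apply/fmodP => l.
by rewrite lmulXE ffunE fmkE -scalerAl mul1r.
Qed.

Lemma gens_mem r e (Z : {vspace fmod K n r}) k : (vbasis (homog_part e Z))`_k \in Z.
Proof.
have [kd|kd] := ltnP k (\dim (homog_part e Z)).
  have : (vbasis (homog_part e Z))`_k \in homog_part e Z by apply/vbasis_mem/mem_nth; rewrite size_tuple.
  by rewrite mem_homog_part => /andP[].
by rewrite nth_default ?mem0v // size_tuple.
Qed.

Section Step.
Variables (r e : nat) (Z : {vspace fmod K n r}).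
Hypothesis e_gt0 : (0 < e)%N.
Hypothesis lmZ : linear_module e Z.
Local Notation D := (gens e Z).

(* If [f] kills [V Z], then [delta f] is a closed family of functionals vanishing on
   [Z], hence the [delta] of another one, which can only be [f] itself. *)
Lemma generated_next d (f : dualX K n r) : (e <= d)%N -> cutoff (fun _ => pred1 d.+1%:Z) f = f ->
  (forall w x, x \in Z -> f (lmulX r (vec w) x) = 0) -> forall x, x \in Z -> f x = 0.
Proof.
move=> ed fd fV; have fge : cutoff (fun _ t => d.+1%:Z <= t) f = f.
  by apply: cutoff_sub fd => _ t /eqP ->.
pose phi a : dualX K n r := if sumn a == 0%N then f else 0.
have ann w : annih (fun x => x \in Z) d (op w f).
  by split=> [x xZ|]; [rewrite opE fV|rewrite -op_cutoff_ge fge].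
have FZ : filtered (@op K n r) (annih (fun x => x \in Z)).
  by apply: filtered_annih => w x; apply: (lm_mul lmZ).
have phid a : annih (fun x => x \in Z) d (delta (@op K n r) ws phi a).
  apply: delta_mem => [|x y|w b]; [exact: filtered0 FZ d|exact: filteredD FZ d x y|].
  by rewrite /phi; case: ifP => _; [exact: ann|rewrite opX_0; exact: filtered0 FZ d].
have hphi : homfam 0 phi by move=> a sa; rewrite /phi (negPf sa).
have [|a sa|eta etaZ etaE] := @lm_reg r e Z lmZ 1 d (delta (@op K n r) ws phi) ed _ phid.
- by move=> a sa; apply: (homfam_delta (@opX_B K n r) ws hphi).
- exact: (delta_delta (@opX_B K n r) (@opX_C K n r) (@opX_2 K n r)).
pose o := nseq (size ws) 0%N; have so : sumn o = 0%N by rewrite sumn_nseq.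
have eo : phi o - eta o = 0.
  apply: (@closed_high r d.+1) => //.
    by rewrite cutoffB /phi so eqxx fge (proj2 (etaZ o)).
  apply: (@delta_closed_degree0 _ _ _ ws (fun a => phi a - eta a)) => a sa.
  by rewrite (deltaB (@opX_B K n r)) etaE ?subrr.
move=> x xZ; have := proj1 (etaZ o) x xZ.
by move/eqP: eo; rewrite /phi so eqxx subr_eq0 => /eqP <-.
Qed.

(** By induction on the degree and separation by functionals: one that kills the image kills the
    multiples by linear forms of [Z] in degree [d], hence [Z] in degree [d.+1] by
    [generated_next]. *)
Lemma gens_image x : x \in Z <-> exists y, x = act D y.
Proof.
split=> [xZ|[y ->]]; last first.
  by rewrite act_gens memv_suml // => k _; apply: (lm_mul lmZ); apply: gens_mem.
suff : x \in limg (act D) by move=> /memv_imgP[y _ ->]; exists y.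
have low d' y : (d' < e)%N -> prX (fun _ => pred1 d'%:Z) y = y -> y \in Z -> y \in limg (act D).
  move=> lt yd yZ; suff -> : y = 0 by apply: mem0v.
  rewrite -(lm_low lmZ yZ) -[LHS]yd; apply/fmodP => k; rewrite -[in RHS]yd !prXE prE_comp.
  by apply: eq_prE => t /=; apply/esym/andb_idl => /eqP ->.
have homog d y : y \in Z -> prX (fun _ => pred1 d%:Z) y = y -> y \in limg (act D).
  elim: d y => [|d IH] y yZ yd; first exact: low e_gt0 yd yZ.
  have [lt|le] := ltnP d.+1 e; first exact: low lt yd yZ.
  move: le; rewrite leq_eqVlt => /predU1P[ed|ed].
    have yh : y \in homog_part e Z by rewrite mem_homog_part yZ ed yd eqxx.
    by rewrite (coord_vbasis yh) -act_gens_scalars memv_img ?memvf.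
  apply: functional_separation => f fW; rewrite -yd -cutoffE.
  apply: (@generated_next d) => //; first exact: cutoff_idem.
  move=> w z zZ; rewrite cutoffE pr_lmul; apply: fW.
  have zd : prX (fun (_ : 'I_r) t => pred1 d.+1%:Z (t + 1)) z = prX (fun _ => pred1 d%:Z) z.
    by apply/fmodP => k; rewrite !prXE; apply: eq_prE => t; rewrite /= intS addrC (inj_eq (addrI 1)).
  rewrite {}zd; have /memv_imgP[v _ ->] : prX (fun _ => pred1 d%:Z) z \in limg (act D).
    apply: IH; first exact: (lm_pr lmZ).
    by apply/fmodP => k; rewrite !prXE prE_comp; apply: eq_prE => t; apply: andbb.
  by rewrite -act_lmul memv_img ?memvf.
have -> : x = \sum_(d < n.+1) prX (fun _ => pred1 d%:Z) x.
  apply/fmodP => k; rewrite fmod_sumE [LHS]ext_sum_degrees.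
  by apply: eq_bigr => d _; rewrite prXE.
rewrite memv_suml // => d _; apply: (homog d); first exact: (lm_pr lmZ).
by apply/fmodP => k; rewrite !prXE prE_comp; apply: eq_prE => t; apply: andbb.
Qed.

Lemma gens_ker_low x : act D x = 0 -> prX (fun _ t => t < 1) x = 0.
Proof.
move=> Dx; pose c k := ext_aug (x k).
have xE : prX (fun _ t => t < 1) x = fmk (fun k => c k *: 1).
  apply/fmodP => k; rewrite prXE fmkE; apply: ext_coefP => S; rewrite ext_coef_pr ext_coefZ.
  rewrite ext_coef_basis ltz_nat ltnS leqn0 cards_eq0.
  by case: eqP => [->|_]; rewrite ?mulr1 ?mulr0.
have hD k l : homogeneous (e%:Z - 0) (D k l) by rewrite subr0; apply: gens_homogeneous.
have y0 : act D (fmk (fun k => c k *: 1)) = 0.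
  have := act_pr (fun t => t < e%:Z + 1) x hD; rewrite Dx linear0 -xE => ->.
  by congr (act D _); apply/fmodP => k; rewrite !prXE; apply: eq_prE => t; rewrite ltrD2l.
rewrite act_gens_scalars in y0; rewrite xE; apply/fmodP => k; rewrite ffunE [RHS]ffunE.
by have /freeP/(_ c y0 k) -> := basis_free (vbasisP (homog_part e Z)); rewrite scale0r.
Qed.

(** A family [phi] killing the kernel is the pull-back of some [f]. Its [delta] kills [Z], so it is
    also the [delta] of an [eta] killing [Z]. Then [f - eta] is closed with pull-back [phi], hence a
    [delta] over the free module, and pulling back solves for [phi]. Internal degrees shift by [e],
    the degree of the entries of [D]. *)
Lemma linear_module_ker : linear_module 1 (lker (act D)).
Proof.
have hD k l : homogeneous (e%:Z - 0) (D k l) by rewrite subr0; apply: gens_homogeneous.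
have prD (P : pred int) x : act D (prX (fun _ => P) x) = prX (fun _ t => P (t - e%:Z)) (act D x).
  have -> : prX (fun _ => P) x = prX (fun _ t => P (e%:Z + t - e%:Z)) x.
    by apply/fmodP => k; rewrite !prXE; apply: eq_prE => t; rewrite addrAC subrr add0r.
  rewrite -(act_pr (fun t => P (t - e%:Z)) x hD).
  by apply/fmodP => k; rewrite !prXE; apply: eq_prE => t; rewrite add0r.
have kerD x : (x \in lker (act D)) = (act D x == 0) by rewrite memv_ker.
have ker_pr P x : x \in lker (act D) -> prX (fun _ => P) x \in lker (act D).
  by rewrite !kerD prD => /eqP ->; rewrite linear0.
split=> // [u x|x|].
- by rewrite !kerD act_lmul => /eqP ->; rewrite linear0.
- by rewrite kerD => /eqP; apply: gens_ker_low.
move=> i [//|d] phi _ hphi phiZ phid.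
have FZ : filtered (@op K n r) (annih (fun x => x \in Z)).
  by apply: filtered_annih => w x; apply: (lm_mul lmZ).
have F0 : filtered (@op K n r) (annih (fun=> False)) by apply: filtered_annih.
pose f a : dualX K n r := cutoff (fun _ t => (d + e).+1%:Z <= t) (phi a \o (act D)^-1)%VF.
have fD a : pullback D (f a) = phi a.
  have [phia dphi] := phiZ a; have phiE : phi a = ((phi a \o (act D)^-1) \o act D)%VF.
    by apply: lfun_factor => x Dx; apply: phia; rewrite kerD Dx.
  rewrite -[RHS]dphi [in RHS]phiE; apply/lfunP => x; rewrite pullbackE !cutoffE [RHS]comp_lfunE.
  congr (_ _); rewrite prD; apply/fmodP => k; rewrite !prXE; apply: eq_prE => t.
  by rewrite lerBrDr -PoszD addSn.
have fge a : annih (fun=> False) (d + e).+1 (f a) by split=> //; apply: cutoff_idem.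
have hf : homfam i f.
  by move=> a /hphi phia; rewrite /f phia comp_lfun0l cutoff0.
pose df a := if size a == size ws then delta (@op K n r) ws f a else 0.
have dfE a : size a = size ws -> df a = delta (@op K n r) ws f a by rewrite /df => ->; rewrite eqxx.
have dfZ a : annih (fun x => x \in Z) (d + e) (df a).
  rewrite /df; case: eqP => sa; last exact: filtered0 FZ _.
  split=> [x|]; last by apply: (proj2 (filtered_delta F0 _ _ fge)).
  case/gens_image => y ->; rewrite -pullbackE -delta_pullback (eq_delta _ _ _ fD).
  by rewrite phid ?zero_lfunE.
have [a na|a sa|eta etaZ etaE] := lm_reg lmZ (i := i.+1) (leq_addl d e) _ dfZ.
- by rewrite /df; case: eqP => // _; apply: (homfam_delta (@opX_B K n r) ws hf).
- transitivity (delta (@op K n r) ws (delta (@op K n r) ws f) a); first exact: eq_delta_size.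
  exact: (delta_delta (@opX_B K n r) (@opX_C K n r) (@opX_2 K n r)).
pose eta' := degpart (pred1 i) eta.
have etaZ' a : annih (fun x => x \in Z) (d + e).+1 (eta' a).
  by rewrite /eta' /degpart; case: ifP => _; [exact: etaZ|exact: filtered0 FZ _].
have etaD a : pullback D (eta' a) = 0.
  apply/lfunP => x; rewrite pullbackE zero_lfunE; apply: (proj1 (etaZ' a)).
  by apply/gens_image; exists x.
pose g a := f a - eta' a.
have hg : homfam i g by move=> a na; rewrite /g hf // /eta' /degpart /= (negPf na) subr0.
have dg a : size a = size ws -> delta (@op K n r) ws g a = 0.
  move=> sa; rewrite (deltaB (@opX_B K n r)) (delta_degpart (@opX_B K n r) ws (pred1 i.+1)) /=.
  rewrite etaE // dfE //; case: eqP => [_|/eqP na]; first by rewrite subrr.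
  by rewrite subr0 (homfam_delta (@opX_B K n r) ws hf).
have gD a : pullback D (g a) = phi a by rewrite /g (pullback_is_additive D) fD etaD subr0.
(* In polynomial degree 0 closed families need not be boundaries, but a closed functional living in
   positive degrees is zero. *)
have [i0|i_gt0] := posnP i.
  have F1 := filtered_annih (Z := fun x => x \in lker (act D)).
  have phi0 a : size a = size ws -> phi a = 0.
    move=> sa; have [/natnseq0P|na] := boolP (sumn a == 0%N); last by apply: hphi; rewrite i0.
    rewrite sa => ->; rewrite -gD -[RHS](raddf0 (pullback D)); congr (pullback D _).
    apply: (@closed_high r (d + e).+1) => //; first by rewrite cutoffB (proj2 (fge _)) (proj2 (etaZ' _)).
    exact: (delta_closed_degree0 dg).
  exists (fun=> 0) => [a|a sa]; last by rewrite (delta0 (@opX_B K n _)) phi0.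
  by split=> [x _|]; rewrite ?zero_lfunE ?cutoff0.
have [|xi _ xiE] := reg_free bws i_gt0 (leqnn 0) hg _ dg => //.
exists (fun a => cutoff (fun _ t => d.+2%:Z <= t) (pullback D (xi a))) => [a|a sa].
  split=> [x /ker_pr xD|]; last exact: cutoff_idem.
  by rewrite cutoffE pullbackE (eqP (etrans (esym (kerD _)) (xD _))) linear0.
rewrite delta_cutoff delta_pullback xiE // gD -[RHS](proj2 (phiZ a)).
by apply: eq_cutoff => k t; rewrite intS addrC lerD2r.
Qed.

End Step.
End LinearModules.

(** * Assembly of the resolutions *)

Section Resolutions.
Variables (K : fieldType) (n : nat).
Local Notation E := (ext K n).

Lemma tor_dim0 (N : E -> Prop) (F : graded_free_resolution N) i d :
  (forall k : 'I_(fr_rank F i), fr_degree k != d) -> tor_dim F i d = 0%N.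
Proof.
move=> hd; rewrite /tor_dim /tensor_cycles.
have -> : tensor_degree F i d = 0.
  by apply/matrixP => k l; rewrite !mxE (negPf (hd _)) mul0rn.
by apply/eqP; rewrite mxrank_eq0 -submx0 (submx_trans (diffmxSl _ _)) // capmxSl.
Qed.

Record graded_matrix := GradedMatrix {gm_rows : nat; gm_cols : nat; gm_mx : 'M[E]_(gm_rows, gm_cols)}.

(** Each free module is treated as generated in degree 0, so the relations start in degree 1
    whatever [m] is. *)
Definition syzygies (A : graded_matrix) := GradedMatrix (gens 1 (lker (act (gm_mx A)))).

Section Build.
Variables (ws : seq 'rV[K]_n) (m : nat) (Z : {vspace fmod K n 1}) (N : E -> Prop).
Hypothesis bws : basis_of fullv ws.
Hypothesis m_gt0 : (0 < m)%N.
Hypothesis lmZ : linear_module ws m Z.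
Hypothesis NZ : forall x, N x <-> fmk (fun=> x) \in Z.

Let st i := iter i syzygies (GradedMatrix (gens m Z)).

Lemma syzygies_linear i : linear_module ws 1 (lker (act (gm_mx (st i)))).
Proof.
elim: i => [|i IH]; first exact: linear_module_ker.
exact: linear_module_ker.
Qed.

Lemma syzygies_exact i (v : 'rV[E]_(gm_rows (st i))) :
  v *m gm_mx (st i) = 0 <-> exists w, v = w *m gm_mx (st i.+1).
Proof.
have im := gens_image bws (ltn0Sn 0) (syzygies_linear i) (Xrow v).
have := act_eq0 (gm_mx (st i)) (Xrow v); rewrite XrowK => <-; split.
  move=> e; have /im[y ye] : Xrow v \in lker (act (gm_mx (st i))) by rewrite memv_ker e.
  by exists (rowX y); rewrite -(XrowK v) ye rowX_act.
case=> w e; apply/eqP; rewrite -memv_ker; apply/im; exists (Xrow w).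
by apply: (can_inj (@rowXK _ _ _)); rewrite rowX_act !XrowK e.
Qed.

Lemma linear_module_resolution : linear_resolution m N.
Proof.
(* The true degrees are restored here: the first map has entries of degree [m], all later ones of
   degree 1, so the basis of [F_i] sits in degree [i + m]. *)
unshelve eexists (@GradedFreeResolution K n N (fun i => gm_rows (st i))
  (fun i _ => (i + m)%:Z) (gm_mx (st 0)) (fun i => gm_mx (st i.+1)) _ _ _ _ _).
- by move=> k; apply: gens_homogeneous.
- move=> i k l; have := @gens_homogeneous K n _ 1 (lker (act (gm_mx (st i)))) k l.
  by congr (homogeneous _ _); rewrite addSn [in RHS]intS addrK.
- move=> x; rewrite NZ (gens_image bws m_gt0 lmZ); split=> [[y xy]|[v xv]].
    exists (rowX y); rewrite -rowX_act -xy mxE fmkE //.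
  exists (Xrow v); apply/fmodP => k; rewrite fmkE (ord1 k) xv -[v in LHS]XrowK -rowX_act mxE //.
- exact: (@syzygies_exact 0).
- by move=> i; apply: (@syzygies_exact i.+1).
by move=> i j jm; apply: tor_dim0 => k /=; rewrite PoszD (inj_eq (addrI _)) eq_sym.
Qed.

End Build.

Lemma zero_linear_resolution m (N : E -> Prop) : (forall x, N x <-> x = 0) -> linear_resolution m N.
Proof.
move=> N0; unshelve eexists (@GradedFreeResolution K n N (fun=> 0%N) (fun _ _ => 0) 0 (fun _ => 0) _ _ _ _ _).
- by case.
- by move=> i [].
- by move=> x; rewrite N0; split=> [->|[v ->]]; [exists 0|]; rewrite mulmx0 mxE.
- by move=> v; split=> _; [exists 0; apply/matrixP => ? []|rewrite mulmx0].
- by move=> i v; split=> _; [exists 0|]; apply/matrixP => ? [].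
by move=> i j _; apply: tor_dim0 => -[].
Qed.

Lemma unit_linear_resolution (N : E -> Prop) : (forall x, N x) -> linear_resolution 0 N.
Proof.
move=> NT; have h1 : homogeneous 0 (1 : E) by have := @homogeneous_basis K n set0; rewrite cards0.
unshelve eexists (@GradedFreeResolution K n N (fun i => (i == 0)%N : nat) (fun _ _ => 0) 1%:M
   (fun _ => 0) _ _ _ _ _).
- by move=> k; rewrite mxE; case: eqP => _; [apply: h1|apply: homogeneous0].
- by move=> i [].
- by move=> x; split=> // _; exists x%:M; rewrite mulmx1 mxE eqxx mulr1n.
- by move=> v; rewrite mulmx1; split=> [->|[w ->]]; [exists 0|]; rewrite mulmx0.
- by move=> i v; split=> _; [exists 0; apply/matrixP => ? []|rewrite mulmx0].
by case=> [|i] j j0; apply: tor_dim0; [move=> k; change (0 != 0 + j); rewrite add0r eq_sym|case].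
Qed.

End Resolutions.

(** * Direct sums of uniform matroids *)

Section Blocks.
Variables (K : fieldType) (n m : nat) (M : matroid 'I_n) (rep : 'I_n -> 'I_n).
Local Notation E := (ext K n).
Local Notation V := 'rV[K]_n.
Local Notation J := (@orlik_solomon_ideal K n M).
Local Notation bd S := (contr (ones K n) (ext_basis K S)).
Implicit Types (S T A B : {set 'I_n}) (x y : E) (b i j : 'I_n) (u w c : V).

Lemma sgnE_degrees x : sgnE x = \sum_(d < n.+1) (-1) ^+ d *: prE (pred1 d%:Z) x.
Proof.
apply: ext_coefP => S; rewrite ext_coef_sgn ext_coef_sum.
have hS : (#|S| < n.+1)%N by rewrite ltnS (leq_trans (max_card _)) ?card_ord.
rewrite (bigD1 (Ordinal hS)) //= ext_coefZ ext_coef_pr /= eqxx big1 ?addr0 // => d nd.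
rewrite ext_coefZ ext_coef_pr /=; case: eqP => [[e]|_]; last by rewrite mulr0.
by case/eqP: nd; apply: val_inj.
Qed.

Lemma os_sgn x : J x -> J (sgnE x).
Proof.
by move=> Jx; rewrite sgnE_degrees; apply: os_sum => d _; apply/osZ/os_pr.
Qed.

Lemma os_contr c : (forall S, dependent M S -> J (contr c (bd S))) -> forall x, J x -> J (contr c x).
Proof.
move=> h x; elim/os_ind => [|y z Jy Jz|a y Jy|A S B dS].
- by rewrite linear0; apply: os0.
- by rewrite contrD; apply: osD.
- by rewrite contrZ; apply: osZ.
have JS := os_gen K dS; rewrite !contrM; apply: osD; last by apply/osMr/os_sgn/osMl.
by rewrite mulrDl; apply: osD; apply/osMr/osMl => //; apply: h.
Qed.

Lemma eq_contr_basis c (d : V) S : (forall i, i \in S -> c 0 i = d 0 i) ->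
  contr c (ext_basis K S) = contr d (ext_basis K S).
Proof.
move=> cd; apply: eq_bigr => i _; rewrite ctr_basis.
by case: ifP => [/cd ->//|_]; rewrite !scaler0.
Qed.

Lemma ext_basis_split S A :
  ext_basis K S = (-1) ^+ ninv (S :&: A) (S :\: A) *: (ext_basis K (S :&: A) * ext_basis K (S :\: A)).
Proof.
rewrite ext_basisM ifT; last first.
  by rewrite -setI_eq0; apply/eqP/setP => i; rewrite !inE; case: (i \in A); rewrite ?andbF.
by rewrite setID scalerA -expr2 sqrr_sign scale1r.
Qed.

Definition indicator A : V := \row_i (i \in A)%:R.

Lemma contr_indicator A S : contr (indicator A) (ext_basis K S) =
  (-1) ^+ ninv (S :&: A) (S :\: A) *: (bd (S :&: A) * ext_basis K (S :\: A)).
Proof.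
rewrite {1}(ext_basis_split S A) contrZ contrM.
rewrite (eq_contr_basis (d := ones K n)) => [|i]; last by rewrite !inE !mxE => /andP[_ ->].
rewrite [contr _ (ext_basis K (S :\: A))](eq_contr_basis (d := 0)) => [|i]; last first.
  by rewrite !inE !mxE => /andP[/negPf ->].
by rewrite /contr [Z in _ + _ * Z]big1 ?mulr0 ?addr0 // => i _; rewrite mxE scale0r.
Qed.

Lemma os_contr_indicator A :
  (forall S, dependent M S -> dependent M (S :&: A) || dependent M (S :\: A)) ->
  forall x, J x -> J (contr (indicator A) x).
Proof.
move=> h; apply: os_contr => S /h dS; rewrite contrC contr_indicator contrZ contrM contr_sqr.
rewrite mul0r add0r; apply/osN/osZ; case/orP: dS => /(os_gen K) JS.
  exact/osMr/os_sgn.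
exact: osMl.
Qed.

Hypothesis m_gt0 : (0 < m)%N.
Hypothesis girthM : forall S, dependent M S -> (m < #|S|)%N.
Local Notation reps := [set b | rep b == b].
Hypothesis splitM : forall b S, b \in reps -> dependent M S ->
  dependent M (S :&: [set i | rep i == b]) || dependent M (S :\: [set i | rep i == b]).
Hypothesis fillM : forall T, #|T| = m -> [disjoint T & reps] ->
  exists2 b, b \in reps & dependent M (b |: T).

Definition os_module : {vspace fmod K n 1} := lker (\1 - fmap (fun=> projv (os_space K M)))%VF.

Lemma mem_os_module (x : fmod K n 1) : x \in os_module <-> J (x 0).
Proof.
rewrite memv_ker add_lfunE opp_lfunE id_lfunE subr_eq0 os_spaceP; split=> [/eqP e|xJ].
  by rewrite e fmapE /= memv_proj.
by apply/eqP/fmodP => k; rewrite fmapE /= (ord1 k) projv_id.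
Qed.

Local Notation reps_first := ([seq delta_mx 0 b : V | b <- enum reps] ++ [seq delta_mx 0 b | b <- enum (~: reps)]).

Lemma reps_basis : basis_of fullv reps_first.
Proof.
rewrite basisEdim; apply/andP; split; last first.
  by rewrite size_cat !size_map -!cardE cardsC card_ord dimvf /dim /= mul1n.
apply/subvP => w _; rewrite [w]row_sum_delta memv_suml // => i _; rewrite memvZ // memv_span //.
rewrite mem_cat; apply/orP; have [ir|ir] := boolP (i \in reps); [left|right].
  by apply/mapP; exists i; rewrite ?mem_enum.
by apply/mapP; exists i; rewrite ?mem_enum // inE ir.
Qed.

Local Notation Q := (annih (fun x : fmod K n 1 => x \in os_module)).
Let opB := @opX_B K n 1.
Let opC := @opX_C K n 1.
Let op2 := @opX_2 K n 1.

Lemma filtered_os : filtered (@op K n 1) Q.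
Proof.
by apply: filtered_annih => w x /mem_os_module xJ; apply/mem_os_module; rewrite lmulXE; apply: osMl.
Qed.

(** Each block contains exactly one representative, so its indicator is dual to that representative,
    and contraction with it is a homotopy preserving the functionals that vanish on J. *)
Lemma reps_exact d : exact_chain (@op K n 1) d [seq delta_mx 0 b : V | b <- enum reps] Q.
Proof.
pose cw w : V := \row_i w 0 (rep i).
have cE b : cw (delta_mx 0 b) = indicator [set i | rep i == b].
  by apply/rowP => i; rewrite !mxE inE.
have dotE b b' : b' \in reps -> dot (cw (delta_mx 0 b)) (delta_mx 0 b') = (b' == b)%:R :> K.
  rewrite inE => /eqP rb'; rewrite /dot (bigD1 b') //= !mxE !eqxx rb' mulr1 big1 ?addr0 // => i ib.
  by rewrite [Z in _ * Z]mxE (negPf ib) andbF mulr0.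
apply: (exact_chain_dual opB opC (h := fun w => @hop K n 1 (cw w)) filtered_os).
- by rewrite map_inj_uniq ?enum_uniq // => i j /rowP/(_ j); rewrite !mxE !eqxx /=; case: eqP => // _ /eqP; rewrite eq_sym oner_eq0.
- by move=> w _; apply: hop0.
- move=> w f /mapP[b]; rewrite mem_enum => br ->.
  by rewrite op_hop dotE // eqxx scale1r.
- move=> u w f /mapP[b']; rewrite mem_enum => br' -> /mapP[b _ ->] bb'.
  apply/eqP; rewrite -addr_eq0 op_hop dotE //; case: (b' =P b) bb' => [->|_ _]; first by rewrite eqxx.
  by rewrite scale0r.
move=> w e f /mapP[b]; rewrite mem_enum => br -> _ [fJ fe]; split.
  move=> x /mem_os_module xJ; rewrite hopE; apply/fJ/mem_os_module; rewrite contrXE cE.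
  by apply: os_contr_indicator xJ => S; apply: splitM.
apply/lfunP => x; rewrite cutoffE !hopE -[in RHS]fe cutoffE; congr (f _); apply/fmodP => k.
rewrite contrXE !prXE contrXE pr_contr; congr (contr _ _); apply: eq_prE => t.
by rewrite intS lerBrDr addrC.
Qed.

(** For an [m]-set [T0] without representatives, [e_T0] is the boundary of [e_b e_T0] plus a
    multiple of [e_b]; by [fillM] that boundary lies in J for a suitable [b]. Hence J and the [e_b]
    generate everything in degrees at least [m]. *)
Lemma ker_reps0 d f : (m <= d)%N -> kerQs (@op K n 1) [seq delta_mx 0 b : V | b <- enum reps] Q d f -> f = 0.
Proof.
move=> md /kerQsP[[fJ fd] fr].
have fgen b x : b \in reps -> f (fmk (fun=> ext_gen K b * x)) = 0.
  move=> br; have /lfunP/(_ (fmk (fun=> x))) := fr _ (map_f _ (etrans (mem_enum _ b) br)).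
  rewrite opE zero_lfunE => <-; congr (f _); apply/fmodP => k; rewrite lmulXE !fmkE; congr (_ * _).
  rewrite /vec (bigD1 b) //= mxE !eqxx scale1r big1 ?addr0 // => i ib.
  by rewrite mxE (negPf ib) andbF scale0r.
have fD x y : f (fmk (fun=> x + y)) = f (fmk (fun=> x)) + f (fmk (fun=> y)).
  by rewrite -(linearD f); congr (f _); apply/fmodP => k; rewrite !ffunE.
have fZ a x : f (fmk (fun=> a *: x)) = a *: f (fmk (fun=> x)).
  by rewrite -linearZ; congr (f _); apply/fmodP => k; rewrite !ffunE.
have fbasis T : (m <= #|T|)%N -> f (fmk (fun=> ext_basis K T)) = 0.
  move=> mT; have [dT|/pred0Pn[b /andP[/= bT br]]] := boolP [disjoint T & reps]; last first.
    by rewrite (ext_basis_D1 _ bT) fZ fgen ?scaler0.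
  have /card_geqP[s [us ss sT]] := mT; pose T0 := [set i in s].
  have T0T : T0 \subset T by apply/subsetP => i; rewrite inE; apply: sT.
  have cT0 : #|T0| = m by rewrite cardsE (card_uniqP us).
  have [b br dbT] := fillM cT0 (disjointWl T0T dT).
  have bT0 : b \notin T0.
    by apply/negP => /(subsetP T0T) bT; rewrite (disjointFr dT bT) in br.
  rewrite (ext_basis_split T T0) (setIidPr T0T) fZ.
  have e : ext_basis K T0 = contr (ones K n) (ext_gen K b * ext_basis K T0)
      + ext_gen K b * bd T0 by rewrite contr_genM mxE scale1r subrK.
  rewrite e mulrDl -mulrA fD fgen // addr0 fJ ?scaler0 //; apply/mem_os_module; rewrite fmkE.
  apply: osMr; rewrite /ext_gen ext_basisM disjoints1 bT0 contrZ.
  exact/osZ/os_gen.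
apply/lfunP => x; rewrite zero_lfunE -fd cutoffE.
have -> : prX (fun _ t => d%:Z <= t) x = fmk (fun=> prE (fun t => d%:Z <= t) (x 0)).
  by apply/fmodP => k; rewrite prXE fmkE (ord1 k).
rewrite [prE _ _]ext_expand; elim/big_rec: _ => [|S y _ fy].
  by rewrite -[RHS](linear0 f); congr (f _); apply/fmodP => k; rewrite !ffunE.
rewrite fD fy addr0 fZ ext_coef_pr; case: ifP => [dS|_]; last by rewrite scale0r.
by rewrite fbasis ?scaler0 // (leq_trans md).
Qed.

Lemma os_linear_module : linear_module reps_first m os_module.
Proof.
split=> [u x /mem_os_module xJ|P x /mem_os_module xJ|x /mem_os_module xJ|i].
- by apply/mem_os_module; rewrite lmulXE; apply: osMl.
- by apply/mem_os_module; rewrite prXE; apply: os_pr.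
- by apply/fmodP => k; rewrite prXE (ord1 k) (os_low girthM xJ) ffunE.
apply/(reg_cat opB opC op2 i _ filtered_os (reps_exact m)) => d f md _ fQ _.
exists (fun=> 0) => [a|a _].
  by apply: filtered0; apply: filtered_kers filtered_os.
by rewrite (delta0 opB) (ker_reps0 md (fQ a)).
Qed.

Lemma os_linear_resolution : linear_resolution m J.
Proof.
apply: (linear_module_resolution reps_basis m_gt0 os_linear_module) => x.
by rewrite mem_os_module fmkE.
Qed.

End Blocks.

Local Close Scope ring_scope.

(** * The listed matroids have linear resolutions *)

Section Backward.
Variables (K : fieldType) (n : nat) (M : matroid 'I_n).
Local Notation J := (@orlik_solomon_ideal K n M).
Implicit Types (S T : {set 'I_n}) (b i j x y : 'I_n).

Lemma loop_linear : has_loop M -> linear_resolution 0 J.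
Proof.
case/existsP=> i di; apply: unit_linear_resolution => x.
have := osMl x (os_gen K di); rewrite -/(ext_gen K i) -[ext_gen K i]GRing.mulr1 contr_genM contr1.
by rewrite GRing.mulr0 GRing.subr0 mxE GRing.scale1r GRing.mulr1.
Qed.

Lemma free_linear m : (forall S, ~~ dependent M S) -> linear_resolution m J.
Proof.
move=> free; apply: zero_linear_resolution => x; split=> [|->]; last exact: os0.
elim/os_ind => [//|y z -> ->|a y ->|A S B dS]; rewrite ?GRing.addr0 ?GRing.scaler0 //.
by rewrite (negPf (free S)) in dS.
Qed.

Lemma rank1_sum_linear : ~~ has_loop M -> rank1_sum M -> linear_resolution 1 J.
Proof.
move=> nl [k [f [A [B [dA dB AB <- iM]]]]].
have depE S : dependent M S = ~~ [forall i, #|S :&: A i| <= 1].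
  by rewrite /dependent iM mem_rank1_dsum.
pose par x y := [exists i, (x \in A i) && (y \in A i)].
have parC x y : par x y = par y x by apply: eq_existsb => i; rewrite andbC.
have par_trans x y z : par x y -> par y z -> par x z.
  move=> /existsP[i /andP[xi yi]] /existsP[j /andP[yj zj]].
  have [e|/dA dij] := eqVneq i j; first by apply/existsP; exists i; rewrite xi e zj.
  by rewrite (disjointFr dij yi) in yj.
have eq_par x y : par x y -> par x =1 par y.
  move=> xy z; apply/idP/idP; last exact: par_trans.
  by apply: par_trans; rewrite parC.
have dep_pair x y S : par x y -> x != y -> x \in S -> y \in S -> dependent M S.
  move=> /existsP[i /andP[xi yi]] xy xS yS; rewrite depE; apply/forallPn; exists i.
  by rewrite -ltnNge; apply/card_gt1P; exists x, y; rewrite !inE xS xi yS yi.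
have dep_ex S : dependent M S -> exists x y, [/\ par x y, x != y, x \in S & y \in S].
  rewrite depE => /forallPn[i]; rewrite -ltnNge => /card_gt1P[x [y []]].
  rewrite !inE => /andP[xS xi] /andP[yS yi] xy; exists x, y; split=> //.
  by apply/existsP; exists i; rewrite xi.
(* Elements outside all the [A i] are parallel to nothing and become blocks of their own by the
   default value. *)
pose rep x := odflt x [pick y | par x y].
have rep_par x : (par x (rep x)) || (rep x == x).
  by rewrite /rep; case: pickP => [y ->|_] //=; rewrite eqxx orbT.
have rep_eq x y : par x y -> rep x = rep y.
  move=> xy; rewrite /rep (eq_pick (eq_par x y xy)).
  by case: pickP => // /(_ y); rewrite -(eq_par x y xy) xy.
apply: (@os_linear_resolution K n _ M rep) => //.
- by move=> S; apply: loopless_dependent.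
- move=> b S _ /dep_ex[x [y [xy ne xS yS]]]; have e := rep_eq _ _ xy.
  by have [xb|xb] := boolP (rep x == b); apply/orP; [left|right];
    apply: (dep_pair x y) => //; rewrite !inE ?xS ?yS -?e ?xb.
move=> T /eqP/cards1P[t ->]; rewrite disjoints1 inE => nt.
have pt : par t (rep t) by have := rep_par t; rewrite (negPf nt) orbF.
exists (rep t); first by rewrite inE -(rep_eq _ _ pt).
by apply: (dep_pair t (rep t)); rewrite // ?inE ?eqxx ?orbT // eq_sym.
Qed.

Lemma uniform_sum_linear m : simple_matroid M -> uniform_sum M m -> linear_resolution m J.
Proof.
move=> /andP[nl _] [f [A [B [_ dAB AB [_ <-] iM]]]].
have depE S : dependent M S = (m < #|S :&: A|).
  by rewrite /dependent iM mem_dsum_uniform // -ltnNge.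
have [m0|m_gt0] := posnP m.
  apply: free_linear => S; rewrite depE m0 -leqNgt leqn0 cards_eq0; apply/eqP/setP => i.
  rewrite !inE; apply/negbTE/negP => /andP[_ iA]; case/existsP: nl; exists i.
  by rewrite /loop depE m0 (setIidPl _) ?cards1 ?sub1set.
(* [A] is a single block, and every element outside it is a block by itself. *)
pose rep x := if x \in A then odflt x [pick y in A] else x.
have rep_in x : x \in A -> rep x \in A.
  by move=> xA; rewrite /rep xA; case: pickP => //.
have rep_const x y : x \in A -> y \in A -> rep x = rep y.
  by move=> xA yA; rewrite /rep xA yA; case: pickP => // /(_ x); rewrite xA.
have rep_out x : x \notin A -> rep x = x by rewrite /rep => /negPf ->.
apply: (@os_linear_resolution K n _ M rep) => //.
- by move=> S; rewrite depE => /leq_trans; apply; rewrite subset_leq_card ?subsetIl.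
- move=> b S; rewrite inE => /eqP rb; rewrite !depE => dS.
  have [bA|bA] := boolP (b \in A); apply/orP; [left|right].
    suff -> : S :&: [set i | rep i == b] :&: A = S :&: A by [].
    apply/setP => i; rewrite !inE; have [iA|//] := boolP (i \in A); last by rewrite !andbF.
    by rewrite (rep_const i b) // rb eqxx andbT.
  suff -> : (S :\: [set i | rep i == b]) :&: A = S :&: A by [].
  apply/setP => i; rewrite !inE; have [iA|//] := boolP (i \in A); last by rewrite !andbF.
  suff -> : (rep i == b) = false by [].
  by apply: contraNF bA => /eqP <-; apply: rep_in.
move=> T cT dT; have TA : T \subset A.
  apply/subsetP => t tT; have := disjointFr dT tT; rewrite inE => /negbT; apply: contraR => /rep_out ->.
  by rewrite eqxx.
have /card_gt0P[t tT] : 0 < #|T| by rewrite cT.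
have tA := subsetP TA t tT; exists (rep t); first by rewrite inE (rep_const _ t) ?rep_in.
have rT : rep t \notin T.
  by apply/negP => /(disjointFr dT); rewrite inE (rep_const _ t) ?eqxx ?rep_in.
rewrite depE (setIidPl _) ?cardsU1 ?rT ?cT //.
by rewrite subUset sub1set rep_in.
Qed.

End Backward.

Theorem theorem6p10 (K : fieldType)
    (K_infinite : forall s : seq K, exists x : K, x \notin s)
    (n m : nat) (M : matroid 'I_n) :
  linear_resolution m (@orlik_solomon_ideal K n M) <->
  [\/ has_loop M /\ m = 0%N,
      [/\ ~~ has_loop M, has_nontrivial_parallel_class M, m = 1%N &
        exists (k f : nat) (A : 'I_k -> {set 'I_n}) (B : {set 'I_n}),
          [/\ forall i j, i != j -> [disjoint A i & A j],
              forall i, [disjoint A i & B],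
              (\bigcup_i A i) :|: B = [set: 'I_n],
              #|B| = f &
              indep M = dsum (\big[@dsum 'I_n/[set set0]]_(i < k) uniform 1 (A i))
                             (uniform f B)]] |
      simple_matroid M /\
        exists (f : nat) (A B : {set 'I_n}),
          [/\ (f <= n)%N, [disjoint A & B], A :|: B = [set: 'I_n],
              #|A| = (n - f)%N /\ #|B| = f &
              indep M = dsum (uniform m A) (uniform f B)]].
Proof.
split=> [lin|]; first exact: linear_classification K_infinite lin.
case=> [[loop ->]|[nl _ -> r1]|[sM uM]].
- exact: loop_linear.
- exact: rank1_sum_linear.
- exact: uniform_sum_linear.
Qed.
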